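(* Let $d\ge1$, $s\in\left(\frac12,1\right)$, $T>0$, and assume: (j) $\beta\in C^1(\mathbb R)$, $\beta'(r)>0$ for all $r\in\mathbb R$, $\beta(0)=0$; (jj) $D\in L^\infty(\mathbb R^d;\mathbb R^d)$; (jjj) $b\in C^1(\mathbb R)$. Let $y_1,y_2\in L^\infty((0,T)\times\mathbb R^d)$ be two distributional solutions on $(0,T)\times\mathbb R^d$ to $$u_t+(-\Delta)^s\beta(u)+\operatorname{div}(D\,b(u)u)=0,\qquad u(0,\cdot)=u_0,$$ such that $y_1-y_2\in L^1((0,T)\times\mathbb R^d)\cap L^\infty(0,T;L^2)$ and $$\lim_{t\to0}\ \operatorname*{ess\,sup}_{\tau\in(0,t)}\big|(y_1(\tau)-y_2(\tau),\varphi)_2\big|=0\qquad\text{for all }\varphi\in C_0^\infty(\mathbb R^d).$$ Then $y_1\equiv y_2$. If $D\equiv0$, then hypothesis (j) can be relaxed to (j)$'$ $\beta\in C^1(\mathbb R)$, $\beta'(r)\ge0$ for all $r\in\mathbb R$, $\beta(0)=0$.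
   Context: $L^2=L^2(\mathbb R^d)$ with inner product $(\cdot,\cdot)_2$. $(-\Delta)^s$ is the fractional Laplacian, i.e. the Fourier multiplier with symbol $|\xi|^{2s}$. Here $u_0$ is a measure of finite variation on $\mathbb R^d$ and a distributional solution on $(0,T)\times\mathbb R^d$ is a function $u$ such that for all $\varphi\in C_0^\infty([0,T)\times\mathbb R^d)$, $$\int_0^T\!\!\int_{\mathbb R^d}\big(u\,\varphi_t-\beta(u)(-\Delta)^s\varphi+b(u)u\,D\cdot\nabla\varphi\big)dx\,dt+\int_{\mathbb R^d}\varphi(0,x)\,u_0(dx)=0 .$$ *)

(* Defs.v *)
From HB Require Import structures.
From mathcomp Require Import all_boot all_order all_algebra.
From mathcomp Require Import all_classical all_reals all_analysis.
From mathcomp Require Import ess_sup_inf complex.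

Set Implicit Arguments.
Unset Strict Implicit.
Unset Printing Implicit Defensive.

Import Order.TTheory GRing.Theory Num.Theory.
Import numFieldNormedType.Exports.

Local Open Scope classical_set_scope.
Local Open Scope ring_scope.

(* 'rV[R]_n carries the product sigma-algebra of the Borel sets of R, that is,
   the Borel sigma-algebra of R^n. *)
Definition measure_rV_display : measure_display -> measure_display.
Proof. exact. Qed.

Section measurable_rV.
Context {R : realType}.
Variable n : nat.

Let coord : 'I_n -> 'rV[R]_n -> R := fun i x => x ord0 i.

Let rV_set0 : g_sigma_preimage coord set0.
Proof. exact: sigma_algebra0. Qed.

Let rV_setC A : g_sigma_preimage coord A -> g_sigma_preimage coord (~` A).
Proof. exact: sigma_algebraC. Qed.

Let rV_bigcup (F : _^nat) : (forall i, g_sigma_preimage coord (F i)) ->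
  g_sigma_preimage coord (\bigcup_i (F i)).
Proof. exact: sigma_algebra_bigcup. Qed.

HB.instance Definition _ :=
  @isMeasurable.Build (measure_rV_display default_measure_display)
    'rV[R]_n (g_sigma_preimage coord) rV_set0 rV_setC rV_bigcup.

End measurable_rV.

Lemma measurable_coord (R : realType) n (i : 'I_n) :
  measurable_fun [set: 'rV[R]_n] (fun x : 'rV[R]_n => x ord0 i).
Proof.
move=> _ Y mY; rewrite setTI; apply: sub_sigma_algebra => /=.
rewrite -bigcup_seq/=; exists i => /=; first by rewrite mem_index_enum.
by exists Y => //; rewrite setTI.
Qed.

Lemma measurable_fun_rVP d (T : measurableType d) (R : realType) n
    (f : T -> 'rV[R]_n) :
  measurable_fun [set: T] f <->
  forall i, measurable_fun [set: T] (fun x => f x ord0 i).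
Proof.
split=> [mf i|mf].
  by apply: (measurableT_comp (measurable_coord i) mf).
move=> _ A mA.
suff : g_sigma_preimage (fun i (x : 'rV[R]_n) => x ord0 i) `<=`
    [set B | measurable (f @^-1` B)].
  by move=> /(_ A mA); rewrite setTI.
apply: smallest_sub.
  split => /=.
  - by rewrite preimage_set0.
  - by move=> B mB /=; rewrite setTD preimage_setC; exact: measurableC.
  - by move=> F mF /=; rewrite preimage_bigcup; exact: bigcupT_measurable.
case: n => [|n] in f A mf mA *; first by rewrite big_ord0.
rewrite -bigcup_mkord_ord; apply: bigcup_sub => i Ii.
by move=> B [C mC <-] /=; have := mf (inord i) measurableT C mC; rewrite !setTI.
Qed.

Section lebesgue_rV.
Context {R : realType}.

Definition rV_cons n (p : measurableTypeR R * 'rV[R]_n) : 'rV[R]_n.+1 :=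
  row_mx (p.1 : R)%:M p.2.

Lemma rV_cons0 n p : @rV_cons n p ord0 ord0 = p.1.
Proof.
have -> : ord0 = lshift n (ord0 : 'I_1) by apply: val_inj.
by rewrite [LHS](row_mxEl (p.1 : R)%:M p.2) mxE eqxx.
Qed.

Lemma rV_consS n p (i : 'I_n) : @rV_cons n p ord0 (lift ord0 i) = p.2 ord0 i.
Proof.
have -> : lift ord0 i = rshift 1 i by apply: val_inj.
by rewrite [LHS](row_mxEr (p.1 : R)%:M p.2).
Qed.

Lemma measurable_rV_cons n : measurable_fun [set: _] (@rV_cons n).
Proof.
apply/measurable_fun_rVP => i; case: (unliftP ord0 i) => [j|] ->.
  under eq_fun do rewrite rV_consS.
  exact: (measurableT_comp (measurable_coord j) measurable_snd).
by under eq_fun do rewrite rV_cons0; exact: measurable_fst.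
Qed.

HB.instance Definition _ n :=
  isMeasurableFun.Build _ _ _ _ (@rV_cons n) (@measurable_rV_cons n).

Definition rV_uncons n (x : 'rV[R]_n.+1) : measurableTypeR R * 'rV[R]_n :=
  (x ord0 ord0, \row_i x ord0 (lift ord0 i)).

Lemma measurable_rV_uncons n : measurable_fun [set: _] (@rV_uncons n).
Proof.
apply/measurable_fun_pairP; split; first exact: measurable_coord.
apply/measurable_fun_rVP => i /=.
by under eq_fun do rewrite mxE; exact: measurable_coord.
Qed.

Lemma rV_consK n : cancel (@rV_cons n) (@rV_uncons n).
Proof.
move=> [a v]; rewrite /rV_uncons rV_cons0; congr pair.
by apply/rowP => i; rewrite mxE rV_consS.
Qed.

Lemma rV_unconsK n : cancel (@rV_uncons n) (@rV_cons n).
Proof.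
move=> x; apply/rowP => i; case: (unliftP ord0 i) => [j|] ->.
  by rewrite rV_consS mxE.
by rewrite rV_cons0.
Qed.

Section step.
Variables (n : nat) (mu : {sigma_finite_measure set 'rV[R]_n -> \bar R}).

Definition lebesgue_rV_step : set 'rV[R]_n.+1 -> \bar R :=
  pushforward (@lebesgue_measure R \x mu)%E (@rV_cons n).

Let step0 : lebesgue_rV_step set0 = 0%E.
Proof. by rewrite /lebesgue_rV_step /pushforward preimage_set0 measure0. Qed.

Let step_ge0 A : (0 <= lebesgue_rV_step A)%E.
Proof. exact: measure_ge0. Qed.

Let step_sigma_additive : semi_sigma_additive lebesgue_rV_step.
Proof.
exact: measure_semi_sigma_additive.
Qed.

HB.instance Definition _ := isMeasure.Build _ _ _ lebesgue_rV_step
  step0 step_ge0 step_sigma_additive.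

Let step_sigma_finite : sigma_finite [set: 'rV[R]_n.+1] lebesgue_rV_step.
Proof.
have /sigma_finiteP[F [TF ndF Foo]] := sigma_finiteT (@lebesgue_measure R).
have /sigma_finiteP[G [TG ndG Goo]] := sigma_finiteT mu.
exists (fun k => @rV_uncons n @^-1` (F k `*` G k)).
  rewrite -preimage_bigcup -[LHS](preimage_setT (@rV_uncons n)); congr preimage.
  rewrite -setXTT TF TG; apply/seteqP; split=> -[x y].
    move=> [/= [i _ Fx] [k _ Gy]]; exists (maxn i k) => //; split.
    - by move: x Fx; exact/subsetPset/ndF/leq_maxl.
    - by move: y Gy; exact/subsetPset/ndG/leq_maxr.
  by move=> [k _ []/= ? ?]; split; exists k.
move=> k; have [mF Fk] := Foo k; have [mG Gk] := Goo k; split.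
  rewrite -[X in measurable X]setTI; apply: measurable_rV_uncons => //.
  exact: measurableX.
rewrite /lebesgue_rV_step /pushforward -comp_preimage.
rewrite (_ : _ \o _ = id) ?preimage_id; last exact/funext/rV_consK.
by rewrite product_measure1E// lte_mul_pinfty// ge0_fin_numE.
Qed.

HB.instance Definition _ := Measure_isSigmaFinite.Build _ _ _ lebesgue_rV_step
  step_sigma_finite.

End step.

Fixpoint lebesgue_rV n : {sigma_finite_measure set 'rV[R]_n -> \bar R} :=
  match n with
  | 0 => \d_ (0 : 'rV[R]_0)
  | n.+1 => lebesgue_rV_step (lebesgue_rV n)
  end.

Lemma lebesgue_rV_box n (A : 'I_n -> set R) :
  (forall i, measurable (A i)) ->
  (lebesgue_rV n [set x | forall i, A i (x ord0 i)] =
   \prod_(i < n) lebesgue_measure (A i))%E.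
Proof.
elim: n A => [|n IHn] A mA.
  by rewrite big_ord0 /= diracE mem_set//= => -[].
have mB : measurable [set x : 'rV[R]_n | forall i, A (lift ord0 i) (x ord0 i)].
  rewrite (_ : mkset _ = \big[setI/setT]_(i < n)
      ((fun x : 'rV[R]_n => x ord0 i) @^-1` A (lift ord0 i))).
    apply: bigsetI_measurable => i _.
    by rewrite -[X in measurable X]setTI; exact: measurable_coord.
  apply/seteqP; split=> x /=.
    by move=> Ax; rewrite -bigcap_seq => i /= _; exact: Ax.
  by rewrite -bigcap_seq => Ax i; apply: (Ax i) => /=; rewrite mem_index_enum.
rewrite big_ord_recl -(IHn (fun i => A (lift ord0 i)) (fun i => mA _))/= /lebesgue_rV_step /pushforward.
rewrite -(product_measure1E lebesgue_measure (lebesgue_rV n) (mA ord0) mB).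
congr product_measure1; apply/seteqP; split=> -[a v] /=.
  move=> Aav; split; first by have := Aav ord0; rewrite rV_cons0.
  by move=> i; have := Aav (lift ord0 i); rewrite rV_consS.
move=> [Aa Av] i; case: (unliftP ord0 i) => [j|] ->.
  by rewrite rV_consS; exact: Av.
by rewrite rV_cons0.
Qed.

End lebesgue_rV.

Section euclidean.
Context {R : realType} {d : nat}.
Implicit Types x y : 'rV[R]_d.

Definition dot x y : R := \sum_(i < d) x ord0 i * y ord0 i.

(* The library norm `|x| on 'rV[R]_d is the sup norm. *)
Definition enorm x : R := Num.sqrt (dot x x).

End euclidean.

Section fourier.
Context {R : realType} {d : nat}.
Local Notation E := 'rV[R]_d.
Local Open Scope complex_scope.

Definition cintegral (f : E -> R[i]) : R[i] :=
  (\int[lebesgue_rV d]_x complex.Re (f x)) +i*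
  (\int[lebesgue_rV d]_x complex.Im (f x)).

Definition cis (t : R) : R[i] := cos t +i* sin t.

Definition fourier (f : E -> R[i]) (xi : E) : R[i] :=
  cintegral (fun x => f x * cis (- dot x xi)).

Definition inverse_fourier (g : E -> R[i]) (x : E) : R[i] :=
  ((2 * pi) ^- d)%:C * cintegral (fun xi => g xi * cis (dot x xi)).

(* For a real even symbol m and a real f, the inverse transform below is real,
   so that taking its real part loses nothing. *)
Definition fourier_multiplier (m : E -> R) (f : E -> R) (x : E) : R :=
  complex.Re (inverse_fourier
    (fun xi => (m xi)%:C * fourier (fun y => (f y)%:C) xi) x).

Definition frac_laplacian (s : R) : (E -> R) -> E -> R :=
  fourier_multiplier (fun xi => enorm xi `^ (2 * s)).

End fourier.

Section test_functions.
Context {R : realType}.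

Definition C1 (f : R -> R) : Prop :=
  (forall r, derivable f r 1) /\ continuous (derive1 f).

(* All iterated directional derivatives exist and are Frechet differentiable. *)
Definition smooth (V : normedModType R) (f : V -> R) : Prop :=
  forall (vs : seq V) (x : V),
    differentiable (foldr (fun v (g : V -> R) => 'D_v g) f vs) x.

Definition Cc_smooth (V : normedModType R) (U : set V) (f : V -> R) : Prop :=
  [/\ smooth f, compact (closure [set x | f x != 0]) &
      closure [set x | f x != 0] `<=` U].

(* C_0^oo([0, T) x R^d): restrictions to t >= 0 of the smooth functions
   compactly supported in (-oo, T) x R^d; they need not vanish at t = 0. *)
Definition cauchy_test d (T : R) : (R * 'rV[R]_d -> R) -> Prop :=
  Cc_smooth [set z | z.1 < T].

End test_functions.

Section charge_integral.
Context d (E : measurableType d) (R : realType).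
Variable nu : {charge set E -> \bar R}.

Let P : set E := projT1 (cid (Hahn_decomposition nu)).
Let PN : {N | hahn_decomposition nu P N} :=
  cid (projT2 (cid (Hahn_decomposition nu))).

(* \int f d(nu), through the Jordan decomposition of nu; the value does not
   depend on the Hahn decomposition that is chosen. *)
Definition charge_integral (f : E -> R) : R :=
  \int[jordan_pos (projT2 PN)]_x f x - \int[jordan_neg (projT2 PN)]_x f x.

End charge_integral.

Section cauchy_problem.
Context {R : realType} {d : nat}.
Local Notation E := 'rV[R]_d.

Definition time_space_measure : {measure set (measurableTypeR R * E) -> \bar R} :=
  (@lebesgue_measure R \x lebesgue_rV d)%E.

Definition time_space (T : R) : set (R * E) := `]0, T[ `*` [set: E].

Definition time_derive (phi : R * E -> R) : R * E -> R := 'D_(1, 0) phi.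

Definition space_grad (phi : R * E -> R) (z : R * E) : E :=
  \row_(i < d) 'D_(0, delta_mx ord0 i) phi z.

Definition weak_integrand (s : R) (beta b : R -> R) (D : E -> E)
    (u phi : R * E -> R) (z : R * E) : R :=
  u z * time_derive phi z
  - beta (u z) * frac_laplacian s (fun x => phi (z.1, x)) z.2
  + b (u z) * u z * dot (D z.2) (space_grad phi z).

(* Integrability makes the integral meaningful; it is automatic when u and D
   are essentially bounded. *)
Definition distributional_solution (T s : R) (beta b : R -> R) (D : E -> E)
    (u0 : {charge set E -> \bar R}) (u : R * E -> R) : Prop :=
  forall phi : R * E -> R, cauchy_test T phi ->
    time_space_measure.-integrable (time_space T)
      (EFin \o weak_integrand s beta b D u phi) /\
    \int[time_space_measure]_(z in time_space T)
      weak_integrand s beta b D u phi z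
    + charge_integral u0 (fun x => phi (0, x)) = 0.

(* L^p((0, T) x R^d): only the values on the strip matter, u being extended by
   zero outside of it. *)
Definition Lp_time_space (T : R) (p : \bar R) (u : R * E -> R) : Prop :=
  (u \_ (time_space T) : measurableTypeR R * E -> R)
    \in Lfun time_space_measure p.

(* L^oo(0, T; L^2) for a jointly measurable w: L^2(R^d) is separable, so strong
   measurability of t |-> w(t, .) follows from joint measurability. *)
Definition Linfty_L2 (T : R) (w : R * E -> R) : Prop :=
  exists M : R, \forall t \ae @lebesgue_measure R, t \in `]0, T[ ->
    ((fun x => w (t, x)) \in Lfun (lebesgue_rV d) 2%:E) /\
    ('N[lebesgue_rV d]_2%:E[EFin \o (fun x => w (t, x))] <= M%:E)%E.

Definition Linfty_field (D : E -> E) : Prop :=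
  measurable_fun [set: E] D /\
  (fun x => enorm (D x)) \in Lfun (lebesgue_rV d) +oo%E.

Definition inner_L2 (f g : E -> R) : R :=
  \int[lebesgue_rV d]_x (f x * g x).

Definition vanishes_initially (w : R * E -> R) : Prop :=
  forall phi : E -> R, Cc_smooth [set: E] phi ->
    ess_sup (mrestr (@lebesgue_measure R) (measurable_itv `]0, t[))
      (fun tau => `|inner_L2 (fun x => w (tau, x)) phi|%:E)
    @[t --> 0^'+] --> 0%E.

End cauchy_problem.

(* Main.v *)
(* Subtracting the two weak formulations removes the initial measure: with
   z = y1 - y2, w = beta y1 - beta y2 and g = D (b y1 y1 - b y2 y2) one has
   z_t + (-Delta)^s w + div g = 0 with zero initial value, where |w|, |g| <= L |z|
   and, by monotonicity, k (w^2 + |g|^2 + z^2) <= 2 z w.  Testing against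
   theta(t) cos(x.xi + alpha), cut off on larger and larger boxes, yields for every
   frequency xi the differential equation Z' = F of the Fourier coefficient Z of z,
   so that Z^2 is twice the primitive of F Z.  With the weight
   m = 1/(1 + A |xi|^(2s)), Young's inequality and |xi|^2 = o(|xi|^(4s)), due to
   s > 1/2, bound 2 m F Z by -2 Z W + k (|W|^2 + |G|^2 + |Z|^2) + C m |Z|^2.  By
   Plancherel the first two terms integrate to a nonpositive number, so
   Gronwall's lemma applies to the integral of m |Z|^2 and gives z = 0.  Without
   drift g = 0, and k w^2 <= 2 z w is enough.

   Plancherel's identity is only needed up to a constant factor: it follows from
   Bessel's inequality, obtained with Fejer kernels, and from the explicit
   transforms of boxes, since the functions attaining equality form a closed
   subspace. *)
From HB Require Import structures.
From mathcomp Require Import all_boot all_order all_algebra.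
From mathcomp Require Import all_classical all_reals all_analysis.
From mathcomp Require Import measurable_realfun ess_sup_inf complex ring lra.
Require Import Defs.

Set Implicit Arguments.
Unset Strict Implicit.
Unset Printing Implicit Defensive.

Import Order.TTheory GRing.Theory Num.Theory.
Import numFieldNormedType.Exports.

Local Open Scope classical_set_scope.
Local Open Scope ring_scope.

(** * Integration of real functions *)

(** The fractional Laplacian of a cut-off wave is not compactly supported, so the cutoff does not
    localize the limit. What replaces this is a bound uniform in space: the transform of a cut-off
    wave sits within [1/N] of [xi] and [-xi], and after rescaling the fast decay of the transform of
    the bump dominates the growth of the symbol. Integrability of [z], with [|w|, |g| <= L |z|],
    then provides the majorant. The initial condition is carried by test functions that need not
    vanish at time 0: [z], extended by 0 to negative times, solves the equation on the whole
    half-line before [T]. The weight must contain the very constant [A] of the frequency equation,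
    because [m A |xi|^(2s) = 1 - m] is what turns the elliptic term into [-2 Z W] up to a term
    carrying the factor [m]. This [A] is the quotient of two limits produced by unnormalized
    cutoffs; it is never evaluated, and neither is the constant of Plancherel's identity, which
    multiplies all the quadratic terms alike. Only the positivity of both is used. The dissipation
    is known at each point [x], the energy estimate at each frequency [xi]; they meet only after
    integration. *)

Definition L1 d (T : measurableType d) (R : realType) (mu : set T -> \bar R)
  (f : T -> R) := mu.-integrable [set: T] (EFin \o f).

Section real_integration.
Context d (T : measurableType d) (R : realType).
Variable mu : {measure set T -> \bar R}.
Implicit Types f g : T -> R.

Lemma L1_measurable f : L1 mu f -> measurable_fun setT f.
Proof. by move=> /measurable_int /measurable_EFinP. Qed.

Lemma L1_le f g : measurable_fun setT f -> L1 mu g ->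
  (forall x, `|f x| <= g x) -> L1 mu f.
Proof.
move=> mf ig fg; apply: (le_integrable measurableT _ _ ig).
  exact/measurable_EFinP.
by move=> x _ /=; rewrite lee_fin (le_trans (fg x))// ler_norm.
Qed.

Lemma L1D f g : L1 mu f -> L1 mu g -> L1 mu (fun x => f x + g x).
Proof.
by move=> fi gi; rewrite /L1; apply: eq_integrable (integrableD measurableT fi gi).
Qed.

Lemma L1N f : L1 mu f -> L1 mu (fun x => - f x).
Proof. by move=> fi; apply: eq_integrable (integrableN fi). Qed.

Lemma L1B f g : L1 mu f -> L1 mu g -> L1 mu (fun x => f x - g x).
Proof. by move=> fi gi; apply: L1D => //; exact: L1N. Qed.

Lemma L1Z k f : L1 mu f -> L1 mu (fun x => k * f x).
Proof. by move=> fi; apply: eq_integrable (integrableZl measurableT k fi). Qed.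

Lemma L1_abs f : L1 mu f -> L1 mu (fun x => `|f x|).
Proof. by move=> fi; apply: eq_integrable (integrable_abse fi). Qed.

Lemma L1_0 : L1 mu (fun=> 0).
Proof. exact: integrable0. Qed.

Lemma L1_sum I (s : seq I) (f : I -> T -> R) :
  (forall i, L1 mu (f i)) -> L1 mu (fun x => \sum_(i <- s) f i x).
Proof.
move=> fi; elim: s => [|a s IH].
  by under eq_fun do rewrite big_nil; exact: L1_0.
by under eq_fun do rewrite big_cons; exact: L1D.
Qed.

Lemma L1_bounded_mul M f g : measurable_fun setT g -> (forall x, `|g x| <= M) ->
  L1 mu f -> L1 mu (fun x => g x * f x).
Proof.
move=> mg gM fi; apply: (@L1_le _ (fun x => M * `|f x|)).
- by apply: measurable_funM => //; exact: L1_measurable.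
- by apply: L1Z; exact: L1_abs.
- by move=> x; rewrite normrM ler_wpM2r.
Qed.

Lemma RintD f g : L1 mu f -> L1 mu g ->
  \int[mu]_x (f x + g x) = \int[mu]_x f x + \int[mu]_x g x.
Proof. by move=> fi gi; rewrite RintegralD. Qed.

Lemma RintB f g : L1 mu f -> L1 mu g ->
  \int[mu]_x (f x - g x) = \int[mu]_x f x - \int[mu]_x g x.
Proof. by move=> fi gi; rewrite RintegralB. Qed.

Lemma RintZ k f : L1 mu f -> \int[mu]_x (k * f x) = k * \int[mu]_x f x.
Proof. by move=> fi; rewrite RintegralZl. Qed.

Lemma RintN f : L1 mu f -> \int[mu]_x (- f x) = - \int[mu]_x f x.
Proof.
move=> fi; rewrite -[RHS]mulN1r -RintZ//.
by apply: eq_Rintegral => x _; rewrite mulN1r.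
Qed.

Lemma Rint_cst0 : \int[mu]_x (0 : R) = 0.
Proof. by rewrite /Rintegral integral0. Qed.

Lemma Rint_sum I (s : seq I) (f : I -> T -> R) : (forall i, L1 mu (f i)) ->
  \int[mu]_x (\sum_(i <- s) f i x) = \sum_(i <- s) \int[mu]_x f i x.
Proof.
move=> fi; elim: s => [|a s IH].
  by rewrite big_nil; under eq_Rintegral do rewrite big_nil; exact: Rint_cst0.
rewrite big_cons; under eq_Rintegral do rewrite big_cons.
by rewrite RintD ?IH//; exact: L1_sum.
Qed.

Lemma Rint_le f g : L1 mu f -> L1 mu g -> (forall x, f x <= g x) ->
  \int[mu]_x f x <= \int[mu]_x g x.
Proof. by move=> fi gi fg; apply: le_Rintegral. Qed.

Lemma Rint_ge0 f : (forall x, 0 <= f x) -> 0 <= \int[mu]_x f x.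
Proof. by move=> f0; apply: Rintegral_ge0. Qed.

Lemma Rint_norm f : L1 mu f -> `|\int[mu]_x f x| <= \int[mu]_x `|f x|.
Proof. by move=> fi; apply: le_normr_Rintegral. Qed.

Lemma EFin_Rint f : L1 mu f -> (\int[mu]_x f x)%:E = (\int[mu]_x (f x)%:E)%E.
Proof. by move=> fi; rewrite fineK//; apply: integrable_fin_num. Qed.

Lemma Rint_ae_eq f g : measurable_fun setT f -> measurable_fun setT g ->
  {ae mu, forall x, f x = g x} -> \int[mu]_x f x = \int[mu]_x g x.
Proof.
move=> mf mg fg; congr fine; apply: ae_eq_integral => //.
- exact/measurable_EFinP.
- exact/measurable_EFinP.
- by apply: filterS fg => x + _ => ->.
Qed.

Lemma L1_ae_eq f g : measurable_fun setT g ->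
  {ae mu, forall x, f x = g x} -> L1 mu f -> L1 mu g.
Proof.
move=> mg fg fi; apply/integrableP; split; first exact/measurable_EFinP.
move/integrableP: fi => [mf fi]; apply: le_lt_trans fi.
rewrite le_eqVlt; apply/orP; left; apply/eqP/esym/ae_eq_integral => //.
- by apply: measurableT_comp.
- by apply: measurableT_comp => //; exact/measurable_EFinP.
- by apply: filterS fg => x /= -> _.
Qed.

Lemma Rint_eq0_ae f : L1 mu f -> (forall x, 0 <= f x) -> \int[mu]_x f x = 0 ->
  {ae mu, forall x, f x = 0}.
Proof.
move=> fi f0 If0.
have : (\int[mu]_x `|(EFin \o f) x| = 0)%E.
  rewrite -[RHS]/(0%:E) -If0 EFin_Rint//.
  by apply: eq_integral => x _ /=; rewrite ger0_norm.
move/(ae_eq_integral_abs mu measurableT (measurable_int _ fi)).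
by apply: filterS => x /(_ I) []. 
Qed.

Lemma dominated_Rint (f_ : nat -> T -> R) f g :
  (forall n, measurable_fun setT (f_ n)) -> measurable_fun setT f ->
  (forall x, f_ n x @[n --> \oo] --> f x) -> L1 mu g ->
  (forall n x, `|f_ n x| <= g x) ->
  L1 mu f /\ \int[mu]_x f_ n x @[n --> \oo] --> \int[mu]_x f x.
Proof.
move=> mf_ mf cf ig fg.
have [||||i _ c] := @dominated_convergence _ _ _ mu _ measurableT
   (fun n => EFin \o f_ n) (EFin \o f) (EFin \o g) _ _ _ ig.
- by move=> n; exact/measurable_EFinP.
- exact/measurable_EFinP.
- by apply: aeW => x _; apply/fine_cvgP; split; [exact: nearW|exact: cf].
- by apply: aeW => x n _ /=; rewrite lee_fin.
split; first exact: i.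
apply: fine_cvg; rewrite fineK//; exact: integrable_fin_num i.
Qed.

End real_integration.

(** * Measurability and Fubini's theorem for real integrals *)

Section real_fubini.
Context d1 d2 (T1 : measurableType d1) (T2 : measurableType d2) (R : realType).
Variable m1 : {sigma_finite_measure set T1 -> \bar R}.
Variable m2 : {sigma_finite_measure set T2 -> \bar R}.

(** Tonelli makes the integrals of the positive and negative parts measurable in the parameter; the
    real integral is [fine] of their difference, also where these integrals are infinite. *)
Lemma measurable_Rint2 (f : T1 -> T2 -> R) :
  measurable_fun setT (fun p => f p.1 p.2) ->
  measurable_fun setT (fun x => \int[m2]_y f x y).
Proof.
move=> mf; apply: measurableT_comp => //.
rewrite (_ : (fun x => _) = fun x =>
   (\int[m2]_y (fun p => (f p.1 p.2)%:E)^\+ (x, y)) -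
   (\int[m2]_y (fun p => (f p.1 p.2)%:E)^\- (x, y)))%E; last first.
  by apply/funext => x; rewrite integralE; congr (_ - _)%E; apply: eq_integral => y _; rewrite ?funeposE ?funenegE.
have mf' : measurable_fun setT (fun p : T1 * T2 => (f p.1 p.2)%:E) by exact/measurable_EFinP.
apply: emeasurable_funB.
- apply: (@measurable_fun_fubini_tonelli_F _ _ _ _ _ m2 (fun p => (f p.1 p.2)%:E)^\+%E) => //.
  exact: measurable_funepos.
- apply: (@measurable_fun_fubini_tonelli_F _ _ _ _ _ m2 (fun p => (f p.1 p.2)%:E)^\-%E) => //.
  exact: measurable_funeneg.
Qed.

Lemma measurable_Rint1 (f : T1 -> T2 -> R) :
  measurable_fun setT (fun p => f p.1 p.2) ->
  measurable_fun setT (fun y => \int[m1]_x f x y).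
Proof.
move=> mf; apply: measurableT_comp => //.
rewrite (_ : (fun x => _) = fun y =>
   (\int[m1]_x (fun p => (f p.1 p.2)%:E)^\+ (x, y)) -
   (\int[m1]_x (fun p => (f p.1 p.2)%:E)^\- (x, y)))%E; last first.
  by apply/funext => x; rewrite integralE; congr (_ - _)%E; apply: eq_integral => y _; rewrite ?funeposE ?funenegE.
have mf' : measurable_fun setT (fun p : T1 * T2 => (f p.1 p.2)%:E) by exact/measurable_EFinP.
apply: emeasurable_funB.
- apply: (@measurable_fun_fubini_tonelli_G _ _ _ _ _ m1 (fun p => (f p.1 p.2)%:E)^\+%E) => //.
  exact: measurable_funepos.
- apply: (@measurable_fun_fubini_tonelli_G _ _ _ _ _ m1 (fun p => (f p.1 p.2)%:E)^\-%E) => //.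
  exact: measurable_funeneg.
Qed.

(** The section at [x] is integrable only for almost every [x]; elsewhere the inner real integral
    may differ from the extended one, whence the detour through almost everywhere equality. *)
Lemma Rfubini1 (f : T1 * T2 -> R) : L1 (m1 \x m2)%E f ->
  \int[(m1 \x m2)%E]_z f z = \int[m1]_x \int[m2]_y f (x, y).
Proof.
move=> fi; rewrite {1}/Rintegral -integral12_prod_meas1//.
congr fine; apply: ae_eq_integral => //.
- exact: (measurable_fubini_F fi).
- apply/measurable_EFinP; apply: (@measurable_Rint2 (fun x y => f (x, y))).
  rewrite (_ : (fun p => _) = f); last by apply/funext => -[].
  exact: L1_measurable fi.
- apply: filterS (ae_integrable1 fi) => x i _.
  by rewrite /fubini_F EFin_Rint.
Qed.

Lemma Rfubini2 (f : T1 * T2 -> R) : L1 (m1 \x m2)%E f ->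
  \int[(m1 \x m2)%E]_z f z = \int[m2]_y \int[m1]_x f (x, y).
Proof.
move=> fi; rewrite {1}/Rintegral -integral21_prod_meas1//.
congr fine; apply: ae_eq_integral => //.
- exact: (measurable_fubini_G fi).
- apply/measurable_EFinP; apply: (@measurable_Rint1 (fun x y => f (x, y))).
  rewrite (_ : (fun p => _) = f); last by apply/funext => -[].
  exact: L1_measurable fi.
- apply: filterS (ae_integrable2 fi) => x i _.
  by rewrite /fubini_G EFin_Rint.
Qed.

Lemma L1_fubini1 (f : T1 * T2 -> R) : L1 (m1 \x m2)%E f ->
  L1 m1 (fun x => \int[m2]_y f (x, y)).
Proof.
move=> fi; apply/integrableP; split.
  apply/measurable_EFinP; apply: (@measurable_Rint2 (fun x y => f (x, y))).
  rewrite (_ : (fun p => _) = f); last by apply/funext => -[].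
  exact: L1_measurable fi.
have /integrableP[mF] := integrable_fubini_F fi.
apply: le_lt_trans; rewrite le_eqVlt; apply/orP; left; apply/eqP.
apply: ae_eq_integral => //.
- apply: measurableT_comp => //; apply/measurable_EFinP.
  apply: (@measurable_Rint2 (fun x y => f (x, y))).
  rewrite (_ : (fun p => _) = f); last by apply/funext => -[].
  exact: L1_measurable fi.
- by apply: measurableT_comp.
- apply: filterS (ae_integrable1 fi) => x i _ /=.
  by rewrite /fubini_F -EFin_Rint.
Qed.

Lemma L1_fubini2 (f : T1 * T2 -> R) : L1 (m1 \x m2)%E f ->
  L1 m2 (fun y => \int[m1]_x f (x, y)).
Proof.
move=> fi; have mf := L1_measurable fi.
apply/integrableP; split.
  apply/measurable_EFinP; apply: (@measurable_Rint1 (fun x y => f (x, y))).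
  by rewrite (_ : (fun p => _) = f); last by apply/funext => -[].
have mEf : measurable_fun setT (EFin \o f) by exact/measurable_EFinP.
apply: le_lt_trans ((integrable21ltyP m1 m2 mEf).1 fi).
apply: ge0_le_integral => //.
- apply: measurableT_comp => //; apply/measurable_EFinP.
  apply: (@measurable_Rint1 (fun x y => f (x, y))).
  by rewrite (_ : (fun p => _) = f); last by apply/funext => -[].
- apply: (@measurable_fun_fubini_tonelli_G _ _ _ _ _ m1 (abse \o (EFin \o f))) => [|y]; last exact: abse_ge0.
  exact: measurableT_comp.
- move=> y _ /=; apply: (@le_trans _ _ `|\int[m1]_x (f (x, y))%:E|%E).
    (* An infinite inner integral is read as 0 by [fine], which can only decrease its absolute
       value. *)
    by rewrite /Rintegral; case: (\int[m1]_x (f (x, y))%:E)%E => //=; rewrite ?normr0 ?leey.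
  apply: le_abse_integral => //.
  by apply/measurable_EFinP; apply: (measurableT_comp mf); exact: pair2_measurable.
Qed.

Lemma Rint_swap (f : T1 -> T2 -> R) : L1 (m1 \x m2)%E (fun p => f p.1 p.2) ->
  \int[m1]_x \int[m2]_y f x y = \int[m2]_y \int[m1]_x f x y.
Proof. by move=> fi; rewrite -(Rfubini1 fi) (Rfubini2 fi). Qed.

Lemma L1_prod (f : T1 -> R) (g : T2 -> R) : L1 m1 f -> L1 m2 g ->
  L1 (m1 \x m2)%E (fun p => f p.1 * g p.2).
Proof.
move=> fi gi.
have mf := L1_measurable fi; have mg := L1_measurable gi.
apply/(integrable12ltyP).
  apply/measurable_EFinP; apply: measurable_funM.
    by apply: (measurableT_comp mf measurable_fst).
  by apply: (measurableT_comp mg measurable_snd).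
rewrite /=; under eq_integral => x _.
  under eq_integral do rewrite normrM EFinM.
  rewrite ge0_integralZl//; last by apply/measurable_EFinP; exact: measurableT_comp.
  over.
rewrite /= ge0_integralZr//; last 2 first.
  by apply/measurable_EFinP; exact: measurableT_comp.
  by apply: integral_ge0.
have /integrableP[_ /= fo] := fi; have /integrableP[_ /= go] := gi.
by rewrite lte_mul_pinfty// ?integral_ge0// ge0_fin_numE ?integral_ge0.
Qed.

(* A criterion in which the inner integrals are majorized, so that no
   integrability on the product has to be known beforehand. *)
Lemma L1_prod_le (f : T1 -> T2 -> R) (h : T1 -> R) :
  measurable_fun setT (fun p => f p.1 p.2) -> L1 m1 h ->
  (forall x, (\int[m2]_y `|f x y|%:E <= (h x)%:E)%E) ->
  L1 (m1 \x m2)%E (fun p => f p.1 p.2).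
Proof.
move=> mf hi fh; apply/integrable12ltyP; first exact/measurable_EFinP.
have /integrableP[mh hoo] := hi; apply: le_lt_trans hoo.
apply: ge0_le_integral => //.
- by move=> x _; exact: integral_ge0.
- apply: (@measurable_fun_fubini_tonelli_F _ _ _ _ _ m2
    (abse \o (EFin \o (fun p => f p.1 p.2)))) => [|y]; last exact: abse_ge0.
  by apply: measurableT_comp => //; exact/measurable_EFinP.
- by apply: measurableT_comp.
- by move=> x _ /=; rewrite (le_trans (fh x))// lee_fin ler_norm.
Qed.

End real_fubini.
Section product_sigma_finite.
Context d1 d2 (T1 : measurableType d1) (T2 : measurableType d2) (R : realType).
Variable m1 : {sigma_finite_measure set T1 -> \bar R}.
Variable m2 : {sigma_finite_measure set T2 -> \bar R}.

Let prod_sigma_finite : sigma_finite [set: T1 * T2] (m1 \x m2)%E.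
Proof.
have /sigma_finiteP[F [FT ndF Foo]] := sigma_finiteT m1.
have /sigma_finiteP[G [GT ndG Goo]] := sigma_finiteT m2.
exists (fun k => F k `*` G k).
  rewrite -setXTT FT GT; apply/seteqP; split=> -[x y].
    move=> [/= [i _ Fx] [j _ Gy]]; exists (maxn i j) => //; split => /=.
    - exact: (subsetPset _ _ (ndF _ _ (leq_maxl i j))).
    - exact: (subsetPset _ _ (ndG _ _ (leq_maxr i j))).
  by move=> [k _ []]; split; exists k.
move=> k; have [mF Fk] := Foo k; have [mG Gk] := Goo k; split.
  exact: measurableX.
by rewrite product_measure1E// lte_mul_pinfty// ge0_fin_numE.
Qed.

(* [m1 \x m2] under a name that can carry a sigma-finite instance, as iterated
   products require. *)
Definition prod_measure : set (T1 * T2) -> \bar R := (m1 \x m2)%E.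

HB.instance Definition _ := Measure.on prod_measure.

HB.instance Definition _ := Measure_isSigmaFinite.Build _ _ _ prod_measure prod_sigma_finite.
End product_sigma_finite.

(** * Changes of variables and product functions on R^n *)

Lemma measurable_cos (R : realType) : measurable_fun [set: R] (@cos R).
Proof. apply: continuous_measurable_fun; exact: continuous_cos. Qed.

Lemma normr_cos_le1 (R : realType) (x : R) : `|cos x| <= 1.
Proof. by rewrite ler_norml cos_geN1 cos_le1. Qed.

Section change_of_variables.
Context d (T : measurableType d) (R : realType).
Variable mu : {measure set T -> \bar R}.
Variables (phi : T -> T) (k : R).
Hypotheses (mphi : measurable_fun setT phi) (k0 : 0 < k).
Hypothesis phiE : forall f : T -> \bar R, measurable_fun setT f ->
  (forall x, 0 <= f x)%E ->
  (\int[mu]_x f (phi x) = k%:E * \int[mu]_x f x)%E.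

(** As [k] is positive and finite, the integrals of both parts of [f] stay finite or infinite under
    the change; when one is infinite, both sides are 0. *)
Lemma Rint_change (f : T -> R) : measurable_fun setT f ->
  \int[mu]_x f (phi x) = k * \int[mu]_x f x.
Proof.
move=> mf; have mEf : measurable_fun setT (EFin \o f) by exact/measurable_EFinP.
rewrite /Rintegral integralE [in RHS]integralE.
have -> : (\int[mu]_x (fun x => (f (phi x))%:E)^\+ x)%E =
    (k%:E * \int[mu]_x (EFin \o f)^\+ x)%E.
  rewrite -phiE; last 2 first.
    exact: measurable_funepos.
    by move=> x; exact: funepos_ge0.
  by apply: eq_integral => x _; rewrite !funeposE.
have -> : (\int[mu]_x (fun x => (f (phi x))%:E)^\- x)%E =
    (k%:E * \int[mu]_x (EFin \o f)^\- x)%E.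
  rewrite -phiE; last 2 first.
    exact: measurable_funeneg.
    by move=> x; exact: funeneg_ge0.
  by apply: eq_integral => x _; rewrite !funenegE.
have p0 : (0 <= \int[mu]_x (EFin \o f)^\+ x)%E by exact: integral_ge0.
have q0 : (0 <= \int[mu]_x (EFin \o f)^\- x)%E by exact: integral_ge0.
rewrite /=.
move: (\int[mu]_x (EFin \o f)^\+ x)%E (\int[mu]_x (EFin \o f)^\- x)%E p0 q0.
case=> [p||] [q||] //= _ _; rewrite ?(gt0_muley, gt0_mulye, lte_fin)//=.
- by rewrite mulrBr.
- by rewrite mulr0.
- by rewrite mulr0.
- by rewrite mulr0.
Qed.

Lemma L1_change (f : T -> R) : L1 mu f -> L1 mu (fun x => f (phi x)).
Proof.
move=> /integrableP[mf foo]; apply/integrableP; split.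
  exact: (measurableT_comp mf mphi).
have := @phiE (fun x => `|(f x)%:E|%E).
rewrite /= => -> //=; last first.
  by apply/measurable_EFinP; apply: measurableT_comp => //; exact/measurable_EFinP.
by rewrite lte_mul_pinfty// lee_fin ltW.
Qed.

End change_of_variables.

Section lebesgue_affine.
Context {R : realType}.
Local Notation leb := (@lebesgue_measure R).

Lemma measurable_affine (c b : R) : measurable_fun [set: R] (fun x : R => c * x + b).
Proof. by apply: measurable_funD => //; exact: measurable_funM. Qed.

(** [c] times the image of Lebesgue measure under the affine map gives each []u, v]] its length,
    hence is Lebesgue measure by uniqueness. *)
Lemma ge0_integral_affine (c b : R) (f : R -> \bar R) : 0 < c ->
  measurable_fun [set: R] f -> (forall x, 0 <= f x)%E ->
  (\int[leb]_x f (c * x + b)%R = (c^-1)%R%:E * \int[leb]_x f x)%E.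
Proof.
move=> c0 mf f0.
pose phi := (fun x : R => c * x + b) : measurableTypeR R -> measurableTypeR R.
have mphi : measurable_fun setT phi by exact: measurable_affine.
pose c' := NngNum (ltW c0).
pose nu := mscale c'
  (measure_function_pushforward__canonical__measure_function_Measure leb mphi).
have nuE A : measurable A -> leb A = nu A.
  move=> mA; apply: (@lebesgue_measure_unique R nu) => // X [[u v]] _ <-.
  have phiuv : phi @^-1` `]u, v] = `](u - b) / c, (v - b) / c]%classic.
    apply/seteqP; split => x /=; rewrite !in_itv/= ltr_pdivrMr// ler_pdivlMr// /phi;
      by move=> /andP[? ?]; apply/andP; split; nra.
  transitivity (c%:E * leb (phi @^-1` `]u, v]))%E => //; rewrite phiuv.
  rewrite !lebesgue_measure_itv/= !lte_fin ltr_pM2r ?invr_gt0// ltrD2r.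
  case: ifPn => uv; last by rewrite mule0.
  by rewrite -!EFinD -EFinM; congr EFin; field; rewrite gt_eqF.
have -> : (\int[leb]_x f x = \int[nu]_x f x)%E.
  by apply: eq_measure_integral => A mA _; exact: nuE.
rewrite ge0_integral_mscale// muleA -EFinM mulVf ?gt_eqF// mul1e.
by rewrite ge0_integral_pushforward.
Qed.

End lebesgue_affine.

Section lebesgue_rV.
Context {R : realType}.
Local Notation leb := (@lebesgue_measure R).
Local Notation lebn := (@lebesgue_rV R).

Lemma ge0_integral_rV_cons n (f : 'rV[R]_n.+1 -> \bar R) :
  measurable_fun setT f -> (forall x, 0 <= f x)%E ->
  (\int[lebn n.+1]_x f x = \int[leb]_a \int[lebn n]_v f (rV_cons (a, v)))%E.
Proof.
move=> mf f0.
transitivity (\int[(leb \x lebn n)%E]_p (f \o @rV_cons R n) p)%E.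
  exact: (@ge0_integral_pushforward _ _ _ _ _ _ (@measurable_rV_cons R n) _ setT).
rewrite fubini_tonelli1//; last by move=> x; exact: f0.
exact: (measurableT_comp mf (@measurable_rV_cons R n)).
Qed.

Lemma L1_rV_cons n (f : 'rV[R]_n.+1 -> R) : measurable_fun setT f ->
  L1 (lebn n.+1) f <-> L1 (leb \x lebn n)%E (f \o @rV_cons R n).
Proof.
move=> mf.
have mEf : measurable_fun setT (EFin \o f) by exact/measurable_EFinP.
have E : (\int[lebn n.+1]_x `|(f x)%:E| =
          \int[(leb \x lebn n)%E]_p `|(f (rV_cons p))%:E|)%E.
  apply: (@ge0_integral_pushforward _ _ _ _ _ _ (@measurable_rV_cons R n) _ setT
    (fun x => `|(f x)%:E|%E)) => //.
  exact: measurableT_comp.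
split => /integrableP[_ foo]; apply/integrableP; split => //; first last.
- by move: foo => /=; rewrite E.
- by move: foo => /=; rewrite E.
- apply/measurable_EFinP; exact: (measurableT_comp mf (@measurable_rV_cons R n)).
Qed.

Lemma Rint_rV_cons n (f : 'rV[R]_n.+1 -> R) : L1 (lebn n.+1) f ->
  \int[lebn n.+1]_x f x = \int[leb]_a \int[lebn n]_v f (rV_cons (a, v)).
Proof.
move=> fi; have mf := L1_measurable fi.
have fi' := (L1_rV_cons mf).1 fi.
rewrite -(Rfubini1 fi') /Rintegral; congr fine.
apply: (@integral_pushforward _ _ _ _ _ _ (@measurable_rV_cons R n) _ setT (EFin \o f)) => //.
exact/measurable_EFinP.
Qed.

Lemma Rint_rV0 (f : 'rV[R]_0 -> R) : \int[lebn 0]_x f x = f 0.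
Proof.
rewrite /Rintegral /= (_ : (fun x => _) = cst (f 0)%:E); last first.
  by apply/funext => x; rewrite (_ : x = 0)//; apply/rowP => -[].
rewrite integral_cst//.
transitivity (fine ((f 0)%:E * \d_(0%R : 'rV[R]_0) [set: 'rV[R]_0])%E) => //.
by rewrite diracT mule1.
Qed.

Lemma L1_rV0 (f : 'rV[R]_0 -> R) : L1 (lebn 0) f.
Proof.
rewrite /L1 (_ : EFin \o f = cst (f 0)%:E); last first.
  by apply/funext => x /=; rewrite (_ : x = 0)//; apply/rowP => -[].
by apply: finite_measure_integrable_cst.
Qed.

Lemma dot_rV_consl n (p : R * 'rV[R]_n) (q : 'rV[R]_n.+1) :
  dot (rV_cons p) q = p.1 * q ord0 ord0 + dot p.2 (\row_i q ord0 (lift ord0 i)).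
Proof.
rewrite /dot big_ord_recl !rV_cons0; congr (_ + _).
by apply: eq_bigr => i _; rewrite !rV_consS mxE.
Qed.

Lemma measurable_dot d (T : measurableType d) n (f g : T -> 'rV[R]_n) :
  measurable_fun setT f -> measurable_fun setT g ->
  measurable_fun setT (fun x => dot (f x) (g x)).
Proof.
move=> /measurable_fun_rVP mf /measurable_fun_rVP mg.
by apply: measurable_sum => i; exact: measurable_funM.
Qed.

Lemma L1_rV_prod n (F : 'I_n -> R -> R) : (forall i, L1 leb (F i)) ->
  L1 (lebn n) (fun x => \prod_(i < n) F i (x ord0 i)).
Proof.
elim: n F => [|n IH] F Fi; first exact: L1_rV0.
apply/L1_rV_cons.
  apply: measurable_prod => i _.
  exact: (measurableT_comp (L1_measurable (Fi i)) (@measurable_coord R _ i)).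
rewrite (_ : _ \o _ = fun p : R * 'rV[R]_n => F ord0 p.1 * \prod_(i < n) F (lift ord0 i) (p.2 ord0 i)).
  apply: (@L1_prod _ _ _ _ R leb (lebn n) (F ord0)
    (fun v => \prod_(i < n) F (lift ord0 i) (v ord0 i))) => //; exact: (IH (fun i => F (lift ord0 i)) (fun i => Fi _)).
apply/funext => p /=; rewrite big_ord_recl rV_cons0; congr (_ * _).
by apply: eq_bigr => i _; rewrite rV_consS.
Qed.

Lemma Rint_rV_prod n (F : 'I_n -> R -> R) : (forall i, L1 leb (F i)) ->
  \int[lebn n]_x (\prod_(i < n) F i (x ord0 i)) = \prod_(i < n) \int[leb]_x F i x.
Proof.
elim: n F => [|n IH] F Fi; first by rewrite Rint_rV0 !big_ord0.
have Pi := @L1_rV_prod n (fun i => F (lift ord0 i)) (fun i => Fi _).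
rewrite Rint_rV_cons; last exact: (L1_rV_prod Fi).
rewrite big_ord_recl -(IH (fun i => F (lift ord0 i)))// mulrC -RintZ//.
apply: eq_Rintegral => a _; rewrite mulrC -RintZ; last exact: Pi.
apply: eq_Rintegral => v _; rewrite big_ord_recl rV_cons0; congr (_ * _).
by apply: eq_bigr => i _; rewrite rV_consS.
Qed.

(* Each factor is supposed to have a real Fourier transform up to a phase;
   iterating over all phases [b] is what makes the induction work. *)
Lemma Rint_rV_prod_cos n (F : 'I_n -> R -> R) (xi : 'rV[R]_n) (th a : 'I_n -> R) :
  (forall i, L1 leb (F i)) ->
  (forall i b, \int[leb]_x (F i x * cos (x * xi ord0 i + b)) = cos (th i + b) * a i) ->
  forall b, \int[lebn n]_x ((\prod_(i < n) F i (x ord0 i)) * cos (dot x xi + b))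
    = cos (\sum_i th i + b) * \prod_i a i.
Proof.
elim: n F xi th a => [|n IH] F xi th a Fi FE b.
  by rewrite Rint_rV0 !big_ord0 /dot big_ord0 mulr1 mul1r.
have Pi := @L1_rV_prod n (fun i => F (lift ord0 i)) (fun i => Fi _).
have mcos m (v : 'rV[R]_m) (c : R) :
    measurable_fun setT (fun x : 'rV[R]_m => cos (dot x v + c)).
  apply: (measurableT_comp (@measurable_cos R)).
  by apply: measurable_funD => //; apply: measurable_dot.
rewrite Rint_rV_cons; last first.
  under eq_fun do rewrite mulrC.
  apply: (@L1_bounded_mul _ _ _ _ 1); last exact: (L1_rV_prod Fi).
    exact: mcos.
  by move=> x; exact: normr_cos_le1.
rewrite !big_ord_recl.
transitivity (\int[leb]_x ((\prod_(i < n) a (lift ord0 i)) *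
    (F ord0 x * cos (x * xi ord0 ord0 + (\sum_(i < n) th (lift ord0 i) + b))))).
  apply: eq_Rintegral => x _.
  have := IH (fun i => F (lift ord0 i)) (\row_i xi ord0 (lift ord0 i))
    (fun i => th (lift ord0 i)) (fun i => a (lift ord0 i)) (fun i => Fi _) _
    (x * xi ord0 ord0 + b).
  have H i c : \int[leb]_x0 (F (lift ord0 i) x0 *
      cos (x0 * (\row_i0 xi ord0 (lift ord0 i0)) ord0 i + c)) =
      cos (th (lift ord0 i) + c) * a (lift ord0 i).
    by rewrite mxE FE.
  move=> /(_ H) {}H.
  rewrite [RHS]mulrC -mulrA (addrCA (x * _)) -H -RintZ; last first.
    under eq_fun do rewrite mulrC.
    apply: (@L1_bounded_mul _ _ _ _ 1); last exact: Pi.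
      exact: mcos.
    by move=> y; exact: normr_cos_le1.
  apply: eq_Rintegral => y _.
  rewrite big_ord_recl rV_cons0 dot_rV_consl /= -mulrA; congr (_ * (_ * cos _)).
    by apply: eq_bigr => i _; rewrite rV_consS.
  by rewrite addrA (addrC (dot _ _)).
rewrite RintZ; first by rewrite FE; rewrite mulrC -mulrA addrA.
under eq_fun do rewrite mulrC.
apply: (@L1_bounded_mul _ _ _ _ 1) => //.
  apply: (measurableT_comp (@measurable_cos R)).
  by apply: measurable_funD => //; apply: measurable_funM.
by move=> x; exact: normr_cos_le1.
Qed.

Lemma measurable_rV_affine n (c : R) (b : 'rV[R]_n) :
  measurable_fun setT (fun x : 'rV[R]_n => c *: x + b).
Proof.
apply/measurable_fun_rVP => i.
under eq_fun do rewrite !mxE.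
by apply: measurable_funD => //; apply: measurable_funM => //; exact: measurable_coord.
Qed.

Lemma ge0_integral_rV_affine n (c : R) (b : 'rV[R]_n) (f : 'rV[R]_n -> \bar R) :
  0 < c -> measurable_fun setT f -> (forall x, 0 <= f x)%E ->
  (\int[lebn n]_x f (c *: x + b)%R = (c^-1 ^+ n)%R%:E * \int[lebn n]_x f x)%E.
Proof.
move=> c0; elim: n b f => [|n IH] b f mf f0.
  rewrite expr0 mul1e; apply: eq_integral => x _; congr f.
  by apply/rowP => -[].
rewrite ge0_integral_rV_cons//; last first.
  exact: (measurableT_comp mf (@measurable_rV_affine _ c b)).
rewrite [in RHS]ge0_integral_rV_cons//.
pose b0 := b ord0 ord0; pose b' := \row_i b ord0 (lift ord0 i).
pose G a := (\int[lebn n]_v f (rV_cons (a, v)))%E.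
have mfc : measurable_fun setT (f \o @rV_cons R n).
  exact: (measurableT_comp mf (@measurable_rV_cons R n)).
have G0 a : (0 <= G a)%E by apply: integral_ge0.
have mG : measurable_fun setT G.
  apply: (@measurable_fun_fubini_tonelli_F _ _ _ _ _ (lebn n) (f \o @rV_cons R n)) => //=.
transitivity (\int[leb]_a ((c^-1 ^+ n)%R%:E * G (c * a + b0)%R))%E.
  apply: eq_integral => a _; rewrite /G.
  rewrite -(IH b' (fun v => f (rV_cons (c * a + b0, v)))) //; last first.
    exact: (measurableT_comp mfc (pair1_measurable _)).
  apply: eq_integral => v _; congr f; apply/rowP => i.
  rewrite [LHS]mxE [X in X + _]mxE; case: (unliftP ord0 i) => [j|] ->.
    by rewrite !rV_consS [RHS]mxE [X in _ = X + _]mxE [X in _ = _ + X]mxE.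
  by rewrite !rV_cons0.
have mGc : measurable_fun setT (fun a => G (c * a + b0)).
  exact: (measurableT_comp mG (@measurable_affine R c b0)).
have cn0 : (0 <= (c^-1 ^+ n)%:E)%E by rewrite lee_fin exprn_ge0// invr_ge0 ltW.
transitivity ((c^-1 ^+ n)%R%:E * \int[leb]_a G (c * a + b0)%R)%E.
  by apply: (@ge0_integralZl _ _ _ leb setT measurableT (fun a => G (c * a + b0)%R) _ (c^-1 ^+ n)%R%:E).
by rewrite (ge0_integral_affine _ c0 mG G0) muleA -EFinM -exprSr.
Qed.

Lemma Rint_rV_affine n (c : R) (b : 'rV[R]_n) (f : 'rV[R]_n -> R) :
  0 < c -> measurable_fun setT f ->
  \int[lebn n]_x f (c *: x + b) = c^-1 ^+ n * \int[lebn n]_x f x.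
Proof.
move=> c0; apply: Rint_change; first by rewrite exprn_gt0// invr_gt0.
by move=> g mg g0; exact: ge0_integral_rV_affine.
Qed.

Lemma L1_rV_affine n (c : R) (b : 'rV[R]_n) (f : 'rV[R]_n -> R) :
  0 < c -> L1 (lebn n) f -> L1 (lebn n) (fun x => f (c *: x + b)).
Proof.
move=> c0; apply: (@L1_change _ _ _ _ _ (c^-1 ^+ n)).
- exact: measurable_rV_affine.
- by rewrite exprn_gt0// invr_gt0.
- by move=> g mg g0; exact: ge0_integral_rV_affine.
Qed.

End lebesgue_rV.

Section lebesgue_affine_real.
Context {R : realType}.
Local Notation leb := (@lebesgue_measure R).

Lemma Rint_affine (c b : R) (f : R -> R) : 0 < c -> measurable_fun setT f ->
  \int[leb]_x f (c * x + b) = c^-1 * \int[leb]_x f x.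
Proof.
move=> c0; apply: (@Rint_change _ _ _ leb); first by rewrite invr_gt0.
by move=> g mg g0; exact: ge0_integral_affine.
Qed.

Lemma L1_affine (c b : R) (f : R -> R) : 0 < c ->
  L1 leb f -> L1 leb (fun x => f (c * x + b)).
Proof.
move=> c0; apply: (@L1_change _ _ _ leb _ c^-1).
- exact: measurable_affine.
- by rewrite invr_gt0.
- by move=> g mg g0; exact: ge0_integral_affine.
Qed.

End lebesgue_affine_real.

(** * The Fejer kernel *)

Section one_dimensional_integrals.
Context {R : realType}.
Local Notation leb := (@lebesgue_measure R).

Lemma ge0_integral_reflect (f : R -> \bar R) :
  measurable_fun [set: R] f -> (forall x, 0 <= f x)%E ->
  (\int[leb]_x f (- x)%R = 1%:E * \int[leb]_x f x)%E.
Proof.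
move=> mf f0; rewrite mul1e.
have mN : measurable_fun [set: measurableTypeR R] (-%R : _ -> measurableTypeR R).
  exact: oppr_measurable.
transitivity (\int[pushforward leb (-%R : _ -> measurableTypeR R)]_x f x)%E.
  symmetry.
  exact: (@ge0_integral_pushforward _ _ _ _ _ _ mN leb setT).
apply: eq_measure_integral => A mA _; exact: lebesgue_measureN.
Qed.

Lemma Rint_reflect (f : R -> R) : measurable_fun [set: R] f ->
  \int[leb]_x f (- x) = \int[leb]_x f x.
Proof.
move=> mf; rewrite -[RHS]mul1r.
apply: (@Rint_change _ _ _ leb) => //.
by move=> g mg g0; exact: ge0_integral_reflect.
Qed.

Lemma L1_reflect (f : R -> R) : L1 leb f -> L1 leb (fun x => f (- x)).
Proof.
apply: (@L1_change _ _ _ leb _ 1) => //.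
by move=> g mg g0; exact: ge0_integral_reflect.
Qed.

Lemma measurable_cos_affine (u b : R) :
  measurable_fun [set: R] (fun x : R => cos (x * u + b)).
Proof.
apply: (measurableT_comp (@measurable_cos R)).
by apply: measurable_funD => //; exact: measurable_funM.
Qed.

Lemma L1_mul_cos (k : R -> R) (u b : R) : L1 leb k ->
  L1 leb (fun x => k x * cos (x * u + b)).
Proof.
move=> ik; under eq_fun do rewrite mulrC.
apply: (@L1_bounded_mul _ _ _ _ 1) => //; first exact: measurable_cos_affine.
by move=> x; exact: normr_cos_le1.
Qed.

(** Reflection turns the phase [b] into [- b], and the average of the two cosines is
    [cos b * cos (x * u)]. This is the hypothesis of [Rint_rV_prod_cos] with phase 0. *)
Lemma Rint_even_cos (k : R -> R) (u b : R) : L1 leb k ->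
  (forall x, k (- x) = k x) ->
  \int[leb]_x (k x * cos (x * u + b)) = cos b * \int[leb]_x (k x * cos (x * u)).
Proof.
move=> ik ek.
have i1 := L1_mul_cos u b ik; have i2 := L1_mul_cos u (- b) ik.
have E : \int[leb]_x (k x * cos (x * u + b)) = \int[leb]_x (k x * cos (x * u - b)).
  rewrite -Rint_reflect; last exact: L1_measurable i1.
  by apply: eq_Rintegral => x _; rewrite ek mulNr -cosN opprD opprK.
have : \int[leb]_x (k x * cos (x * u + b)) + \int[leb]_x (k x * cos (x * u - b))
    = \int[leb]_x ((2 * cos b) * (k x * cos (x * u))).
  rewrite -RintD//; apply: eq_Rintegral => x _.
  by rewrite cosD cosB; ring.
rewrite -E RintZ; first by lra.
by have := L1_mul_cos u 0 ik; under eq_fun do rewrite addr0.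
Qed.

Lemma Rint_supp (a b : R) (f : R -> R) : (forall x, x \notin `[a, b] -> f x = 0) ->
  \int[leb]_x f x = \int[leb]_(x in `[a, b]) f x.
Proof.
move=> f0; rewrite [RHS]Rintegral_mkcond; apply: eq_Rintegral => x _.
rewrite patchE; case: ifPn => // xab; rewrite f0//.
by apply: contra xab => xab; rewrite inE.
Qed.

Lemma FTC_Rint (a b : R) (F f : R -> R) : a < b ->
  (forall x : R, is_derive x 1 F (f x)) -> continuous f ->
  \int[leb]_(x in `[a, b]) f x = F b - F a.
Proof.
move=> ab dF cf.
have cF : continuous F.
  by move=> x; apply: differentiable_continuous; apply/derivable1_diffP; have [] := dF x.
rewrite /Rintegral (@continuous_FTC2 _ f F)//.
- exact: continuous_subspaceT.
- split.
  + by move=> x _; have [] := dF x.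
  + by apply: cvg_at_right_filter; exact: cF.
  + by apply: cvg_at_left_filter; exact: cF.
- by move=> x _; rewrite derive1E; have [_ ->] := dF x.
Qed.

Lemma L1_itvcc (a b : R) : L1 leb (\1_`[a, b] : R -> R).
Proof. exact: integrable_indic_itv. Qed.

Lemma L1_bounded_supp (a b M : R) (f : R -> R) : measurable_fun setT f ->
  (forall x, x \notin `[a, b] -> f x = 0) -> (forall x, `|f x| <= M) -> L1 leb f.
Proof.
move=> mf f0 fM; apply: (@L1_le _ _ R leb _ (fun x => M * \1_`[a, b] x)) => //.
  by apply: L1Z; exact: L1_itvcc.
move=> x; rewrite indicE; have [xab|xab] := boolP (x \in `[a, b]).
  by rewrite mem_set// mulr1.
by rewrite f0// normr0 mulr_ge0//; exact: (le_trans _ (fM 0)).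
Qed.

Lemma L1_oneDsqrV : L1 leb (fun x => (1 + x ^+ 2)^-1).
Proof.
have mf : measurable_fun [set: R] (fun x : R => (1 + x ^+ 2)^-1).
  by apply: continuous_measurable_fun; exact: continuous_oneDsqrV.
have f0 (x : R) : 0 <= (1 + x ^+ 2)^-1 by rewrite invr_ge0 addr_ge0// sqr_ge0.
pose h := (fun x : R => (1 + x ^+ 2)^-1) \_ `[0, +oo[.
have hi : L1 leb h.
  rewrite /L1 -restrict_EFin -integrable_mkcond//.
  apply/integrableP; split; first exact/measurable_EFinP/measurable_funTS.
  under eq_integral do rewrite /= ger0_norm//.
  by have := @integral0y_oneDsqr R; rewrite /oneDsqr => ->; rewrite ltry.
apply: (@L1_le _ _ R leb _ (fun x => h x + h (- x))) => //.
  by apply: L1D => //; exact: L1_reflect.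
move=> x; rewrite ger0_norm// /h !patchE !mem_setE !in_itv/= !andbT sqrrN oppr_ge0.
(* Off its set a restriction takes the default value [point], which is 0 here. *)
have p0 : (point : R) = 0 by [].
by rewrite p0; have := f0 x; case: (leP 0 x) => x0; case: (leP x 0) => x0n; lra.
Qed.

End one_dimensional_integrals.

Section fejer.
Context {R : realType}.
Local Notation leb := (@lebesgue_measure R).

Definition tent (x : R) : R := Num.max 0 (1 - `|x|).

(** Equal to [(sin (u / 2) / (u / 2))^2] for nonzero [u]; as a cosine transform it is also defined
    at 0, without a convention. *)
Definition fejer (u : R) : R := \int[leb]_x (tent x * cos (x * u)).

Lemma tent_ge0 x : 0 <= tent x. Proof. by rewrite /tent le_max lexx. Qed.

Lemma tent_le1 x : tent x <= 1.
Proof. by rewrite /tent ge_max ler01/= gerBl. Qed.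

Lemma tentN x : tent (- x) = tent x. Proof. by rewrite /tent normrN. Qed.

Lemma continuous_tent : continuous tent.
Proof.
move=> x; apply: (@continuous_max R R (cst 0) (fun x => 1 - `|x|)).
  exact: cvg_cst.
apply: cvgB; first exact: cvg_cst.
exact: norm_continuous.
Qed.

Lemma measurable_tent : measurable_fun setT tent.
Proof. by apply: continuous_measurable_fun; exact: continuous_tent. Qed.

Lemma tent_supp x : x \notin `[-1, 1] -> tent x = 0.
Proof.
rewrite in_itv/= -ler_norml -ltNge => x1; apply/max_idPl; lra.
Qed.

Lemma L1_tent : L1 leb tent.
Proof.
apply: (@L1_bounded_supp _ (-1) 1 1); first exact: measurable_tent.
  exact: tent_supp.
by move=> x; rewrite ger0_norm ?tent_ge0// tent_le1.
Qed.

Lemma tent_cos u b : \int[leb]_x (tent x * cos (x * u + b)) = cos b * fejer u.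
Proof. by apply: Rint_even_cos; [exact: L1_tent|exact: tentN]. Qed.

(** The slope [e] will be 1 on [[0, 1]] and -1 on [[-1, 0]], where [tent x] is [1 - e * x]. *)
Lemma is_derive_fejer_primitive (u e x : R) : u != 0 ->
  is_derive x 1 (fun x => (1 - e * x) * (sin (x * u) / u) - e * (cos (x * u) / u ^+ 2))
    ((1 - e * x) * cos (x * u)).
Proof.
move=> u0.
apply: is_derive_eq.
rewrite /GRing.scale/= !mulr0 !add0r !mulr1.
field.
by [].
Qed.

Lemma fejerE u : u != 0 -> fejer u = 2 * (1 - cos u) / u ^+ 2.
Proof.
move=> u0.
have cc e : continuous (fun x : R => (1 - e * x) * cos (x * u)).
  move=> x; apply: differentiable_continuous; apply/derivable1_diffP.
  have := @is_derive_fejer_primitive u e x u0 => _.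
  by apply: ex_derive.
have H1 : \int[leb]_(x in `[0, 1]) (tent x * cos (x * u)) = (1 - cos u) / u ^+ 2.
  transitivity (\int[leb]_(x in `[0, 1]) ((1 - 1 * x) * cos (x * u))).
    apply: eq_Rintegral => x; rewrite inE/= in_itv/= => /andP[x0 x1].
    by rewrite /tent ger0_norm// mul1r; congr (_ * _); apply/max_idPr; lra.
  rewrite (FTC_Rint _ (fun x => is_derive_fejer_primitive 1 x u0) (cc 1))//.
  by rewrite !mul0r sin0 cos0 !mul1r; field.
have H2 : \int[leb]_(x in `[-1, 0]) (tent x * cos (x * u)) = (1 - cos u) / u ^+ 2.
  transitivity (\int[leb]_(x in `[-1, 0]) ((1 - (-1) * x) * cos (x * u))).
    apply: eq_Rintegral => x; rewrite inE/= in_itv/= => /andP[x0 x1].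
    by rewrite /tent ler0_norm// mulN1r; congr (_ * _); apply/max_idPr; lra.
  rewrite (FTC_Rint _ (fun x => is_derive_fejer_primitive (-1) x u0) (cc (-1)))//.
  by rewrite !mul0r !mulN1r sin0 cos0 sinN cosN; field.
have i1 : L1 leb (fun x => tent x * cos (x * u)).
  by have := L1_mul_cos u 0 L1_tent; under eq_fun do rewrite addr0.
have E : [set` `[-1, 1]] = `[(-1 : R), 0[ `|` `[0, 1].
  apply/seteqP; split=> x /=; rewrite !in_itv/=.
    by move=> /andP[? ?]; case: (leP 0 x) => ?; [right|left]; apply/andP; split; lra.
  by case => /andP[? ?]; apply/andP; split; lra.
rewrite /fejer (@Rint_supp _ (-1) 1); last first.
  by move=> x x1; rewrite tent_supp// mul0r.
rewrite E Rintegral_setU//; last 2 first.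
- by rewrite -E; apply: (integrableS measurableT) i1.
- by apply/disj_setPS => x /= []; rewrite !in_itv/= => /andP[? ?] /andP[? ?]; lra.
rewrite Rintegral_itv_bndo_bndc; last by apply: (integrableS measurableT) i1.
by rewrite H1 H2; field.
Qed.

Lemma measurable_fejer : measurable_fun setT fejer.
Proof.
apply: (@measurable_Rint2 _ _ _ _ R leb (fun u x => tent x * cos (x * u))).
apply: measurable_funM.
  exact: (measurableT_comp measurable_tent measurable_snd).
apply: (measurableT_comp (@measurable_cos R)).
exact: measurable_funM.
Qed.

Lemma fejer_ge0 u : 0 <= fejer u.
Proof.
have [->|u0] := eqVneq u 0.
  by apply: Rint_ge0 => x; rewrite mulr0 cos0 mulr1 tent_ge0.
by rewrite fejerE// divr_ge0// ?sqr_ge0// mulr_ge0// subr_ge0 cos_le1.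
Qed.

Lemma fejer_le2 u : fejer u <= 2.
Proof.
have -> : 2 = \int[leb]_x (\1_(`[-1, 1]) x : R).
  rewrite /Rintegral integral_indic// setIT.
  transitivity (fine (lebesgue_measure (`[-1, 1]%classic : set R))) => //.
  by rewrite lebesgue_measure_itv/= lte_fin ifT/=; lra.
apply: Rint_le; last first.
- move=> x; rewrite indicE; have [x1|x1] := boolP (x \in `[-1, 1]).
    rewrite mem_set//= (le_trans (ler_norm _))// normrM -[leRHS]mulr1.
    by apply: ler_pM => //; [rewrite ger0_norm ?tent_ge0// tent_le1|exact: normr_cos_le1].
  by rewrite tent_supp// mul0r.
- exact: L1_itvcc.
- by have := L1_mul_cos u 0 L1_tent; under eq_fun do rewrite addr0.
Qed.

(** 6 is 2 + 4: [fejer u] is at most 2, and [fejer u * u ^+ 2], which is [2 * (1 - cos u)], is at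
    most 4. *)
Lemma fejer_le u : fejer u <= 6 * (1 + u ^+ 2)^-1.
Proof.
have u1 : 0 < 1 + u ^+ 2 by rewrite ltr_wpDr// sqr_ge0.
rewrite ler_pdivlMr// mulrDr mulr1.
have := fejer_le2 u; suff : fejer u * u ^+ 2 <= 4 by lra.
have [->|u0] := eqVneq u 0; first by rewrite expr0n mulr0.
rewrite fejerE// divfK ?expf_eq0//.
by have := cos_geN1 u; lra.
Qed.

Lemma L1_fejer : L1 leb fejer.
Proof.
apply: (@L1_le _ _ R leb _ (fun u => 6 * (1 + u ^+ 2)^-1)).
- exact: measurable_fejer.
- by apply: L1Z; exact: L1_oneDsqrV.
- by move=> x; rewrite ger0_norm ?fejer_ge0// fejer_le.
Qed.

Lemma fejer_gt0 u : 0 < u < 1 -> 0 < fejer u.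
Proof.
move=> /andP[u0 u1]; rewrite fejerE ?gt_eqF// divr_gt0// ?exprn_gt0// mulr_gt0//.
rewrite subr_gt0 -cos0 ltr_cos// in_itv/= ?lexx ?pi_ge0//.
by rewrite ltW//=; have := @pi_ge2 R; lra.
Qed.

Lemma fejer01_gt0 : 0 < \int[leb]_u (\1_(`]0, 1[) u * fejer u).
Proof.
have i0 : L1 leb (fun u => \1_(`]0, 1[) u * fejer u).
  apply: (@L1_bounded_mul _ _ _ _ 1); last exact: L1_fejer.
  - exact: measurable_indic.
  - by move=> x; rewrite indicE; case: (_ \in _); rewrite ?normr1 ?normr0.
have g0 u : 0 <= \1_(`]0, 1[) u * fejer u.
  by rewrite mulr_ge0// ?fejer_ge0//.
rewrite lt_def Rint_ge0// andbT; apply/eqP => E0.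
have [N [mN N0 sN]] := Rint_eq0_ae i0 g0 E0.
have : (leb `]0%R, 1%R[ <= leb N)%E.
  apply: le_measure; rewrite ?inE// => u /= u01; apply: sN => /=.
  rewrite indicE mem_set// mul1r => K0.
  by have := @fejer_gt0 u; rewrite K0 ltxx; move: u01; rewrite in_itv/= => -> /(_ isT).
rewrite N0 lebesgue_measure_itv/= lte_fin ltr01.
by rewrite -EFinD lee_fin subr0 ler10.
Qed.

(** Its value is [2 * pi], the one-dimensional Plancherel constant; only its positivity will be
    used. *)
Definition fejer_mass : R := \int[leb]_u fejer u.

Lemma fejer_mass_gt0 : 0 < fejer_mass.
Proof.
apply: (lt_le_trans fejer01_gt0); apply: Rint_le.
- apply: (@L1_bounded_mul _ _ _ _ 1); last exact: L1_fejer.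
  + exact: measurable_indic.
  + by move=> x; rewrite indicE; case: (_ \in _); rewrite ?normr1 ?normr0.
- exact: L1_fejer.
- move=> x; rewrite -[leRHS]mul1r ler_wpM2r ?fejer_ge0// indicE lern1; exact: leq_b1.
Qed.

End fejer.

(** * Bessel's inequality *)

Lemma fatou_Rint d (T : measurableType d) (R : realType)
    (mu : {measure set T -> \bar R}) (f_ : nat -> T -> R) (f : T -> R) (B : R) :
  (forall n, L1 mu (f_ n)) -> (forall n x, 0 <= f_ n x) ->
  (forall n, \int[mu]_x f_ n x <= B) ->
  measurable_fun setT f -> (forall x, f_ n x @[n --> \oo] --> f x) ->
  L1 mu f /\ \int[mu]_x f x <= B.
Proof.
move=> fi f0 fB mf cf.
have f0' x : 0 <= f x.
  rewrite -(cvg_lim (@Rhausdorff R) (cf x)).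
  by apply: limr_ge; [exact: cvgP (cf x)|exact: nearW].
have H : (\int[mu]_x (f x)%:E <= B%:E)%E.
  rewrite (_ : (\int[mu]_x (f x)%:E = \int[mu]_x limn_einf ((fun n x => (f_ n x)%:E)^~ x))%E); last first.
    apply: eq_integral => x _; rewrite is_cvg_limn_einfE; last first.
      by apply/cvg_ex; exists (f x)%:E; apply/fine_cvgP; split; [exact: nearW|exact: cf].
    apply/esym/cvg_lim => //; apply/fine_cvgP; split; [exact: nearW|exact: cf].
  apply: (le_trans (fatou mu measurableT _ _)).
  - by move=> n; apply/measurable_EFinP; exact: L1_measurable (fi n).
  - by move=> n x _; rewrite lee_fin.
  - rewrite limn_einf_lim; apply: lime_le; first exact: is_cvg_einfs.
    apply: nearW => n; rewrite /einfs.
    apply: (@le_trans _ _ (\int[mu]_x (f_ n x)%:E)%E); last by rewrite -EFin_Rint ?lee_fin.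
    by apply: ereal_inf_lbound; exists n => //=.
have fi' : L1 mu f.
  apply/integrableP; split; first exact/measurable_EFinP.
  under eq_integral do rewrite /= ger0_norm//.
  by rewrite (le_lt_trans H)// ltry.
by split => //; rewrite -lee_fin EFin_Rint.
Qed.

Lemma L1_swap d1 d2 (T1 : measurableType d1) (T2 : measurableType d2) (R : realType)
    (m1 : {sigma_finite_measure set T1 -> \bar R})
    (m2 : {sigma_finite_measure set T2 -> \bar R}) (f : T1 -> T2 -> R) :
  L1 (m1 \x m2)%E (fun p => f p.1 p.2) -> L1 (m2 \x m1)%E (fun p => f p.2 p.1).
Proof.
move=> fi; have mf := L1_measurable fi.
have mf' : measurable_fun setT (fun p : T2 * T1 => f p.2 p.1).
  exact: (measurableT_comp mf (@measurable_swap _ _ T2 T1)).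
apply/integrable12ltyP; first exact/measurable_EFinP.
have mEf : measurable_fun setT (EFin \o (fun p : T1 * T2 => f p.1 p.2)).
  exact/measurable_EFinP.
exact: ((integrable21ltyP m1 m2 mEf).1 fi).
Qed.

Lemma cvg_bigprod (R : realType) I (r : seq I) (u : I -> nat -> R) (l : I -> R) :
  (forall i, u i N @[N --> \oo] --> l i) ->
  \prod_(i <- r) u i N @[N --> \oo] --> \prod_(i <- r) l i.
Proof.
move=> ul; elim: r => [|a r IH].
  by rewrite big_nil; under eq_fun do rewrite big_nil; exact: cvg_cst.
by rewrite big_cons; under eq_fun do rewrite big_cons; exact: cvgM.
Qed.

Section fourier_real.
Context {R : realType} {n : nat}.
Local Notation E := 'rV[R]_n.
Local Notation mu := (@lebesgue_rV R n).
Implicit Types (f g : E -> R) (xi x : E).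

Definition fcos f xi : R := \int[mu]_x (f x * cos (dot x xi)).
Definition fsin f xi : R := \int[mu]_x (f x * sin (dot x xi)).
(** The squared modulus of the Fourier transform of the real function [f]. *)
Definition fpower f xi : R := fcos f xi ^+ 2 + fsin f xi ^+ 2.

Definition L12 f := L1 mu f /\ L1 mu (fun x => f x ^+ 2).

Lemma measurable_dot12 : measurable_fun setT (fun p : E * E => dot p.1 p.2).
Proof. exact: measurable_dot. Qed.

Lemma measurable_dotl xi : measurable_fun setT (fun x : E => dot x xi).
Proof. exact: measurable_dot. Qed.

Lemma measurable_sin : measurable_fun [set: R] (@sin R).
Proof. by apply: continuous_measurable_fun; exact: continuous_sin. Qed.

Lemma normr_sin_le1 (x : R) : `|sin x| <= 1.
Proof. by rewrite -cosBpihalf normr_cos_le1. Qed.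

Lemma L1_fcos f xi : L1 mu f -> L1 mu (fun x => f x * cos (dot x xi)).
Proof.
move=> fi; under eq_fun do rewrite mulrC.
apply: (@L1_bounded_mul _ _ _ _ 1) => //.
  exact: (measurableT_comp (@measurable_cos R) (measurable_dotl xi)).
by move=> x; exact: normr_cos_le1.
Qed.

Lemma L1_fsin f xi : L1 mu f -> L1 mu (fun x => f x * sin (dot x xi)).
Proof.
move=> fi; under eq_fun do rewrite mulrC.
apply: (@L1_bounded_mul _ _ _ _ 1) => //.
  exact: (measurableT_comp measurable_sin (measurable_dotl xi)).
by move=> x; exact: normr_sin_le1.
Qed.

Lemma measurable_fcos f : measurable_fun setT f -> measurable_fun setT (fcos f).
Proof.
move=> mf; apply: (@measurable_Rint1 _ _ _ _ R mu (fun x xi => f x * cos (dot x xi))).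
apply: measurable_funM; first exact: (measurableT_comp mf measurable_fst).
exact: (measurableT_comp (@measurable_cos R) measurable_dot12).
Qed.

Lemma measurable_fsin f : measurable_fun setT f -> measurable_fun setT (fsin f).
Proof.
move=> mf; apply: (@measurable_Rint1 _ _ _ _ R mu (fun x xi => f x * sin (dot x xi))).
apply: measurable_funM; first exact: (measurableT_comp mf measurable_fst).
exact: (measurableT_comp measurable_sin measurable_dot12).
Qed.

Lemma measurable_fpower f : measurable_fun setT f -> measurable_fun setT (fpower f).
Proof.
move=> mf; apply: measurable_funD; apply: measurable_funX.
  exact: measurable_fcos.
exact: measurable_fsin.
Qed.

Lemma fpower_ge0 f xi : 0 <= fpower f xi.
Proof. by rewrite addr_ge0// sqr_ge0. Qed.

(** In this form the power can be integrated in [xi] first, which turns a weight in the frequency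
    into a kernel in [x - y]. *)
Lemma fpowerE f xi : L1 mu f ->
  fpower f xi = \int[(mu \x mu)%E]_p (f p.1 * f p.2 * cos (dot p.1 xi - dot p.2 xi)).
Proof.
move=> fi; rewrite (@Rfubini1 _ _ _ _ R mu mu); last first.
  under eq_fun do rewrite mulrC.
  apply: (@L1_bounded_mul _ _ _ _ 1); last exact: L1_prod.
  - apply: (measurableT_comp (@measurable_cos R)); apply: measurable_funB.
      exact: (measurableT_comp (measurable_dotl xi) measurable_fst).
    exact: (measurableT_comp (measurable_dotl xi) measurable_snd).
  - by move=> x; exact: normr_cos_le1.
rewrite /= /fpower.
transitivity (\int[mu]_x (fcos f xi * (f x * cos (dot x xi)) + fsin f xi * (f x * sin (dot x xi)))).
  rewrite RintD; last 2 first.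
  - by apply: L1Z; exact: L1_fcos.
  - by apply: L1Z; exact: L1_fsin.
  by rewrite !RintZ; [|exact: L1_fsin|exact: L1_fcos].
apply: eq_Rintegral => x _.
rewrite /fcos /fsin mulrC -RintZ; last exact: L1_fcos.
rewrite [X in _ + X]mulrC -RintZ; last exact: L1_fsin.
rewrite -RintD; last 2 first.
- by apply: L1Z; exact: L1_fcos.
- by apply: L1Z; exact: L1_fsin.
by apply: eq_Rintegral => y _; rewrite cosB; ring.
Qed.

Lemma fejerN (u : R) : fejer (- u) = fejer u.
Proof. by apply: eq_Rintegral => x _; rewrite mulrN cosN. Qed.

Definition tentn (N : nat) xi : R := \prod_(i < n) tent (N.+1%:R^-1 * xi ord0 i).

(** The transform of [tentn N]: a nonnegative kernel that concentrates at 0 while its mass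
    [fejer_mass ^+ n] does not depend on [N]. *)
Definition fejern (N : nat) x : R :=
  \prod_(i < n) (N.+1%:R * fejer (N.+1%:R * x ord0 i)).

Lemma tent_affine_L1 (N : nat) :
  L1 (@lebesgue_measure R) (fun y : R => tent (N.+1%:R^-1 * y)).
Proof.
have := @L1_affine R N.+1%:R^-1 0 tent; under [in X in _ -> _ -> X]eq_fun do rewrite addr0.
by apply; [rewrite invr_gt0|exact: L1_tent].
Qed.

Lemma L1_tentn N : L1 mu (tentn N).
Proof.
exact: (@L1_rV_prod R n (fun i (y : R) => tent (N.+1%:R^-1 * y)) (fun=> tent_affine_L1 N)).
Qed.

Lemma tentn_ge0 N xi : 0 <= tentn N xi.
Proof. by apply: prodr_ge0 => i _; exact: tent_ge0. Qed.

Lemma fejern_ge0 N x : 0 <= fejern N x.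
Proof. by apply: prodr_ge0 => i _; rewrite mulr_ge0// fejer_ge0. Qed.

Lemma fejernN N x : fejern N (- x) = fejern N x.
Proof. by apply: eq_bigr => i _; rewrite mxE mulrN fejerN. Qed.

Lemma measurable_fejern N : measurable_fun setT (fejern N).
Proof.
apply: measurable_prod => i _; apply: measurable_funM => //.
apply: (measurableT_comp (@measurable_fejer R)).
by apply: measurable_funM => //; exact: measurable_coord.
Qed.

Lemma tentn_fourier N (v : E) :
  \int[mu]_xi (tentn N xi * cos (dot xi v)) = fejern N v.
Proof.
have N0 : 0 < N.+1%:R^-1 :> R by rewrite invr_gt0.
have := @Rint_rV_prod_cos R n (fun i (y : R) => tent (N.+1%:R^-1 * y)) v (fun=> 0)
  (fun i => N.+1%:R * fejer (N.+1%:R * v ord0 i)) (fun=> tent_affine_L1 N) _ 0.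
under eq_Rintegral do rewrite addr0.
rewrite big1// addr0 cos0 mul1r => -> // i b.
rewrite add0r.
have := @Rint_affine R N.+1%:R^-1 0 (fun y => tent y * cos (y * (N.+1%:R * v ord0 i) + b)) N0.
under eq_Rintegral do rewrite addr0.
rewrite tent_cos invrK mulrCA => <-; last first.
  apply: measurable_funM; first exact: measurable_tent.
  exact: measurable_cos_affine.
apply: eq_Rintegral => x _; congr (_ * cos (_ + _)).
by rewrite mulrACA mulVf ?mul1r// pnatr_eq0.
Qed.

Lemma fejern_mass N x :
  L1 mu (fun y => fejern N (x - y)) /\
  \int[mu]_y fejern N (x - y) = fejer_mass ^+ n.
Proof.
have N0 : 0 < N.+1%:R :> R by [].
pose F (i : 'I_n) (y : R) := N.+1%:R * fejer (N.+1%:R * y + (- N.+1%:R * x ord0 i)).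
have FE y : fejern N (x - y) = \prod_(i < n) F i (y ord0 i).
  rewrite -fejernN opprB; apply: eq_bigr => i _; rewrite !mxE /F; congr (_ * fejer _).
  by rewrite mulrBr mulNr.
have Fi i : L1 (@lebesgue_measure R) (F i).
  by apply: L1Z; apply: L1_affine => //; exact: L1_fejer.
split; first by under eq_fun do rewrite FE; exact: L1_rV_prod.
under eq_Rintegral do rewrite FE.
rewrite Rint_rV_prod// (eq_bigr (fun=> fejer_mass)) ?prodr_const ?card_ord// => i _.
rewrite /F RintZ; last by apply: L1_affine => //; exact: L1_fejer.
rewrite Rint_affine//; last exact: measurable_fejer.
by rewrite mulrA mulfV ?mul1r// pnatr_eq0.
Qed.

(** One half of Schur's test, to be used with [g = f ^+ 2]: the kernel has the same finite mass
    along either variable. *)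
Lemma schur_L1 N g : L1 mu g -> (forall x, 0 <= g x) ->
  L1 (mu \x mu)%E (fun p => g p.1 * fejern N (p.1 - p.2)).
Proof.
move=> gi g0.
apply: (@L1_prod_le _ _ _ _ _ mu mu (fun x y => g x * fejern N (x - y))
  (fun x => fejer_mass ^+ n * g x)).
- apply: measurable_funM; first exact: (measurableT_comp (L1_measurable gi) measurable_fst).
  apply: (measurableT_comp (measurable_fejern N)).
  apply/measurable_fun_rVP => i; under eq_fun do rewrite !mxE.
  apply: measurable_funB.
    exact: (measurableT_comp (@measurable_coord R n i) measurable_fst).
  exact: (measurableT_comp (@measurable_coord R n i) measurable_snd).
- exact: L1Z.
- move=> x; have [Fi FE] := fejern_mass N x.
  under eq_integral do rewrite ger0_norm ?mulr_ge0 ?fejern_ge0//.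
  rewrite -EFin_Rint; last exact: L1Z.
  by rewrite RintZ// FE mulrC.
Qed.

Lemma schur_Rint N g : L1 mu g -> (forall x, 0 <= g x) ->
  \int[(mu \x mu)%E]_p (g p.1 * fejern N (p.1 - p.2)) = fejer_mass ^+ n * \int[mu]_x g x.
Proof.
move=> gi g0; rewrite (@Rfubini1 _ _ _ _ R mu mu); last exact: schur_L1.
rewrite -RintZ//; apply: eq_Rintegral => x _ /=.
by have [Fi FE] := fejern_mass N x; rewrite RintZ// FE mulrC.
Qed.

Lemma schur_L1' N g : L1 mu g -> (forall x, 0 <= g x) ->
  L1 (mu \x mu)%E (fun p => g p.2 * fejern N (p.1 - p.2)).
Proof.
move=> gi g0; have := @L1_swap _ _ _ _ _ mu mu
  (fun x y => g x * fejern N (x - y)) (schur_L1 N gi g0).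
by under eq_fun do rewrite -fejernN opprB.
Qed.

Lemma schur_Rint' N g : L1 mu g -> (forall x, 0 <= g x) ->
  \int[(mu \x mu)%E]_p (g p.2 * fejern N (p.1 - p.2)) = fejer_mass ^+ n * \int[mu]_x g x.
Proof.
move=> gi g0; rewrite (@Rfubini2 _ _ _ _ R mu mu); last exact: schur_L1'.
rewrite -RintZ//; apply: eq_Rintegral => x _ /=.
have [Fi FE] := fejern_mass N x.
under eq_Rintegral do rewrite -fejernN opprB.
by rewrite RintZ// FE mulrC.
Qed.

(** After Fubini the left side is the quadratic form of the kernel [fejern N (x - y)] at [f]. As the
    kernel is nonnegative, [f x * f y <= (f x ^+ 2 + f y ^+ 2) / 2] reduces the bound to the mass of
    the kernel, uniformly in [N]. *)
Lemma bessel_tentn N f : L12 f ->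
  L1 mu (fun xi => tentn N xi * fpower f xi) /\
  \int[mu]_xi (tentn N xi * fpower f xi) <= fejer_mass ^+ n * \int[mu]_x f x ^+ 2.
Proof.
move=> [fi f2i].
pose h xi (p : E * E) := tentn N xi * (f p.1 * f p.2) * cos (dot p.1 xi - dot p.2 xi).
have hi : L1 (mu \x prod_measure mu mu)%E (fun q => h q.1 q.2).
  rewrite /h; under eq_fun do rewrite mulrC.
  apply: (@L1_bounded_mul _ _ R (mu \x prod_measure mu mu)%E 1
    (fun q => tentn N q.1 * (f q.2.1 * f q.2.2))
    (fun q => cos (dot q.2.1 q.1 - dot q.2.2 q.1))).
  - apply: (measurableT_comp (@measurable_cos R)); apply: measurable_funB.
      apply: measurable_dot; last exact: measurable_fst.
      exact: (measurableT_comp measurable_fst measurable_snd).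
    apply: measurable_dot; last exact: measurable_fst.
    exact: (measurableT_comp measurable_snd measurable_snd).
  - by move=> x; exact: normr_cos_le1.
  - apply: (@L1_prod _ _ _ _ R mu (prod_measure mu mu) (tentn N) (fun p => f p.1 * f p.2)).
      exact: L1_tentn.
    exact: L1_prod.
have fh xi : tentn N xi * fpower f xi = \int[prod_measure mu mu]_p h xi p.
  rewrite fpowerE// -RintZ.
    by apply: eq_Rintegral => p _; rewrite /h; ring.
  under eq_fun do rewrite mulrC.
  apply: (@L1_bounded_mul _ _ _ _ 1); last exact: L1_prod.
  - apply: (measurableT_comp (@measurable_cos R)); apply: measurable_funB.
      exact: (measurableT_comp (measurable_dotl xi) measurable_fst).
    exact: (measurableT_comp (measurable_dotl xi) measurable_snd).
  - by move=> x; exact: normr_cos_le1.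
split.
  under eq_fun do rewrite fh.
  exact: (@L1_fubini1 _ _ _ _ R mu (prod_measure mu mu) _ hi).
under eq_Rintegral do rewrite fh.
rewrite (@Rint_swap _ _ _ _ R mu (prod_measure mu mu) h hi).
have hE p : \int[mu]_xi h xi p = f p.1 * f p.2 * fejern N (p.1 - p.2).
  rewrite -tentn_fourier -RintZ; last by apply: L1_fcos; exact: L1_tentn.
  apply: eq_Rintegral => xi _; rewrite /h (_ : _ - _ = dot xi (p.1 - p.2)); last first.
    by rewrite /dot -sumrB; apply: eq_bigr => i _; rewrite !mxE; ring.
  ring.
under eq_Rintegral do rewrite hE.
have f20 x : 0 <= f x ^+ 2 by exact: sqr_ge0.
have i1 := schur_L1 N f2i f20; have i2 := schur_L1' N f2i f20.
apply: (@le_trans _ _ (\int[(mu \x mu)%E]_p (2^-1 * ((f p.1 ^+ 2 * fejern N (p.1 - p.2))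
  + (f p.2 ^+ 2 * fejern N (p.1 - p.2)))))).
  apply: Rint_le.
  - have := L1_fubini2 hi.
    by under [in X in X -> _]eq_fun do rewrite /= hE.
  - by apply: L1Z; exact: L1D.
  - move=> p; rewrite -mulrDl mulrA ler_wpM2r ?fejern_ge0//.
    have := sqr_ge0 (f p.1 - f p.2); rewrite sqrrB; lra.
rewrite RintZ; last exact: L1D.
rewrite (RintD i1 i2) (schur_Rint N f2i f20) (schur_Rint' N f2i f20); lra.
Qed.

Lemma cvg_tentn xi : tentn N xi @[N --> \oo] --> (1 : R).
Proof.
rewrite [X in _ --> X](_ : 1 = \prod_(i < n) (1:R)); last by rewrite big1.
have cN : (N.+1%:R^-1 : R) @[N --> \oo] --> (0 : R) by exact: cvg_harmonic.
apply: cvg_bigprod => i.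
rewrite [X in _ --> X](_ : 1 = tent (0 * xi ord0 i)); last first.
  by rewrite mul0r /tent normr0 subr0; apply/esym/max_idPr.
have cN' : (N.+1%:R^-1 * xi ord0 i) @[N --> \oo] --> 0 * xi ord0 i.
  by apply: cvgM => //; exact: cvg_cst.
exact: (cvg_comp _ _ cN' (@continuous_tent R _)).
Qed.

(** [tentn N] tends to 1 pointwise, so Fatou's lemma removes the weight from the uniform bound. *)
Lemma bessel f : L12 f ->
  L1 mu (fpower f) /\ \int[mu]_xi fpower f xi <= fejer_mass ^+ n * \int[mu]_x f x ^+ 2.
Proof.
move=> Hf; have [fi _] := Hf.
apply: (@fatou_Rint _ _ _ mu (fun N xi => tentn N xi * fpower f xi)).
- by move=> N; have [] := bessel_tentn N Hf.
- by move=> N xi; rewrite mulr_ge0 ?tentn_ge0 ?fpower_ge0.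
- by move=> N; have [] := bessel_tentn N Hf.
- by apply: measurable_fpower; exact: L1_measurable fi.
- move=> xi; rewrite -[X in _ --> X]mul1r.
  by apply: cvgM; [exact: cvg_tentn|exact: cvg_cst].
Qed.

End fourier_real.

(** * Plancherel's theorem *)

Section box_fourier.
Context {R : realType}.
Local Notation leb := (@lebesgue_measure R).

Lemma is_derive_sin_affine (u b x : R) : u != 0 ->
  is_derive x 1 (fun x => sin (x * u + b) / u) (cos (x * u + b)).
Proof.
move=> u0; apply: is_derive_eq.
rewrite /GRing.scale/= !mulr0 !add0r !mulr1 addr0.
by field.
Qed.

Lemma indic_oc_cos (a b u c : R) : a < b -> u != 0 ->
  \int[leb]_x (\1_`]a, b] x * cos (x * u + c)) =
  cos ((a + b) / 2 * u + c) * (2 * sin ((b - a) / 2 * u) / u).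
Proof.
move=> ab u0.
have cc : continuous (fun x : R => cos (x * u + c)).
  by move=> x; apply: differentiable_continuous; apply/derivable1_diffP; exact: ex_derive.
have E : \int[leb]_x (\1_`]a, b] x * cos (x * u + c)) = \int[leb]_(x in `[a, b]) cos (x * u + c).
  rewrite -Rintegral_itv_obnd_cbnd; last first.
    apply: (@integrableS _ _ _ leb `[a, b]%classic) => //.
      by apply: subset_itv; rewrite bnd_simp.
    apply: continuous_compact_integrable; first exact: segment_compact.
    exact: continuous_subspaceT.
  rewrite [RHS]Rintegral_mkcond; apply: eq_Rintegral => x _.
  by rewrite patchE indicE; case: (_ \in _); rewrite ?mul1r ?mul0r.
rewrite E (FTC_Rint ab (fun x => is_derive_sin_affine c x u0) cc).
rewrite (_ : b * u + c = ((a + b) / 2 * u + c) + (b - a) / 2 * u); last by field.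
rewrite (_ : a * u + c = ((a + b) / 2 * u + c) - (b - a) / 2 * u); last by field.
by rewrite sinD sinB; field.
Qed.

Lemma L1_oc (a b : R) : L1 leb (\1_`]a, b] : R -> R).
Proof. exact: integrable_indic_itv. Qed.

Lemma Rint_oc (a b : R) : a < b -> \int[leb]_x \1_`]a, b] x = b - a.
Proof.
move=> ab; rewrite /Rintegral integral_indic// setIT.
transitivity (fine (lebesgue_measure (`]a, b]%classic : set R))) => //.
by rewrite lebesgue_measure_itv/= lte_fin ab.
Qed.

(* [a u] is the modulus, up to sign, and [m u] the phase of the transform of
   the indicator function of [A]. *)
Lemma ocitv_fourier (A : set R) : ocitv A -> exists a : R -> R, exists m : R,
  [/\ L1 leb (\1_A : R -> R),
      forall u c, \int[leb]_x (\1_A x * cos (x * u + c)) = cos (m * u + c) * a u,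
      L1 leb (fun u => a u ^+ 2) &
      \int[leb]_u a u ^+ 2 = fejer_mass * \int[leb]_x \1_A x].
Proof.
case/ocitvP => [->|[[p q] /= pq ->]].
  exists (fun=> 0), 0; rewrite indic0; split.
  - exact: L1_0.
  - move=> u c; rewrite mulr0 -[RHS](Rint_cst0 leb).
    by apply: eq_Rintegral => x _; rewrite mul0r.
  - by under eq_fun do rewrite expr0n/=; exact: L1_0.
  - rewrite (_ : \int[leb]_x cst 0 x = 0) ?mulr0 -[RHS](Rint_cst0 leb)//.
    by apply: eq_Rintegral => x _; rewrite expr0n.
pose m := (p + q) / 2.
pose a u := \int[leb]_x (\1_(`](p - m), (q - m)]) x * cos (x * u)).
have L0 : 0 < q - p by rewrite subr_gt0.
have aE u : u != 0 -> a u = 2 * sin ((q - p) / 2 * u) / u.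
  move=> u0; rewrite /a; under eq_Rintegral do rewrite -[X in cos X]addr0.
  rewrite indic_oc_cos//; last by rewrite ltrD2r.
  rewrite (_ : (p - m + (q - m)) / 2 = 0); last by rewrite /m; field.
  rewrite mul0r addr0 cos0 mul1r; congr (_ * sin (_ * _) / _).
  by rewrite /m; field.
(* By the half-angle formula the square is a rescaled [fejer]; this is why the constant in the
   identity for intervals is the one of Bessel's inequality. *)
have a2 u : u != 0 -> a u ^+ 2 = (q - p) ^+ 2 * fejer ((q - p) * u + 0).
  move=> u0; rewrite addr0 aE// fejerE ?mulf_neq0// ?gt_eqF//.
  rewrite [in cos _](_ : (q - p) * u = (q - p) / 2 * u + (q - p) / 2 * u); last by field.
  have := cos2Dsin2 ((q - p) / 2 * u).
  rewrite cosD; set C := cos _; set S := sin _ => CS.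
  rewrite (_ : 1 - _ = 2 * S ^+ 2); last by lra.
  by field; rewrite u0/= gt_eqF.
have ma : measurable_fun setT a.
  apply: (@measurable_Rint2 _ _ _ _ R leb (fun u x => \1_(`](p - m), (q - m)]) x * cos (x * u))).
  apply: measurable_funM.
    exact: (measurableT_comp (L1_measurable (L1_oc _ _)) measurable_snd).
  apply: (measurableT_comp (@measurable_cos R)); exact: measurable_funM.
have ae : {ae leb, forall u, (q - p) ^+ 2 * fejer ((q - p) * u + 0) = a u ^+ 2}.
  exists [set 0]; split => //; first exact: lebesgue_measure_set1.
  move=> u /=; apply: contra_notP => /eqP u0; exact/esym/a2.
have fi : L1 leb (fun u => (q - p) ^+ 2 * fejer ((q - p) * u + 0)).
  by apply: L1Z; apply: L1_affine => //; exact: L1_fejer.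
exists a, m; split.
- exact: L1_oc.
- move=> u c; have [->|u0] := eqVneq u 0; last by rewrite aE// indic_oc_cos.
  rewrite mulr0 add0r /a.
  under [LHS]eq_Rintegral do rewrite mulr0 add0r mulrC.
  under [in RHS]eq_Rintegral do rewrite mulr0 cos0 mulr1.
  rewrite RintZ; last exact: L1_oc.
  by rewrite !Rint_oc// ?ltrD2r//; ring.
- by apply: L1_ae_eq ae fi; exact: measurable_funX.
- rewrite -(Rint_ae_eq _ _ ae); last 2 first.
  + exact: L1_measurable fi.
  + exact: measurable_funX.
  rewrite RintZ; last by apply: L1_affine => //; exact: L1_fejer.
  rewrite Rint_affine//; last exact: measurable_fejer.
  by rewrite Rint_oc// /fejer_mass; field; rewrite gt_eqF.
Qed.

End box_fourier.

Section plancherel.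
Context {R : realType} {n : nat}.
Local Notation E := 'rV[R]_n.
Local Notation mu := (@lebesgue_rV R n).
Local Notation leb := (@lebesgue_measure R).
Implicit Types (f g : E -> R) (xi x : E).

(** The gap in Bessel's inequality: a nonnegative quadratic form, which therefore obeys the
    parallelogram law. *)
Definition defect f : R :=
  fejer_mass ^+ n * \int[mu]_x f x ^+ 2 - \int[mu]_xi fpower f xi.

Lemma defect_ge0 f : L12 f -> 0 <= defect f.
Proof. by move=> /bessel[_ fb]; rewrite subr_ge0. Qed.

Lemma defect_le f : L12 f -> defect f <= fejer_mass ^+ n * \int[mu]_x f x ^+ 2.
Proof. by move=> _; rewrite gerBl; apply: Rint_ge0 => xi; exact: fpower_ge0. Qed.

Lemma L12_sqD f g : L12 f -> L12 g -> L1 mu (fun x => (f x + g x) ^+ 2).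
Proof.
move=> [fi f2] [gi g2]; apply: (@L1_le _ _ _ _ _ (fun x => 2 * (f x ^+ 2 + g x ^+ 2))).
- apply: measurable_funX; apply: measurable_funD; [exact: L1_measurable fi|exact: L1_measurable gi].
- by apply: L1Z; exact: L1D.
- move=> x; rewrite ger0_norm ?sqr_ge0//.
  by have := sqr_ge0 (f x - g x); lra.
Qed.

Lemma L12Z k f : L12 f -> L12 (fun x => k * f x).
Proof.
move=> [fi f2]; split; first exact: L1Z.
by under eq_fun do rewrite exprMn; exact: L1Z.
Qed.

Lemma L12D f g : L12 f -> L12 g -> L12 (fun x => f x + g x).
Proof.
move=> Hf Hg; split; last exact: L12_sqD.
by apply: L1D; [case: Hf|case: Hg].
Qed.

Lemma L12B f g : L12 f -> L12 g -> L12 (fun x => f x - g x).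
Proof.
move=> Hf /(L12Z (-1)) Hg; have := L12D Hf Hg.
by under eq_fun do rewrite mulN1r.
Qed.

Lemma fcosD f g xi : L1 mu f -> L1 mu g ->
  fcos (fun x => f x + g x) xi = fcos f xi + fcos g xi.
Proof.
move=> fi gi; rewrite /fcos -RintD; [|exact: L1_fcos..].
by apply: eq_Rintegral => x _; rewrite mulrDl.
Qed.

Lemma fsinD f g xi : L1 mu f -> L1 mu g ->
  fsin (fun x => f x + g x) xi = fsin f xi + fsin g xi.
Proof.
move=> fi gi; rewrite /fsin -RintD; [|exact: L1_fsin..].
by apply: eq_Rintegral => x _; rewrite mulrDl.
Qed.

Lemma fcosZ k f xi : L1 mu f -> fcos (fun x => k * f x) xi = k * fcos f xi.
Proof.
move=> fi; rewrite /fcos -RintZ; last exact: L1_fcos.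
by apply: eq_Rintegral => x _; rewrite mulrA.
Qed.

Lemma fsinZ k f xi : L1 mu f -> fsin (fun x => k * f x) xi = k * fsin f xi.
Proof.
move=> fi; rewrite /fsin -RintZ; last exact: L1_fsin.
by apply: eq_Rintegral => x _; rewrite mulrA.
Qed.

Lemma fcosB f g xi : L1 mu f -> L1 mu g ->
  fcos (fun x => f x - g x) xi = fcos f xi - fcos g xi.
Proof.
move=> fi gi; rewrite /fcos -RintB; [|exact: L1_fcos..].
by apply: eq_Rintegral => x _; rewrite mulrBl.
Qed.

Lemma fsinB f g xi : L1 mu f -> L1 mu g ->
  fsin (fun x => f x - g x) xi = fsin f xi - fsin g xi.
Proof.
move=> fi gi; rewrite /fsin -RintB; [|exact: L1_fsin..].
by apply: eq_Rintegral => x _; rewrite mulrBl.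
Qed.

Lemma defect_parallelogram f g : L12 f -> L12 g ->
  defect (fun x => f x + g x) + defect (fun x => f x - g x) =
  2 * defect f + 2 * defect g.
Proof.
move=> Hf Hg; have HD := L12D Hf Hg; have HB := L12B Hf Hg.
have [[fi f2] [gi g2]] := (Hf, Hg); have [_ D2] := HD; have [_ B2] := HB.
have [[pf _] [pg _]] := (bessel Hf, bessel Hg).
have [[pD _] [pB _]] := (bessel HD, bessel HB).
have E1 : \int[mu]_x (f x + g x) ^+ 2 + \int[mu]_x (f x - g x) ^+ 2 =
    2 * \int[mu]_x f x ^+ 2 + 2 * \int[mu]_x g x ^+ 2.
  rewrite -!RintZ// -!RintD//; [|exact: L1Z..].
  by apply: eq_Rintegral => x _; ring.
have E2 : \int[mu]_xi fpower (fun x => f x + g x) xi +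
    \int[mu]_xi fpower (fun x => f x - g x) xi =
    2 * \int[mu]_xi fpower f xi + 2 * \int[mu]_xi fpower g xi.
  rewrite -!RintZ// -!RintD//; [|exact: L1Z..].
  apply: eq_Rintegral => xi _; rewrite /fpower fcosD// fcosB// fsinD// fsinB//.
  by ring.
rewrite /defect; move: E1 E2.
move: (\int[mu]_x (f x + g x) ^+ 2) (\int[mu]_x (f x - g x) ^+ 2) (\int[mu]_x f x ^+ 2)
  (\int[mu]_x g x ^+ 2) (\int[mu]_xi fpower (fun x => f x + g x) xi)
  (\int[mu]_xi fpower (fun x => f x - g x) xi) (\int[mu]_xi fpower f xi)
  (\int[mu]_xi fpower g xi) (fejer_mass ^+ n) => A B C D A' B' C' D' c E1 E2.
transitivity (c * (A + B) - (A' + B')); first by ring.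
by rewrite E1 E2; ring.
Qed.

(* By the parallelogram law the functions for which Plancherel's identity holds
   form a subspace that is closed in mean square. *)
Definition tight f := L12 f /\ defect f = 0.

Lemma tight0 : tight (fun=> 0).
Proof.
have H : @L12 R n (fun=> 0).
  by split; [exact: L1_0|under eq_fun do rewrite expr0n/=; exact: L1_0].
split; first by [].
apply/eqP; rewrite eq_le defect_ge0// andbT; apply: (le_trans (defect_le H)).
by under eq_Rintegral do rewrite expr0n/=; rewrite Rint_cst0 mulr0.
Qed.

Lemma tightD f g : tight f -> tight g -> tight (fun x => f x + g x).
Proof.
move=> [Hf f0] [Hg g0]; have HD := L12D Hf Hg; split; first by [].
have := defect_parallelogram Hf Hg; rewrite f0 g0 mulr0 addr0.
move/eqP; rewrite (paddr_eq0 (defect_ge0 HD) (defect_ge0 (L12B Hf Hg))).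
by case/andP => /eqP e _; exact: e.
Qed.

Lemma tightB f g : tight f -> tight g -> tight (fun x => f x - g x).
Proof.
move=> [Hf f0] [Hg g0]; have HB := L12B Hf Hg; split; first by [].
have := defect_parallelogram Hf Hg; rewrite f0 g0 mulr0 addr0.
move/eqP; rewrite (paddr_eq0 (defect_ge0 (L12D Hf Hg)) (defect_ge0 HB)).
by case/andP => _ /eqP e; exact: e.
Qed.

Lemma tightZ k f : tight f -> tight (fun x => k * f x).
Proof.
move=> [Hf f0]; split; first exact: L12Z.
have [fi f2] := Hf; have [pf _] := bessel Hf.
transitivity (k ^+ 2 * defect f); last by rewrite f0 mulr0.
rewrite /defect mulrBr mulrCA -(RintZ _ f2) -(RintZ _ pf); congr (_ * _ - _).
  by apply: eq_Rintegral => x _; rewrite exprMn.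
by apply: eq_Rintegral => xi _; rewrite /fpower fcosZ// fsinZ//; ring.
Qed.

Lemma tight_sum I (r : seq I) (f : I -> E -> R) : (forall i, tight (f i)) ->
  tight (fun x => \sum_(i <- r) f i x).
Proof.
move=> Hf; elim: r => [|a r IH].
  by under eq_fun do rewrite big_nil; exact: tight0.
rewrite (_ : (fun x => _) = fun x => f a x + \sum_(i <- r) f i x); first exact: tightD.
by apply/funext => x; rewrite big_cons.
Qed.

(** Write [f = f_k + (f - f_k)]. As [f_k] has no defect, the parallelogram law gives
    [defect f <= 2 * defect (f - f_k)], which is at most a multiple of the mean square distance;
    that distance tends to 0 by domination. *)
Lemma tight_lim (f_ : nat -> E -> R) f : (forall k, tight (f_ k)) -> L12 f ->
  (forall k x, `|f_ k x| <= `|f x|) -> (forall x, f_ k x @[k --> \oo] --> f x) ->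
  tight f.
Proof.
move=> Hk Hf fk cf; split; first by [].
have [fi f2] := Hf.
have mk k : measurable_fun setT (f_ k) by have [[] /L1_measurable] := Hk k.
have [|||||_] := @dominated_Rint _ _ _ mu (fun k x => (f x - f_ k x) ^+ 2) (fun=> 0)
  (fun x => 4 * f x ^+ 2).
- by move=> k; apply: measurable_funX; apply: measurable_funB => //; exact: L1_measurable fi.
- by [].
- move=> x; rewrite -[X in _ --> X](expr0n _ 2) -(subrr (f x)).
  apply: (@cvg_comp _ _ _ (fun k => f x - f_ k x) (fun y => y ^+ 2)); last exact: exprn_continuous.
  by apply: cvgB; [exact: cvg_cst|exact: cf].
- exact: L1Z.
- move=> k x; rewrite ger0_norm ?sqr_ge0//.
  rewrite -(real_normK (num_real (f x - _))) -(real_normK (num_real (f x))).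
  rewrite (_ : 4 = 2 ^+ 2); last by ring.
  rewrite -exprMn ler_sqr ?nnegrE ?mulr_ge0//.
  by have := fk k x; have := ler_normB (f x) (f_ k x); lra.
rewrite Rint_cst0 => H0.
have key k : defect f <= 2 * (fejer_mass ^+ n * \int[mu]_x (f x - f_ k x) ^+ 2).
  have [Hfk d0] := Hk k; have HB := L12B Hf Hfk.
  have := defect_parallelogram Hfk HB.
  rewrite (_ : (fun x => f_ k x + _) = f); last by apply/funext => x; rewrite addrC subrK.
  rewrite d0 mulr0 add0r.
  have := defect_ge0 (L12B Hfk HB); have := defect_le HB.
  by move: (defect _) (defect _) (defect _) (_ ^+ _ * _) => a b c e ? ? ?; lra.
apply/eqP; rewrite eq_le defect_ge0// andbT.
have lim0 : 2 * (fejer_mass ^+ n * \int[mu]_x (f x - f_ k x) ^+ 2) @[k --> \oo] --> (0 : R).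
  rewrite [X in _ --> X](_ : 0 = 2 * (fejer_mass ^+ n * 0)); last by rewrite !mulr0.
  apply: cvgM; first exact: cvg_cst.
  apply: cvgM; first exact: cvg_cst.
  exact: H0.
rewrite -(cvg_lim (@Rhausdorff R) lim0).
by apply: limr_ge; [exact: cvgP lim0|exact: nearW].
Qed.

Definition box (A : 'I_n -> set R) : set E := [set x | forall i, A i (x ord0 i)].

Lemma indic_box A x : (\1_(box A) x : R) = \prod_(i < n) \1_(A i) (x ord0 i).
Proof.
rewrite indicE; have [xA|xA] := boolP (x \in box A).
  rewrite big1// => i _; rewrite indicE mem_set//.
  by move: xA; rewrite inE => /(_ i).
have /existsNP[i Ai] : ~ forall i, A i (x ord0 i) by move=> H; rewrite (mem_set H) in xA.
by rewrite (bigD1 i)//= indicE memNset// mul0r.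
Qed.

(** The transform of a box is a product of one-dimensional factors times a phase, and the phase
    disappears from [fpower]; the identity is then the product of the identities for intervals. *)
Lemma tight_box A : (forall i, ocitv (A i)) -> tight (\1_(box A) : E -> R).
Proof.
move=> /(_ _)/ocitv_fourier => /(_ _)/cid => H.
pose a i := projT1 (H i).
have H' i := cid (projT2 (H i)).
pose m i := projT1 (H' i).
have Ai i : L1 leb (\1_(A i) : R -> R) by case: (projT2 (H' i)).
have Af i u c : \int[leb]_x (\1_(A i) x * cos (x * u + c)) = cos (m i * u + c) * a i u.
  by case: (projT2 (H' i)) => _ /(_ u c).
have a2i i : L1 leb (fun u => a i u ^+ 2) by case: (projT2 (H' i)).
have a2 i : \int[leb]_u a i u ^+ 2 = fejer_mass * \int[leb]_x \1_(A i) x.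
  by case: (projT2 (H' i)).
have fE : (\1_(box A) : E -> R) = fun x => \prod_(i < n) \1_(A i) (x ord0 i).
  by apply/funext => x; rewrite indic_box.
have f2E : (fun x : E => (\1_(box A) x : R) ^+ 2) = \1_(box A).
  by apply/funext => x; rewrite indicE; case: (_ \in _); rewrite ?expr1n ?expr0n.
have fi : L1 mu (\1_(box A) : E -> R).
  by rewrite fE; apply: (@L1_rV_prod R n (fun i => \1_(A i))).
have Hf : L12 (\1_(box A) : E -> R) by split => //; rewrite f2E.
split; first by [].
rewrite /defect.
have FE xi c : \int[mu]_x (\1_(box A) x * cos (dot x xi + c)) =
    cos (\sum_i m i * xi ord0 i + c) * \prod_i a i (xi ord0 i).
  rewrite fE (@Rint_rV_prod_cos R n (fun i => \1_(A i)) xi (fun i => m i * xi ord0 i)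
    (fun i => a i (xi ord0 i)))//.
have pE xi : fpower (\1_(box A)) xi = \prod_i a i (xi ord0 i) ^+ 2.
  rewrite /fpower.
  have -> : fcos (\1_(box A)) xi = cos (\sum_i m i * xi ord0 i) * \prod_i a i (xi ord0 i).
    rewrite -[in RHS](addr0 (\sum_i _)) -FE.
    by apply: eq_Rintegral => x _; rewrite addr0.
  have -> : fsin (\1_(box A)) xi = sin (\sum_i m i * xi ord0 i) * \prod_i a i (xi ord0 i).
    rewrite -cosBpihalf -FE.
    by apply: eq_Rintegral => x _; rewrite cosBpihalf.
  by rewrite !exprMn -mulrDl cos2Dsin2 mul1r prodrXl.
under [X in _ - X]eq_Rintegral do rewrite pE.
rewrite (@Rint_rV_prod R n (fun i u => a i u ^+ 2) a2i).
have -> : \int[mu]_x (\1_(box A) x : R) ^+ 2 = \prod_(i < n) \int[leb]_x \1_(A i) x.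
  rewrite -(@Rint_rV_prod R n (fun i => \1_(A i)))//; apply: eq_Rintegral => x _.
  by rewrite -indic_box -[RHS](congr1 (@^~ x) f2E).
under [X in _ - X]eq_bigr do rewrite a2.
by rewrite big_split/= prodr_const card_ord subrr.
Qed.

(** Half-open intervals, the empty one included, are stable under intersection, so these boxes form
    a pi-system. *)
Definition oc_boxes : set (set E) :=
  [set box A | A in [set A : 'I_n -> set R | forall i, ocitv (A i)]].

Definition cube (k : nat) : set E := box (fun=> `](- k%:R), k%:R]%classic).

Lemma cubeP (x : E) : exists K, forall k, (K <= k)%N -> cube k x.
Proof.
have [K KP] : exists K : nat, forall i, `|x ord0 i| < K%:R.
  exists (\sum_(i < n) (Num.trunc `|x ord0 i|).+1)%N => i.
  rewrite (lt_le_trans (Num.Theory.truncnS_gt _))// ler_nat.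
  by rewrite (bigD1 i)//= leq_addr.
exists K => k Kk i /=; rewrite in_itv/=.
have := KP i; have : K%:R <= k%:R :> R by rewrite ler_nat.
by move=> Kk' /ltr_normlP[? ?]; apply/andP; split; lra.
Qed.

Lemma measurable_box (A : 'I_n -> set R) : (forall i, measurable (A i)) -> measurable (box A).
Proof.
move=> mA; rewrite (_ : box A = \big[setI/setT]_(i < n) ((fun x : E => x ord0 i) @^-1` A i)).
  apply: bigsetI_measurable => i _.
  by rewrite -[X in measurable X]setTI; exact: measurable_coord.
rewrite -bigcap_seq; apply/seteqP; split=> x /= H i; first by move=> _; exact: H.
by apply: H => /=; rewrite mem_index_enum.
Qed.

Lemma measurable_oc (A : set R) : ocitv A -> measurable A.
Proof. by move=> /ocitvP[->|[x _ ->]]. Qed.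

Lemma measurable_rVE : @measurable _ E = <<s oc_boxes >>.
Proof.
apply/seteqP; split; last first.
  apply: smallest_sub; first exact: sigma_algebra_measurable.
  by move=> _ [A oA <-]; apply: measurable_box => i; exact: measurable_oc.
have sT : sigma_algebra setT <<s oc_boxes >> by exact: smallest_sigma_algebra.
apply: smallest_sub => //.
rewrite -bigcup_seq => _ [i _ [B mB <-]]; rewrite setTI.
suff : measurable `<=` [set B : set R | <<s oc_boxes >> ((fun x : E => x ord0 i) @^-1` B)].
  by move=> /(_ B mB).
apply: smallest_sub.
  split => /=.
  - by rewrite preimage_set0; case: sT.
  - move=> C HC; rewrite setTD preimage_setC -setTD; by case: sT => _ + _; exact.
  - move=> F HF; rewrite preimage_bigcup; by case: sT => _ _; exact.
move=> C oC /=.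
(* A cylinder has unbounded sides; it is exhausted by boxes with base [C] and growing other
   sides. *)
rewrite (_ : _ @^-1` C = \bigcup_k (box (fun j => if j == i then C else `](- k%:R), k%:R]%classic))).
  case: sT => _ _; apply => k; apply: sub_sigma_algebra.
  exists (fun j => if j == i then C else `](- k%:R), k%:R]%classic) => // j.
  by case: ifP => // _; exact: is_ocitv.
apply/seteqP; split=> x /=.
  move=> xC; have [K /(_ K (leqnn _)) HK] := cubeP x.
  by exists K => // j /=; case: ifPn => [/eqP -> //|_]; exact: HK.
by move=> [k _ /(_ i)]; rewrite eqxx.
Qed.

Lemma oc_boxesI : setI_closed oc_boxes.
Proof.
move=> _ _ [A oA <-] [B oB <-]; exists (fun i => A i `&` B i).
  by move=> i; exact: ocitvI.
by apply/seteqP; split=> x /=; [move=> H; split=> i; have [] := H i|move=> [HA HB] i; split].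
Qed.

(** Dynkin's pi-lambda theorem. Intersecting with a fixed cube keeps every indicator integrable, so
    that complements become differences of tight functions. *)
Lemma tight_cubeI k (A : set E) : measurable A -> tight (\1_(A `&` cube k) : E -> R).
Proof.
move=> mA.
pose P := [set A : set E | tight (\1_(A `&` cube k) : E -> R)].
have tc : tight (\1_(cube k) : E -> R) by apply: tight_box => i; exact: is_ocitv.
have mc : measurable (cube k) by apply: measurable_box => i.
apply: (@dynkin_induction _ E oc_boxes P measurable_rVE oc_boxesI); last 1 first.
- by rewrite -measurable_rVE.
- by rewrite /P/= setTI.
- move=> _ [B oB <-]; rewrite /P /=.
  have -> : box B `&` cube k = box (fun i => B i `&` `](- k%:R), k%:R]%classic).
    by apply/seteqP; split=> x /=; [move=> [HA HB] i; split|move=> H; split=> i; have [] := H i].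
  by apply: tight_box => i; apply: ocitvI => //; exact: is_ocitv.
- move=> S mS tS; rewrite /P /=.
  have -> : (\1_(~` S `&` cube k) : E -> R) = fun x => \1_(cube k) x - \1_(S `&` cube k) x.
    apply/funext => x; rewrite !indicE !in_setI in_setC.
    by case: (x \in S); case: (x \in cube k); rewrite /= ?subrr ?subr0.
  exact: tightB.
- move=> F mF tF HF; rewrite /P /=.
  have tU : tight (\1_(cube k) : E -> R) by [].
  (* By disjointness a point of [F j0] is counted by the term of index [j0] alone, so the partial
     sums are 0 and then 1. *)
  have fE j0 x : (F j0 `&` cube k) x -> forall m,
      \sum_(j < m) \1_(F j `&` cube k) x = ((j0 < m)%N)%:R :> R.
    move=> Fx; elim=> [|m IH]; first by rewrite big_ord0.
    rewrite big_ord_recr/= IH (_ : (j0 < m.+1)%N = (j0 == m) || (j0 < m)%N); last first.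
      by rewrite ltnS leq_eqVlt.
    have [j0m|j0m] := eqVneq j0 m.
      by rewrite -j0m ltnn indicE mem_set//= add0r.
    rewrite /= indicE memNset ?addr0// => -[Fmx _].
    move/eqP: j0m; apply; move/trivIsetP: tF => /(_ j0 m I I) tF.
    by apply/eqP/negP => /negP /tF; apply/eqP/set0P; exists x; split=> //; case: Fx.
  have f0 x : ~ (\bigcup_j F j `&` cube k) x -> forall m,
      \sum_(j < m) \1_(F j `&` cube k) x = 0 :> R.
    move=> Fx m; rewrite big1// => j _; rewrite indicE memNset// => -[Fjx cx].
    by apply: Fx; split => //; exists j.
  have mU : measurable (\bigcup_j F j) by exact: bigcupT_measurable.
  apply: (@tight_lim (fun m x => \sum_(j < m) \1_(F j `&` cube k) x)).
  + by move=> m; apply: tight_sum => j; exact: HF.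
  + have fi : L1 mu (\1_(\bigcup_j F j `&` cube k) : E -> R).
      have [[ci _] _] := tc; apply: (@L1_le _ _ _ _ _ (\1_(cube k))) => //.
        by apply: measurable_indic; exact: measurableI.
      move=> x; rewrite !indicE in_setI.
      by case: (x \in cube k); rewrite ?andbF ?normr0// andbT; case: (_ \in _); rewrite ?normr1 ?normr0.
    split => //; rewrite (_ : (fun x => _) = (\1_(\bigcup_j F j `&` cube k) : E -> R))//.
    by apply/funext => x; rewrite indicE; case: (_ \in _); rewrite ?expr1n ?expr0n.
  + move=> m x; have [Fx|Fx] := pselect ((\bigcup_j F j `&` cube k) x).
      have [[j _ Fj] cx] := Fx; rewrite (fE j)// indicE mem_set// normr1.
      by case: (j < m)%N; rewrite ?normr1 ?normr0.
    by rewrite f0// normr0.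
  + move=> x; have [Fx|Fx] := pselect ((\bigcup_j F j `&` cube k) x).
      have [[j _ Fj] cx] := Fx; rewrite indicE mem_set//.
      apply: cvg_near_cst; exists j.+1 => // m /= jm.
      by rewrite (fE j)// (leq_trans _ jm).
    rewrite indicE memNset//; under eq_fun do rewrite f0//; exact: cvg_cst.
Qed.

Import HBNNSimple.

(** Simple functions approximate [f] from below; cutting them off to growing cubes makes them finite
    combinations of the indicators of [tight_cubeI]. *)
Lemma tight_ge0 f : (forall x, 0 <= f x) -> L12 f -> tight f.
Proof.
move=> f0 Hf; have [fi _] := Hf.
have mf : measurable_fun setT (EFin \o f) by apply/measurable_EFinP; exact: L1_measurable fi.
pose h := nnsfun_approx measurableT mf.
have hf k x : h k x <= f x.
  rewrite -lee_fin /h nnsfun_approxE; apply: le_approx => //.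
  by move=> y _; rewrite lee_fin.
have h0 k x : 0 <= h k x by [].
have ch x : h k x @[k --> \oo] --> f x.
  have H0 (y : E) : [set: E] y -> (0 <= (EFin \o f) y)%E by rewrite lee_fin.
  have := cvg_nnsfun_approx measurableT mf H0 (I : [set: E] x).
  by move=> /fine_cvgP[_].
apply: (@tight_lim (fun k x => h k x * \1_(cube k) x)) => //.
- move=> k.
  have -> : (fun x => h k x * \1_(cube k) x) =
      fun x => \sum_(y <- finmap.enum_fset (fset_set (range (h k)))) y * \1_(h k @^-1` [set y] `&` cube k) x.
    apply/funext => x; rewrite {1}fimfunE fsbig_finite//= mulr_suml.
    by apply: eq_bigr => y _; rewrite indicI/= mulrA.
  apply: tight_sum => y; apply: tightZ; apply: tight_cubeI.
  exact: measurable_sfunP.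
- move=> k x; rewrite normrM (ger0_norm (h0 k x)) (ger0_norm (f0 x)).
  rewrite (le_trans _ (hf k x))// -[leRHS]mulr1 ler_wpM2l//.
  by rewrite indicE; case: (_ \in _); rewrite ?normr1 ?normr0.
- move=> x; rewrite -[X in _ --> X]mulr1; apply: cvgM => //.
  apply: cvg_near_cst; have [K HK] := cubeP x; exists K => // k /= Kk.
  by rewrite indicE mem_set//; exact: HK.
Qed.

Lemma L12_abs_le f g : measurable_fun setT f -> L12 g ->
  (forall x, `|f x| <= `|g x|) -> L12 f.
Proof.
move=> mf [gi g2] fg; split.
  by apply: (@L1_le _ _ _ _ _ (fun x => `|g x|)) => //; exact: L1_abs.
apply: (@L1_le _ _ _ _ _ (fun x => g x ^+ 2)) => //; first exact: measurable_funX.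
move=> x; rewrite normrX -(real_normK (num_real (g x))).
by rewrite ler_sqr ?nnegrE.
Qed.

Theorem plancherel f : L12 f ->
  L1 mu (fpower f) /\
  \int[mu]_xi fpower f xi = fejer_mass ^+ n * \int[mu]_x f x ^+ 2.
Proof.
move=> Hf; split; first by have [] := bessel Hf.
have mf : measurable_fun setT f by case: Hf => /L1_measurable.
have mz : measurable_fun setT (fun=> 0 : R) by [].
pose p x := Num.max (f x) 0; pose q x := Num.max (- f x) 0.
have Hp : L12 p.
  apply: L12_abs_le Hf _; first exact: measurable_maxr.
  by move=> x; rewrite /p; case: (leP (f x) 0); rewrite ?normr0.
have Hq : L12 q.
  apply: L12_abs_le Hf _; first by apply: measurable_maxr => //; exact: measurableT_comp.
  by move=> x; rewrite /q; case: (leP (- f x) 0); rewrite ?normr0 ?normrN.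
have [_] : tight (fun x => p x - q x).
  apply: tightB; apply: tight_ge0 => // x; rewrite /p /q le_max lexx orbT//.
rewrite (_ : (fun x => p x - q x) = f); first by move/eqP; rewrite subr_eq0 => /eqP.
apply/funext => x; rewrite /p /q.
by case: (leP (f x) 0); case: (leP (- f x) 0); lra.
Qed.

End plancherel.

(** * Smooth functions and bumps *)

Definition smooth1 {R : realType} (h : R -> R) := forall n (x : R), derivable (derive1n n h) x 1.

Section smooth1.
Context {R : realType}.
Implicit Types h : R -> R.

(** Coinduction: [P] is an invariant that implies derivability and is inherited by the
    derivative. *)
Lemma smooth1_coind (P : (R -> R) -> Prop) :
  (forall h, P h -> (forall x : R, derivable h x 1) /\ P (derive1 h)) ->
  forall h, P h -> smooth1 h.
Proof.
move=> PH h Ph n x.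
have : P (derive1n n h) by elim: n => [//|n IH]; rewrite derive1nS; have [] := PH _ IH.
by move=> /PH[].
Qed.

Lemma smooth1_derivable h : smooth1 h -> forall x : R, derivable h x 1.
Proof. by move=> /(_ 0%N). Qed.

Lemma smooth1_derive1 h : smooth1 h -> smooth1 (derive1 h).
Proof.
move=> sh n x; have := sh n.+1 x.
by rewrite /derive1n -iterSr.
Qed.

Lemma smooth1_intro h : (forall x : R, derivable h x 1) -> smooth1 (derive1 h) -> smooth1 h.
Proof.
move=> dh sh [|n] x; first exact: dh.
by have := sh n x; rewrite /derive1n -iterSr.
Qed.

Lemma smooth1_continuous h : smooth1 h -> continuous h.
Proof.
move=> sh x; apply: differentiable_continuous; apply/derivable1_diffP.
exact: smooth1_derivable.
Qed.

Lemma smooth1_cos : smooth1 (@cos R).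
Proof.
apply: (@smooth1_coind (fun h => exists a b, h = fun x => a * cos x + b * sin x)).
  move=> _ [a [b ->]].
  have H (x : R) : is_derive x 1 (fun x => a * cos x + b * sin x) (b * cos x + (- a) * sin x).
    by apply: is_derive_eq; rewrite /GRing.scale/=; ring.
  split; first by move=> x; have [] := H x.
  by exists b, (- a); apply/funext => x; rewrite derive1E; have [_ ->] := H x.
by exists 1, 0; apply/funext => x; rewrite mul1r mul0r addr0.
Qed.

End smooth1.

(* Functions obtained from one-variable smooth functions of affine forms by
   sums and products; the class is visibly stable under directional
   derivatives. *)
Inductive tame {R : realType} {V : normedModType R} : (V -> R) -> Prop :=
| tame_comp h (l : V -> R) : smooth1 h -> (forall z, differentiable l z) ->
    (forall v, exists c, forall z, 'D_v l z = c) -> tame (fun z => h (l z))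
| tame_cst (c : R) : tame (fun=> c)
| tame_add f g : tame f -> tame g -> tame (fun z => f z + g z)
| tame_mul f g : tame f -> tame g -> tame (fun z => f z * g z).

Section tame.
Context {R : realType} {V : normedModType R}.
Implicit Types (f g : V -> R) (h : R -> R).

Lemma derive_comp1 h (l : V -> R) (z v : V) : derivable h (l z) 1 ->
  differentiable l z ->
  differentiable (fun z => h (l z)) z /\
  'D_v (fun z => h (l z)) z = 'D_v l z * derive1 h (l z).
Proof.
move=> /derivable1_diffP dh dl.
have dhl : differentiable (h \o l) z by exact: differentiable_comp.
split => //; rewrite (deriveE _ dhl) (deriveE _ dl) diff_comp//=.
rewrite [in RHS]derive1E' //.
by rewrite -[X in 'd h _ X]mulr1 -[_ * 1]/( _ *: (1 : R)) linearZ.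
Qed.

Lemma tame_differentiable f : tame f -> forall z, differentiable f z.
Proof.
elim=> [h l sh dl _ z|c z|f1 g1 _ IHf _ IHg z|f1 g1 _ IHf _ IHg z].
- by have [] := derive_comp1 0 (@smooth1_derivable _ _ sh (l z)) (dl z).
- exact: differentiable_cst.
- exact: differentiableD.
- exact: differentiableM.
Qed.

Lemma tame_derive f v : tame f -> tame ('D_v f).
Proof.
move=> tf; elim: tf v => {f} [h l sh dl Dl v|c v|f g tf IHf tg IHg v|f g tf IHf tg IHg v].
- have [c lc] := Dl v.
  rewrite (_ : 'D_v _ = fun z => c * derive1 h (l z)).
    by apply: tame_mul; [exact: tame_cst|apply: tame_comp => //; exact: smooth1_derive1].
  apply/funext => z; rewrite -(lc z).
  by have [] := derive_comp1 v (@smooth1_derivable _ _ sh (l z)) (dl z).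
- rewrite (_ : 'D_v _ = fun=> 0); first exact: tame_cst.
  by apply/funext => z; exact: derive_cst.
- rewrite (_ : 'D_v _ = fun z => 'D_v f z + 'D_v g z); first exact: tame_add.
  apply/funext => z; apply: deriveD; apply: diff_derivable; exact: tame_differentiable.
- rewrite (_ : 'D_v _ = fun z => f z * 'D_v g z + g z * 'D_v f z).
    by apply: tame_add; apply: tame_mul.
  apply/funext => z; apply: deriveM; apply: diff_derivable; exact: tame_differentiable.
Qed.

Lemma tame_smooth f : tame f -> smooth f.
Proof.
move=> tf vs z; apply: tame_differentiable.
by elim: vs => [//|v vs IH] /=; exact: tame_derive.
Qed.

Lemma tame_prod I (r : seq I) (f : I -> V -> R) : (forall i, tame (f i)) ->
  tame (fun z => \prod_(i <- r) f i z).
Proof.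
move=> Hf; elim: r => [|a r IH].
  by under eq_fun do rewrite big_nil; exact: tame_cst.
by under eq_fun do rewrite big_cons; exact: tame_mul.
Qed.

End tame.

Section smooth1_tame.
Context {R : realType}.

Lemma tame_smooth1 (f : R -> R) : @tame R R f -> smooth1 f.
Proof.
apply: smooth1_coind => h th; split.
  by move=> x; apply/derivable1_diffP; exact: tame_differentiable.
rewrite (_ : derive1 h = 'D_1 h); first exact: tame_derive.
by apply/funext => x; rewrite derive1E.
Qed.

Lemma tame_affine h (c b : R) : smooth1 h -> @tame R R (fun x => h (c * x + b)).
Proof.
move=> sh.
have H (v z : R) : is_derive z v (fun x => c * x + b) (c * v).
  by apply: is_derive_eq; rewrite /GRing.scale/=; ring.
apply: (@tame_comp R R h (fun x => c * x + b)) => //.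
- by move=> v; exists (c * v) => z; have [_ ->] := H v z.
Qed.

Lemma smooth1M (f g : R -> R) : smooth1 f -> smooth1 g -> smooth1 (fun x => f x * g x).
Proof.
move=> sf sg; apply: tame_smooth1; apply: tame_mul.
  by have := tame_affine 1 0 sf; under eq_fun do rewrite mul1r addr0.
by have := tame_affine 1 0 sg; under eq_fun do rewrite mul1r addr0.
Qed.

End smooth1_tame.

(** * A smooth compactly supported bump *)

Section bump.
Context {R : realType}.
Local Notation leb := (@lebesgue_measure R).
Implicit Types p : {poly R}.

(** Carrying an arbitrary polynomial in [x^-1] along makes the family stable under derivation, so it
    can serve as an invariant for [smooth1_coind]. *)
Definition expinv_poly p (x : R) : R :=
  if 0 < x then p.[x^-1] * expR (- x^-1) else 0.

(** Each [y ^+ i / i!] is at most [expR y], whence the constant, the sum of the [|p_i| i!]. *)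
Lemma poly_le_expR p : exists C, forall y : R, 0 <= y -> `|p.[y]| <= C * expR y.
Proof.
exists (\sum_(i < size p) `|p`_i| * i`!%:R) => y y0.
rewrite horner_coef (le_trans (ler_norm_sum _ _ _))// mulr_suml.
apply: ler_sum => i _; rewrite normrM -mulrA ler_wpM2l//.
rewrite ger0_norm ?exprn_ge0//; case: (i : nat) => [|k].
  by rewrite expr0 fact0 mul1r -expR0 ler_expR.
have H := expR_ge1Dxn k y0.
have f0 : 0 < k.+1`!%:R :> R by rewrite ltr0n fact_gt0.
by rewrite mulrC -ler_pdivrMr//; apply: le_trans H; rewrite lerDr.
Qed.

(** Away from 0 this is the chain rule, which produces the polynomial [X^2 (p - p')]. At 0 the
    function is [O(y^2)], since the exponential dominates [X^2 p]; hence the derivative there is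
    0. *)
Lemma is_derive_expinv p (x : R) :
  is_derive x 1 (expinv_poly p) (expinv_poly ('X^2 * (p - p^`())) x).
Proof.
have [x0|x0|->] := ltrgt0P x.
- have H : is_derive x 1 (fun x => p.[x^-1] * expR (- x^-1))
      (expinv_poly ('X^2 * (p - p^`())) x).
    have xn0 : x != 0 by rewrite gt_eqF.
    have H1 : is_derive x 1 (fun x => x^-1) (- x ^- 2).
      apply: DeriveDef; first exact: derivableV.
      by rewrite deriveV// derive_id /GRing.scale/= mulr1.
    have H2 : is_derive x 1 (fun x => p.[x^-1]) (- x ^- 2 * p^`().[x^-1]).
      have := @is_derive1_comp _ (horner p) (fun x => x^-1) x _ _ (is_derive_poly p x^-1) H1.
      by move=> H; apply: is_derive_eq; rewrite /GRing.scale/= mulrC.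
    have H3 : is_derive x 1 (fun x => expR (- x^-1)) (x ^- 2 * expR (- x^-1)).
      have := @is_derive1_comp _ expR (fun x => - x^-1) x _ _ (is_derive_expR (- x^-1)) _.
      by move=> H; apply: is_derive_eq; rewrite /GRing.scale/= opprK mulrC.
    apply: is_derive_eq; rewrite /expinv_poly x0 !hornerE /GRing.scale/= -exprVn.
    by ring.
  apply: near_eq_is_derive H; near=> y; rewrite /expinv_poly ifT//.
  near: y; exact: lt_nbhsr.
- have H : is_derive x 1 (fun=> 0 : R) (0 : R) by exact: is_derive_cst.
  rewrite /expinv_poly ltNge ltW//=.
  apply: near_eq_is_derive H; near=> y; rewrite ifF//; apply/negbTE; rewrite -leNgt ltW//.
  near: y; exact: lt_nbhsl.
- rewrite {2}/expinv_poly ltxx.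
  have [C HC] := poly_le_expR ('X^2 * p).
  have bnd (y : R) : `|expinv_poly p y| <= `|C| * y ^+ 2.
    set bnd_rhs := (X in _ <= X); rewrite /expinv_poly; case: ifPn => y0; last first.
      by rewrite normr0 mulr_ge0// sqr_ge0.
    have yi0 : 0 <= y^-1 by rewrite invr_ge0 ltW.
    have := HC _ yi0; rewrite !hornerE normrM ger0_norm ?exprn_ge0// => Hy.
    rewrite normrM (ger0_norm (expR_ge0 _)) expRN.
    apply: (@le_trans _ _ (y ^+ 2 * C)); last first.
      rewrite /bnd_rhs [leLHS]mulrC; apply: ler_wpM2r; first exact: sqr_ge0.
      exact: ler_norm.
    rewrite ler_pdivrMr ?expR_gt0// -mulrA.
    rewrite -[leLHS]mul1r -(@mulfV _ (y ^+ 2)) ?expf_neq0 ?gt_eqF// -mulrA -exprVn.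
    by rewrite ler_wpM2l ?sqr_ge0.
  have H0 : (fun h => h^-1 *: (expinv_poly p (h *: (1 : R) + 0) - expinv_poly p 0)) @ 0^' --> (0 : R).
    apply/cvgr0Pnorm_lt => e e0.
    near=> h.
    rewrite addr0 /GRing.scale/= mulr1 [X in _ - X]/expinv_poly ltxx subr0 normrM normfV.
    have h0 : h != 0 by near: h; exact: nbhs_dnbhs_neq.
    have h0' : 0 < `|h| by rewrite normr_gt0.
    rewrite mulrC ltr_pdivrMr// (le_lt_trans (bnd h))// -real_normK ?num_real// expr2 mulrA.
    rewrite ltr_pM2r// (@le_lt_trans _ _ ((`|C| + 1) * `|h|))//.
      by rewrite ler_wpM2r// lerDl.
    rewrite -ltr_pdivlMl ?ltr_pwDr//.
    near: h; apply: dnbhs0_lt; rewrite mulr_gt0// invr_gt0 ltr_pwDr//.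
  apply: DeriveDef; last exact: cvg_lim H0.
  exact: cvgP H0.
Unshelve. all: by end_near. Qed.

Lemma smooth1_expinv p : smooth1 (expinv_poly p).
Proof.
apply: (@smooth1_coind R (fun h => exists p, h = expinv_poly p)); last by exists p.
move=> _ [q ->]; split; first by move=> x; have [] := is_derive_expinv q x.
exists ('X^2 * (q - q^`())); apply/funext => x.
by rewrite derive1E; have [_ ->] := is_derive_expinv q x.
Qed.

Definition bump (x : R) : R := expinv_poly 1 (1 + x) * expinv_poly 1 (1 - x).

Lemma expinvE (x : R) : expinv_poly 1 x = if 0 < x then expR (- x^-1) else 0.
Proof. by rewrite /expinv_poly hornerE mul1r. Qed.

Lemma expinv_ge0 (x : R) : 0 <= expinv_poly 1 x.
Proof. by rewrite expinvE; case: ifP => // _; exact: expR_ge0. Qed.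

Lemma expinv_le1 (x : R) : expinv_poly 1 x <= 1.
Proof.
rewrite expinvE; case: ifP => // x0; rewrite -expR0 ler_expR oppr_le0 invr_ge0.
exact: ltW.
Qed.

Lemma smooth1_bump : smooth1 bump.
Proof.
apply: tame_smooth1; apply: tame_mul.
  have := tame_affine 1 1 (@smooth1_expinv 1).
  by under eq_fun do rewrite mul1r addrC.
have := tame_affine (-1) 1 (@smooth1_expinv 1).
by under eq_fun do rewrite mulN1r addrC.
Qed.

Lemma bumpN x : bump (- x) = bump x.
Proof. by rewrite /bump opprK mulrC. Qed.

Lemma bump_ge0 x : 0 <= bump x.
Proof. by rewrite mulr_ge0// expinv_ge0. Qed.

Lemma bump_le1 x : bump x <= 1.
Proof. by rewrite -[leRHS](mulr1 1) ler_pM// ?expinv_ge0// expinv_le1. Qed.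

Lemma bump_supp x : 1 <= `|x| -> bump x = 0.
Proof.
rewrite /bump !expinvE ler_normr => /orP[x1|x1].
  by rewrite [in X in _ * X]ifF ?mulr0//; apply/negbTE; rewrite -leNgt; lra.
by rewrite ifF ?mul0r//; apply/negbTE; rewrite -leNgt; lra.
Qed.

(** Both factors of [bump] are evaluated at points at least [1 / 2], so each is at least
    [expR (-2)]. *)
Lemma bump_ge (x : R) : `|x| <= 2^-1 -> expR (-4) <= bump x.
Proof.
have H (y : R) : 2^-1 <= y -> expR (-2) <= expinv_poly 1 y.
  move=> y2; have y0 : 0 < y by lra.
  rewrite expinvE y0 ler_expR lerN2 -[2]invrK lef_pV2 ?posrE//; lra.
move=> /ler_normlP[x1 x2].
rewrite (_ : expR (-4) = expR (-2) * expR (-2)); last by rewrite -expRD; congr expR; ring.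
by apply: ler_pM; rewrite ?expR_ge0//; apply: H; lra.
Qed.

Lemma measurable_bump : measurable_fun setT bump.
Proof. apply: continuous_measurable_fun; exact: smooth1_continuous smooth1_bump. Qed.

Lemma L1_bump : L1 leb bump.
Proof.
apply: (@L1_bounded_supp _ (-1) 1 1); first exact: measurable_bump.
- move=> x; rewrite in_itv/= -ler_norml -ltNge => x1; apply: bump_supp; exact: ltW.
- by move=> x; rewrite ger0_norm ?bump_ge0// bump_le1.
Qed.

End bump.

(** * Decay and mass of the transform of the bump *)

Section bump_fourier.
Context {R : realType}.
Local Notation leb := (@lebesgue_measure R).
Implicit Types h : R -> R.

(** The strict inequality describes an open set, on which the derivative of [h] vanishes as well. *)
Definition supp1 h := forall x : R, 1 < `|x| -> h x = 0.

Lemma supp1_derive1 h : supp1 h -> supp1 (derive1 h).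
Proof.
move=> h0 x x1; rewrite derive1E.
rewrite -(@near_eq_derive _ _ _ (fun=> 0) h x 1); first exact: derive_cst.
near=> y; rewrite h0//; near: y.
exact: (cvgr_gt _ (@norm_continuous R R x)).
Unshelve. all: by end_near. Qed.

Lemma L1_continuous_supp1 h : continuous h -> supp1 h -> L1 leb h.
Proof.
move=> ch h0; have : leb.-integrable `[-1, 1] (EFin \o h).
  apply: continuous_compact_integrable; first exact: segment_compact.
  exact: continuous_subspaceT.
rewrite integrable_mkcond//.
apply: eq_integrable => // x _; rewrite patchE; case: ifPn => //= x1.
rewrite h0// ltNge ler_norml; apply: contra x1 => x1.
by rewrite inE/= in_itv.
Qed.

(** Two integrations by parts at once: [F] is a primitive of the sum [f] of the two integrands and
    vanishes outside the support. *)
Lemma fourier_ibp h (u : R) : smooth1 h -> supp1 h ->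
  u ^+ 2 * \int[leb]_x (h x * cos (x * u)) =
  - \int[leb]_x (derive1 (derive1 h) x * cos (x * u)).
Proof.
move=> sh h0; have sh1 := smooth1_derive1 sh; have sh2 := smooth1_derive1 sh1.
have h10 := supp1_derive1 h0; have h20 := supp1_derive1 h10.
have dh (x : R) : is_derive x 1 h (derive1 h x).
  by apply: DeriveDef; [exact: (@smooth1_derivable _ _ sh x)|rewrite derive1E].
have dh1 (x : R) : is_derive x 1 (derive1 h) (derive1 (derive1 h) x).
  by apply: DeriveDef; [exact: (@smooth1_derivable _ _ sh1 x)|rewrite [RHS]derive1E].
pose F (x : R) := derive1 h x * cos (x * u) + u * (h x * sin (x * u)).
pose f (x : R) := derive1 (derive1 h) x * cos (x * u) + u ^+ 2 * (h x * cos (x * u)).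
have dF (x : R) : is_derive x 1 F (f x).
  apply: is_derive_eq; rewrite /f /GRing.scale/=; ring.
have ccos : continuous (fun x : R => cos (x * u)).
  by move=> x; apply: differentiable_continuous; apply/derivable1_diffP; exact: ex_derive.
have cont (k : R -> R) : smooth1 k -> continuous (fun x => k x * cos (x * u)).
  by move=> sk x; apply: cvgM; [exact: smooth1_continuous|exact: ccos].
have cf : continuous f.
  move=> x; apply: cvgD; first exact: cont.
  by apply: cvgM; [exact: cvg_cst|exact: cont].
have i0 : L1 leb (fun x => h x * cos (x * u)).
  by apply: L1_continuous_supp1; [exact: cont|move=> x x1; rewrite h0// mul0r].
have i2 : L1 leb (fun x => derive1 (derive1 h) x * cos (x * u)).
  by apply: L1_continuous_supp1; [exact: cont|move=> x x1; rewrite h20// mul0r].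
have : \int[leb]_x f x = 0.
  (* The endpoints are taken strictly outside [[-1, 1]], where [supp1] makes [h] and its derivative
     vanish. *)
  rewrite (@Rint_supp _ (-2) 2); last first.
    move=> x; rewrite in_itv/= -ler_norml -ltNge => x2.
    by rewrite /f h0 ?h20 ?mul0r ?mulr0 ?addr0//; lra.
  rewrite (FTC_Rint _ dF cf); last by lra.
  rewrite /F !h0 ?h10 ?normrN ?(mul0r, mulr0, addr0, subr0)// ger0_norm; lra.
rewrite RintD ?RintZ//; last exact: L1Z.
by move=> E; lra.
Qed.

Definition bump_hat (u : R) : R := \int[leb]_x (bump x * cos (x * u)).

Lemma bump_cos u b : \int[leb]_x (bump x * cos (x * u + b)) = cos b * bump_hat u.
Proof. by apply: Rint_even_cos; [exact: L1_bump|exact: bumpN]. Qed.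

Lemma bump_hatN u : bump_hat (- u) = bump_hat u.
Proof. by apply: eq_Rintegral => x _; rewrite mulrN cosN. Qed.

Lemma measurable_bump_hat : measurable_fun setT bump_hat.
Proof.
apply: (@measurable_Rint2 _ _ _ _ R leb (fun u x => bump x * cos (x * u))).
apply: measurable_funM.
  exact: (measurableT_comp measurable_bump measurable_snd).
apply: (measurableT_comp (@measurable_cos R)).
exact: measurable_funM.
Qed.

Lemma normr_Rint_cos h u : L1 leb h ->
  `|\int[leb]_x (h x * cos (x * u))| <= \int[leb]_x `|h x|.
Proof.
move=> ih; have i1 : L1 leb (fun x => h x * cos (x * u)).
  by have := L1_mul_cos u 0 ih; under eq_fun do rewrite addr0.
rewrite (le_trans (Rint_norm i1))//; apply: Rint_le; [exact: L1_abs|exact: L1_abs|].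
by move=> x; rewrite normrM -[leRHS]mulr1 ler_wpM2l// normr_cos_le1.
Qed.

(** Integrating by parts twice over gives decay of order 4. One factor [1 + u ^+ 2] will absorb the
    growth of the symbol, the other one leaves an integrable function. *)
Lemma bump_hat_decay : exists2 C : R, 0 <= C & forall u : R, (1 + u ^+ 2) * `|bump_hat u| <= C * (1 + u ^+ 2)^-1.
Proof.
have b0 : @supp1 bump by move=> x x1; apply: bump_supp; exact: ltW.
have sb := @smooth1_bump R.
have s2 := smooth1_derive1 (smooth1_derive1 sb).
have s4 := smooth1_derive1 (smooth1_derive1 s2).
have b2 := supp1_derive1 (supp1_derive1 b0).
have b4 := supp1_derive1 (supp1_derive1 b2).
have i4 : L1 leb (derive1 (derive1 (derive1 (derive1 bump)))).
  by apply: L1_continuous_supp1 => //; exact: smooth1_continuous.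
exists (2 * (\int[leb]_x `|bump x| + \int[leb]_x `|derive1 (derive1 (derive1 (derive1 bump))) x : R|)).
  by rewrite mulr_ge0// addr_ge0// Rint_ge0.
move=> u; have u1 : 0 < 1 + u ^+ 2 by rewrite ltr_wpDr// sqr_ge0.
rewrite ler_pdivlMr//.
have E : u ^+ 4 * bump_hat u = \int[leb]_x (derive1 (derive1 (derive1 (derive1 bump))) x * cos (x * u)).
  rewrite /bump_hat (_ : u ^+ 4 = u ^+ 2 * u ^+ 2); last by ring.
  by rewrite -mulrA fourier_ibp// mulrN fourier_ibp// opprK.
have B0 := normr_Rint_cos u (@L1_bump R).
have B4 := normr_Rint_cos u i4.
rewrite -E normrM in B4.
rewrite -/(bump_hat u) in B0.
have u4 : `|u ^+ 4| = u ^+ 4 by rewrite ger0_norm// exprn_even_ge0.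
rewrite u4 in B4.
have n0 := normr_ge0 (bump_hat u).
have : (1 + u ^+ 2) * (1 + u ^+ 2) <= 2 * (1 + u ^+ 4).
  by have := sqr_ge0 (1 - u ^+ 2); lra.
move=> /(ler_wpM2r n0) H; rewrite mulrAC mulrC mulrA (le_trans _ (le_trans H _))//.
  by rewrite le_eqVlt; apply/orP; left; apply/eqP; ring.
lra.
Qed.

Lemma L1_bump_hat_weight : L1 leb (fun u => (1 + u ^+ 2) * `|bump_hat u|).
Proof.
have [C C0 HC] := bump_hat_decay.
apply: (@L1_le _ _ _ leb _ (fun u => C * (1 + u ^+ 2)^-1)).
- apply: measurable_funM; first by apply: measurable_funD => //; exact: measurable_funX.
  by apply: measurableT_comp => //; exact: measurable_bump_hat.
- by apply: L1Z; exact: L1_oneDsqrV.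
- by move=> u; rewrite ger0_norm ?HC// mulr_ge0// addr_ge0// sqr_ge0.
Qed.

Lemma L1_bump_hat : L1 leb bump_hat.
Proof.
apply: (@L1_le _ _ _ leb _ (fun u => (1 + u ^+ 2) * `|bump_hat u|)).
- exact: measurable_bump_hat.
- exact: L1_bump_hat_weight.
- by move=> u; rewrite -[leLHS]mul1r ler_wpM2r// lerDl sqr_ge0.
Qed.

Lemma tent_scaled_cos (c u : R) : 0 < c ->
  \int[leb]_x (tent (c^-1 * x) * cos (x * u)) = c * fejer (c * u).
Proof.
move=> c0; have ci0 : 0 < c^-1 by rewrite invr_gt0.
have := @Rint_affine R c^-1 0 (fun y => tent y * cos (y * (c * u) + 0)) ci0.
rewrite tent_cos cos0 mul1r invrK => <-; last first.
  apply: measurable_funM; first exact: measurable_tent.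
  exact: measurable_cos_affine.
apply: eq_Rintegral => x _; rewrite !addr0; congr (_ * cos _).
by rewrite mulrACA mulVf ?mul1r// gt_eqF.
Qed.

(* Weighting with a wide tent turns the integral of the transform of [bump]
   into an average of [bump] against the nonnegative Fejer kernel. *)
Lemma bump_hat_mass_gt0 : 0 < \int[leb]_u bump_hat u.
Proof.
pose r : R := expR (-4).
pose c1 : R := \int[leb]_u (\1_(`]0, 1[) u * fejer u).
have c1r : 0 < r * c1 by rewrite mulr_gt0 ?expR_gt0// fejer01_gt0.
apply: (lt_le_trans c1r).
have i01 : L1 leb (fun u => \1_(`]0, 1[) u * fejer u).
  apply: (@L1_bounded_mul _ _ _ _ 1); last exact: L1_fejer.
  - exact: measurable_indic.
  - by move=> x; rewrite indicE; case: (_ \in _); rewrite ?normr1 ?normr0.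
have tentL1 (c : R) : 0 < c -> L1 leb (fun y => tent (c^-1 * y)).
  move=> c0; have := @L1_affine R c^-1 0 tent; under [in X in _ -> _ -> X]eq_fun do rewrite addr0.
  by apply; [rewrite invr_gt0|exact: L1_tent].
(* With scale [N.+2], at least 2, the region [0 < N.+2 * x < 1] lies in [|x| <= 1 / 2], where [bump]
   is at least [r]. *)
have lower N : r * c1 <= \int[leb]_u (tent (N.+2%:R^-1 * u) * bump_hat u).
  have N0 : 0 < N.+2%:R :> R by [].
  have hi : L1 (leb \x leb)%E (fun q : R * R => tent (N.+2%:R^-1 * q.1) * bump q.2 * cos (q.2 * q.1)).
    under eq_fun do rewrite mulrC.
    apply: (@L1_bounded_mul _ _ R (leb \x leb)%E 1
      (fun q : R * R => tent (N.+2%:R^-1 * q.1) * bump q.2) (fun q => cos (q.2 * q.1))).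
    - by apply: (measurableT_comp (@measurable_cos R)); exact: measurable_funM.
    - by move=> q; exact: normr_cos_le1.
    - apply: (@L1_prod _ _ _ _ R leb leb (fun y => tent (N.+2%:R^-1 * y)) bump).
        exact: tentL1.
      exact: L1_bump.
  have -> : \int[leb]_u (tent (N.+2%:R^-1 * u) * bump_hat u) =
            \int[leb]_x (bump x * (N.+2%:R * fejer (N.+2%:R * x + 0))).
    transitivity (\int[leb]_u \int[leb]_x (tent (N.+2%:R^-1 * u) * bump x * cos (x * u))).
      apply: eq_Rintegral => u _; rewrite /bump_hat -RintZ.
        by apply: eq_Rintegral => x _; rewrite mulrA.
      by have := L1_mul_cos u 0 (@L1_bump R); under eq_fun do rewrite addr0.
    rewrite (@Rint_swap _ _ _ _ R leb leb (fun u x => tent (N.+2%:R^-1 * u) * bump x * cos (x * u)) hi).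
    apply: eq_Rintegral => x _; rewrite addr0 -tent_scaled_cos// -RintZ.
      by apply: eq_Rintegral => u _; rewrite (mulrC x); ring.
    by have := L1_mul_cos x 0 (tentL1 _ N0); under eq_fun do rewrite addr0.
  have -> : r * c1 = \int[leb]_x ((r * N.+2%:R) * (\1_(`]0, 1[) (N.+2%:R * x + 0) * fejer (N.+2%:R * x + 0))).
    rewrite RintZ; last exact: (@L1_affine R _ 0 _ N0 i01).
    rewrite (@Rint_affine R _ 0 (fun u => \1_(`]0, 1[) u * fejer u))//; last exact: L1_measurable i01.
    by rewrite -/c1; field.
  apply: Rint_le.
  - apply: L1Z; exact: (@L1_affine R _ 0 _ N0 i01).
  - apply: (@L1_bounded_mul _ _ R leb 1).
    + exact: measurable_bump.
    + by move=> x; rewrite ger0_norm ?bump_ge0// bump_le1.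
    + by apply: L1Z; apply: L1_affine => //; exact: L1_fejer.
  - move=> x; rewrite mulrACA ler_wpM2r ?mulr_ge0 ?fejer_ge0//.
    rewrite indicE; have [x01|_] := boolP (_ \in _); last by rewrite mulr0 bump_ge0.
    rewrite mulr1; apply: bump_ge.
    move: x01; rewrite inE/= in_itv/= addr0 => /andP[x0 x1].
    have x0' : 0 < x by rewrite -(pmulr_rgt0 _ N0).
    rewrite (ger0_norm (ltW x0')) -[x](mulKf (lt0r_neq0 N0)) -[leRHS]mulr1.
    apply: ler_pM; [by rewrite invr_ge0|exact: ltW| |exact: ltW].
    by rewrite lef_pV2 ?posrE// ler_nat.
have [|||||_] := @dominated_Rint _ _ _ leb (fun N u => tent (N.+2%:R^-1 * u) * bump_hat u)
  bump_hat (fun u => `|bump_hat u|).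
- move=> N; apply: measurable_funM; last exact: measurable_bump_hat.
  apply: (measurableT_comp (@measurable_tent R)).
  exact: measurable_funM.
- exact: measurable_bump_hat.
- move=> u; rewrite -[X in _ --> X]mul1r; apply: cvgM; last exact: cvg_cst.
  have cN' : (N.+2%:R^-1 * u) @[N --> \oo] --> 0 * u.
    apply: cvgM; last exact: cvg_cst.
    have := @cvg_harmonic R; rewrite -(@cvg_shiftn 1 R) /=.
    by under eq_fun do rewrite addn1.
  rewrite [X in _ --> X](_ : 1 = tent (0 * u)); last first.
    by rewrite mul0r /tent normr0 subr0; apply/esym/max_idPr.
  exact: (cvg_comp _ _ cN' (@continuous_tent R _)).
- by apply: L1_abs; exact: L1_bump_hat.
- move=> N u; rewrite normrM -[leRHS]mul1r ler_wpM2r//.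
  by rewrite ger0_norm ?tent_ge0// tent_le1.
move=> cl; rewrite -(cvg_lim (@Rhausdorff R) cl).
by apply: limr_ge; [exact: cvgP cl|exact: nearW].
Qed.

End bump_fourier.

(** * A smooth step, as primitive of the bump *)

Section step.
Context {R : realType}.
Local Notation leb := (@lebesgue_measure R).

Definition step (y : R) : R := \int[leb]_(t in `]-oo, y]) bump t.

Definition step_height : R := \int[leb]_t bump t.

Lemma step_derive (y : R) : derivable step y 1 /\ derive1 step y = bump y.
Proof.
apply: (@continuous_FTC1 R bump -oo%O y (y + 1)); first by lra.
- apply: (integrableS measurableT) => //; exact: L1_bump.
- by rewrite ltNyr.
- exact: smooth1_continuous (@smooth1_bump R) _.
Qed.

Lemma smooth1_step : smooth1 step.
Proof.
apply: smooth1_intro; first by move=> y; have [] := step_derive y.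
rewrite (_ : derive1 step = bump); first exact: smooth1_bump.
by apply/funext => y; have [] := step_derive y.
Qed.

Lemma step_le (y : R) : y <= -1 -> step y = 0.
Proof.
move=> y1; rewrite /step Rintegral_mkcond -[RHS](Rint_cst0 leb).
apply: eq_Rintegral => t _; rewrite patchE; case: ifPn => //.
rewrite inE/= in_itv/= => ty; apply: bump_supp.
by rewrite ler_normr; apply/orP; right; lra.
Qed.

Lemma step_ge (y : R) : 1 <= y -> step y = step_height.
Proof.
move=> y1; rewrite /step Rintegral_mkcond.
apply: eq_Rintegral => t _; rewrite patchE; case: ifPn => //.
rewrite notin_setE/= in_itv/= => /negP; rewrite -ltNge => ty; rewrite bump_supp//.
by rewrite ler_normr; apply/orP; left; lra.
Qed.

Lemma step_ge0 (y : R) : 0 <= step y.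
Proof. by apply: Rintegral_ge0 => t _; exact: bump_ge0. Qed.

Lemma step_le_height (y : R) : step y <= step_height.
Proof.
rewrite /step Rintegral_mkcond; apply: Rint_le; last first.
- by move=> t; rewrite patchE; case: ifPn => // _; exact: bump_ge0.
- exact: L1_bump.
- rewrite /L1 -restrict_EFin -integrable_mkcond//.
  apply: (integrableS measurableT) => //; exact: L1_bump.
Qed.

Lemma step_height_gt0 : 0 < step_height.
Proof.
have r0 : 0 < expR (-4) :> R by exact: expR_gt0.
apply: (lt_le_trans r0).
have -> : expR (-4) = \int[leb]_x (expR (-4) * \1_`](- 2^-1), 2^-1] x).
  rewrite RintZ; last exact: L1_oc.
  by rewrite Rint_oc; lra.
apply: Rint_le; [by apply: L1Z; exact: L1_oc|exact: L1_bump|].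
move=> x; rewrite indicE; have [x2|_] := boolP (_ \in _); last by rewrite mulr0 bump_ge0.
rewrite mulr1; apply: bump_ge; move: x2; rewrite inE/= in_itv/= => /andP[? ?].
by rewrite ler_norml; apply/andP; split; lra.
Qed.

End step.

(** * The fractional Laplacian of a modulated bump *)

Section powR_limits.
Context {R : realType}.

(** At a positive limit the power is continuous because it is derivable; at the limit 0 the
    convergence comes from monotonicity. *)
Lemma cvg_powR (u : nat -> R) (l r : R) : 0 < r -> (forall n, 0 <= u n) ->
  u n @[n --> \oo] --> l -> u n `^ r @[n --> \oo] --> l `^ r.
Proof.
move=> r0 u0 ul.
have l0 : 0 <= l.
  rewrite -(cvg_lim (@Rhausdorff R) ul).
  by apply: limr_ge; [exact: cvgP ul|exact: nearW].
move: l0; rewrite le_eqVlt => /predU1P[l0|l0].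
  rewrite -l0 powR0 ?gt_eqF// in ul *.
  apply/cvgr0Pnorm_lt => e e0.
  move/cvgr0Pnorm_lt : ul => /(_ (e `^ r^-1)).
  rewrite powR_gt0// => /(_ isT); apply: filterS => n.
  rewrite !ger0_norm ?powR_ge0// => H.
  rewrite (_ : e = (e `^ r^-1) `^ r); last by rewrite -powRrM mulVf ?gt_eqF// powRr1// ltW.
  by apply: gt0_ltr_powR => //; rewrite nnegrE ?powR_ge0.
have cr : {for l, continuous (fun y : R => y `^ r)}.
  apply: differentiable_continuous; apply/derivable1_diffP.
  by apply: derivable_powR; rewrite in_itv/= l0.
exact: (@cvg_comp _ _ _ u (fun y => y `^ r) _ _ _ ul cr).
Qed.

Lemma powR_le_sqr (x r : R) : 0 <= x -> 0 <= r -> r <= 2 -> x `^ r <= 1 + x ^+ 2.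
Proof.
move=> x0 r0 r2; have [x1|x1] := leP x 1.
  rewrite (@le_trans _ _ 1)//; last by rewrite lerDl sqr_ge0.
  by have := @ge0_ler_powR R r r0 x 1; rewrite powR1 !nnegrE => /(_ x0 ler01 x1).
rewrite (@le_trans _ _ (x ^+ 2))//; last by rewrite lerDr.
rewrite -(powR_mulrn 2 x0) ler_powR//; exact: ltW.
Qed.

End powR_limits.

Section symbol.
Context {R : realType} {d : nat}.
Local Notation E := 'rV[R]_d.
Implicit Types (x y xi eta : E).

Definition symbol (s : R) (xi : E) : R := enorm xi `^ (2 * s).

Lemma dot_ge0 x : 0 <= dot x x.
Proof. by apply: sumr_ge0 => i _; rewrite -expr2 sqr_ge0. Qed.

Lemma enorm_ge0 x : 0 <= enorm x. Proof. exact: sqrtr_ge0. Qed.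

Lemma enorm_sqr x : enorm x ^+ 2 = dot x x.
Proof. by rewrite sqr_sqrtr// dot_ge0. Qed.

Lemma dotDl x y z : dot (x + y) z = dot x z + dot y z :> R.
Proof. by rewrite /dot -big_split/=; apply: eq_bigr => i _; rewrite mxE mulrDl. Qed.

Lemma dotC x y : dot x y = dot y x :> R.
Proof. by apply: eq_bigr => i _; rewrite mulrC. Qed.

Lemma dotDr x y z : dot z (x + y) = dot z x + dot z y :> R.
Proof. by rewrite dotC dotDl !(dotC z). Qed.

Lemma dotZl (k : R) x y : dot (k *: x) y = k * dot x y.
Proof. by rewrite /dot mulr_sumr; apply: eq_bigr => i _; rewrite mxE mulrA. Qed.

Lemma dotZr (k : R) x y : dot x (k *: y) = k * dot x y.
Proof. by rewrite dotC dotZl dotC. Qed.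

Lemma dotNr x y : dot x (- y) = - dot x y :> R.
Proof. by rewrite -scaleN1r dotZr mulN1r. Qed.

Lemma dotNl x y : dot (- x) y = - dot x y :> R.
Proof. by rewrite dotC dotNr dotC. Qed.

Lemma enormN x : enorm (- x) = enorm x.
Proof. by rewrite /enorm dotNl dotNr opprK. Qed.

Lemma symbolN s xi : symbol s (- xi) = symbol s xi.
Proof. by rewrite /symbol enormN. Qed.

Lemma measurable_enorm : measurable_fun setT (enorm : E -> R).
Proof.
have mdot : measurable_fun setT (fun x : E => dot x x) by exact: measurable_dot.
apply: (measurableT_comp _ mdot); apply: continuous_measurable_fun.
exact: sqrt_continuous.
Qed.

Lemma measurable_symbol s : measurable_fun setT (symbol s).
Proof. exact: (measurableT_comp (@measurable_powR R (2 * s)) measurable_enorm). Qed.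

Lemma symbol_ge0 s xi : 0 <= symbol s xi. Proof. exact: powR_ge0. Qed.

(** Replaces quadratic growth by a product over the coordinates, which fits the product form of
    [bump_hatn]. *)
Lemma prod_onesq_ge1 x : 1 + dot x x <= \prod_(i < d) (1 + x ord0 i ^+ 2).
Proof.
rewrite /dot; have H : forall r : seq 'I_d,
    1 + \sum_(i <- r) x ord0 i * x ord0 i <= \prod_(i <- r) (1 + x ord0 i ^+ 2).
  elim=> [|a r IH]; first by rewrite !big_nil addr0.
  rewrite !big_cons (le_trans _ (ler_wpM2l _ IH))//; last by rewrite addr_ge0// sqr_ge0.
  have : 0 <= \sum_(j <- r) x ord0 j * x ord0 j.
    by apply: sumr_ge0 => i _; rewrite -expr2 sqr_ge0.
  have := sqr_ge0 (x ord0 a); rewrite expr2; nra.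
exact: H.
Qed.

(** The order [2 * s] is below 2, so the symbol is at most one plus the square of the norm. The
    bound is uniform in [c], which will be [N.+1^-1]. *)
Lemma symbol_bound (s c : R) xi eta : 0 < s < 1 -> 0 <= c <= 1 ->
  symbol s (c *: eta + xi) <= (2 + 2 * dot xi xi) * \prod_(i < d) (1 + eta ord0 i ^+ 2).
Proof.
move=> /andP[s0 s1] /andP[c0 c1].
apply: (@le_trans _ _ (1 + enorm (c *: eta + xi) ^+ 2)).
  by apply: powR_le_sqr; rewrite ?enorm_ge0//; lra.
rewrite enorm_sqr.
have H : dot (c *: eta + xi) (c *: eta + xi) <= 2 * dot eta eta + 2 * dot xi xi.
  have := dot_ge0 (c *: eta - xi).
  rewrite !(dotDl, dotDr, dotNl, dotNr, dotZl, dotZr).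
  have e0 := dot_ge0 eta.
  have : c * (c * dot eta eta) <= dot eta eta.
    rewrite mulrA -[leRHS]mul1r ler_wpM2r//.
    by rewrite -[leRHS](mulr1 1) ler_pM.
  by rewrite (dotC eta xi); lra.
have P := prod_onesq_ge1 eta; have x0 := dot_ge0 xi; have e0 := dot_ge0 eta.
apply: (@le_trans _ _ ((2 + 2 * dot xi xi) * (1 + dot eta eta))); first by nra.
by rewrite ler_wpM2l//; lra.
Qed.

Lemma cvg_symbol (s : R) xi eta : 0 < s ->
  symbol s (N.+1%:R^-1 *: eta + xi) @[N --> \oo] --> symbol s xi.
Proof.
move=> s0; apply: cvg_powR; [lra|by move=> N; exact: enorm_ge0|].
have c0 : (N.+1%:R^-1 : R) @[N --> \oo] --> (0 : R) by exact: cvg_harmonic.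
have H : dot (N.+1%:R^-1 *: eta + xi) (N.+1%:R^-1 *: eta + xi) @[N --> \oo] --> dot xi xi.
  have -> : (fun N => dot (N.+1%:R^-1 *: eta + xi) (N.+1%:R^-1 *: eta + xi)) =
      fun N => N.+1%:R^-1 * (N.+1%:R^-1 * dot eta eta) + N.+1%:R^-1 * dot eta xi +
     (N.+1%:R^-1 * dot xi eta + dot xi xi).
    by apply/funext => N; rewrite !(dotDl, dotDr, dotZl, dotZr); ring.
  have -> : nbhs (dot xi xi) = nbhs (0 * (0 * dot eta eta) + 0 * dot eta xi +
     (0 * dot xi eta + dot xi xi)) by congr nbhs; ring.
  by apply: cvgD; apply: cvgD; do ?apply: cvgM => //; exact: cvg_cst.
exact: (cvg_comp _ _ H (@sqrt_continuous R _)).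
Qed.

End symbol.

Section multiplier.
Context {R : realType} {d : nat}.
Local Notation E := 'rV[R]_d.
Local Notation mu := (@lebesgue_rV R d).
Implicit Types (f : E -> R) (x y xi eta : E).
Local Open Scope complex_scope.

Lemma Re_realM (k : R) (z : R[i]) : complex.Re (k%:C * z) = k * complex.Re z.
Proof. by case: z => a b; rewrite /= mul0r subr0. Qed.

Lemma fourier_multiplier_real (m : E -> R) f x : L1 mu f ->
  fourier_multiplier m f x = (2 * pi) ^- d *
    \int[mu]_xi (m xi * (fcos f xi * cos (dot x xi) + fsin f xi * sin (dot x xi))).
Proof.
move=> fi; rewrite /fourier_multiplier /inverse_fourier Re_realM; congr (_ * _).
rewrite /cintegral; apply: eq_Rintegral => xi _.
rewrite -mulrA Re_realM; congr (_ * _).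
have -> : fourier (fun y => (f y)%:C) xi = fcos f xi +i* (- fsin f xi).
  rewrite /fourier /cintegral; congr (_ +i* _); rewrite /= /fcos /fsin.
    by apply: eq_Rintegral => y _; rewrite mul0r subr0 cosN.
  rewrite -RintN; last exact: L1_fsin.
  by apply: eq_Rintegral => y _; rewrite mul0r addr0 sinN mulrN.
by rewrite /cis /= mulNr opprK.
Qed.

End multiplier.

Section modulated_bump.
Context {R : realType} {d : nat}.
Local Notation E := 'rV[R]_d.
Local Notation mu := (@lebesgue_rV R d).
Implicit Types (x y xi eta v : E).

Definition cutoff (N : nat) x : R := \prod_(i < d) bump (N.+1%:R^-1 * x ord0 i).

Definition bump_hatn eta : R := \prod_(i < d) bump_hat (eta ord0 i).

(** The phases [al = 0] and [al = - (pi / 2)] will yield the cosine and the sine coefficients. *)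
Definition modulated (N : nat) (xi : E) (al : R) (x : E) : R :=
  cutoff N x * cos (dot x xi + al).

Lemma bump_scaled_L1 N : L1 (@lebesgue_measure R) (fun y : R => bump (N.+1%:R^-1 * y)).
Proof.
have := @L1_affine R N.+1%:R^-1 0 bump; under [in X in _ -> _ -> X]eq_fun do rewrite addr0.
by apply; [rewrite invr_gt0|exact: L1_bump].
Qed.

Lemma L1_cutoff N : L1 mu (cutoff N).
Proof.
exact: (@L1_rV_prod R d (fun i (y : R) => bump (N.+1%:R^-1 * y)) (fun=> bump_scaled_L1 N)).
Qed.

Lemma cutoff_ge0 N x : 0 <= cutoff N x.
Proof. by apply: prodr_ge0 => i _; exact: bump_ge0. Qed.

Lemma cutoff_le1 N x : cutoff N x <= 1.
Proof.
rewrite -(big1 (op := *%R) (index_enum 'I_d) xpredT (fun=> 1)) //.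
by apply: ler_prod => i _; rewrite bump_ge0 bump_le1.
Qed.

Lemma cvg_cutoff x : cutoff N x @[N --> \oo] --> bump (0 : R) ^+ d.
Proof.
rewrite (_ : bump 0 ^+ d = \prod_(i < d) bump 0); last by rewrite prodr_const card_ord.
have cN : (N.+1%:R^-1 : R) @[N --> \oo] --> (0 : R) by exact: cvg_harmonic.
apply: cvg_bigprod => i.
have cN' : (N.+1%:R^-1 * x ord0 i) @[N --> \oo] --> 0 * x ord0 i.
  by apply: cvgM => //; exact: cvg_cst.
rewrite mul0r in cN'.
exact: (cvg_comp _ _ cN' (@smooth1_continuous R _ smooth1_bump _)).
Qed.

Lemma cutoff_cos N v b : \int[mu]_y (cutoff N y * cos (dot y v + b)) =
  cos b * (N.+1%:R ^+ d * bump_hatn (N.+1%:R *: v)).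
Proof.
have N0 : 0 < N.+1%:R^-1 :> R by rewrite invr_gt0.
have := @Rint_rV_prod_cos R d (fun i (y : R) => bump (N.+1%:R^-1 * y)) v (fun=> 0)
  (fun i => N.+1%:R * bump_hat (N.+1%:R * v ord0 i)) (fun=> bump_scaled_L1 N) _ b.
rewrite big1// add0r big_split/= prodr_const card_ord => ->.
  by congr (_ * (_ * _)); apply: eq_bigr => i _; rewrite mxE.
move=> i c; rewrite add0r.
have := @Rint_affine R N.+1%:R^-1 0 (fun y : R => bump y * cos (y * (N.+1%:R * v ord0 i) + c)) N0.
rewrite bump_cos invrK mulrCA => <-; last first.
  apply: measurable_funM; first exact: measurable_bump.
  exact: measurable_cos_affine.
apply: eq_Rintegral => x _; rewrite addr0; congr (_ * cos (_ + _)).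
by rewrite mulrACA mulVf ?mul1r// pnatr_eq0.
Qed.

Lemma L1_modulated N xi al : L1 mu (modulated N xi al).
Proof.
rewrite /modulated; under eq_fun do rewrite mulrC.
apply: (@L1_bounded_mul _ _ _ mu 1); last exact: L1_cutoff.
- apply: (measurableT_comp (@measurable_cos R)).
  by apply: measurable_funD => //; exact: measurable_dotl.
- by move=> x; exact: normr_cos_le1.
Qed.

(** By the product formula for cosines, modulation splits the spectrum into two bumps of width of
    order [N.+1^-1], centred at [xi0] and [- xi0]. *)
Lemma modulated_fourier N xi0 al x xi :
  fcos (modulated N xi0 al) xi * cos (dot x xi) +
  fsin (modulated N xi0 al) xi * sin (dot x xi) =
  N.+1%:R ^+ d * (2^-1 * (bump_hatn (N.+1%:R *: xi + - (N.+1%:R *: xi0)) * cos (al + dot x xi)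
   + bump_hatn (N.+1%:R *: xi + (N.+1%:R *: xi0)) * cos (al - dot x xi))).
Proof.
have im := L1_modulated N xi0 al.
have Li v b : L1 mu (fun y => cutoff N y * cos (dot y v + b)) by exact: (L1_modulated N v b).
rewrite ![_ * cos (dot x xi)]mulrC ![_ * sin (dot x xi)]mulrC /fcos /fsin.
rewrite -RintZ; last exact: L1_fcos.
rewrite -RintZ; last exact: L1_fsin.
rewrite -RintD; last 2 first.
- by apply: L1Z; exact: L1_fcos.
- by apply: L1Z; exact: L1_fsin.
have bN : bump_hatn (N.+1%:R *: xi - N.+1%:R *: xi0) = bump_hatn (N.+1%:R *: (xi0 - xi)).
  by apply: eq_bigr => i _; rewrite !mxE -bump_hatN; congr bump_hat; ring.
transitivity (2^-1 * \int[mu]_y (cutoff N y * cos (dot y (xi0 - xi) + (al + dot x xi)) +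
   cutoff N y * cos (dot y (xi0 + xi) + (al - dot x xi)))).
  rewrite -RintZ; last exact: L1D.
  apply: eq_Rintegral => y _; rewrite /modulated !dotDr dotNr.
  rewrite (_ : dot y xi0 - dot y xi + _ = (dot y xi0 + al) + (dot x xi - dot y xi)); last by ring.
  rewrite (_ : dot y xi0 + dot y xi + _ = (dot y xi0 + al) - (dot x xi - dot y xi)); last by ring.
  move: (dot y xi0 + al) => a.
  rewrite cosD [cos (a - _)]cosB cosB sinB.
  by field.
rewrite RintD// !cutoff_cos bN -scalerDr (addrC xi0 xi).
by field.
Qed.

Definition hat_weight eta : R := \prod_(i < d) ((1 + eta ord0 i ^+ 2) * `|bump_hat (eta ord0 i)|).

Lemma L1_hat_weight : L1 mu hat_weight.
Proof.
exact: (@L1_rV_prod R d (fun i u => (1 + u ^+ 2) * `|bump_hat u|) (fun=> L1_bump_hat_weight)).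
Qed.

Lemma measurable_bump_hatn : measurable_fun setT bump_hatn.
Proof.
apply: measurable_prod => i _.
exact: (measurableT_comp (@measurable_bump_hat R) (@measurable_coord R d i)).
Qed.

Lemma L1_bump_hatn : L1 mu bump_hatn.
Proof. exact: (@L1_rV_prod R d (fun=> bump_hat) (fun=> L1_bump_hat)). Qed.

Lemma Rint_bump_hatn_gt0 : 0 < \int[mu]_eta bump_hatn eta.
Proof.
rewrite (@Rint_rV_prod R d (fun=> bump_hat) (fun=> L1_bump_hat)).
by apply: prodr_gt0 => i _; exact: bump_hat_mass_gt0.
Qed.

Section limit.
Variables (s : R) (hs : 0 < s < 1) (xi0 : E) (al : R) (x : E).

(** The part of the inverse transform near the frequency [e], in the rescaled variable
    [eta = N.+1 (xi - e)]; the sign [sg] is 1 for [e = xi0] and -1 for [e = - xi0]. *)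
Let G (N : nat) (e : E) (sg : R) (eta : E) : R :=
  symbol s (N.+1%:R^-1 *: eta + e) * (bump_hatn eta * cos (al + sg * dot x (N.+1%:R^-1 *: eta + e))).

Let G_bound N e sg eta : `|G N e sg eta| <= (2 + 2 * dot e e) * hat_weight eta.
Proof.
rewrite /G normrM ger0_norm ?symbol_ge0//.
have c01 : 0 <= (N.+1%:R^-1 : R) <= 1 by rewrite invr_ge0 ler0n/= invf_le1// ler1n.
have -> : hat_weight eta = (\prod_(i < d) (1 + eta ord0 i ^+ 2)) * `|bump_hatn eta|.
  by rewrite /hat_weight big_split/= /bump_hatn normr_prod.
rewrite mulrA ler_pM ?symbol_ge0//; first exact: symbol_bound.
by rewrite normrM -[leRHS]mulr1 ler_wpM2l// normr_cos_le1.
Qed.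

Let G_measurable N e sg : measurable_fun setT (G N e sg).
Proof.
apply: measurable_funM.
  exact: (measurableT_comp (@measurable_symbol R d s) (@measurable_rV_affine R d _ e)).
apply: measurable_funM; first exact: measurable_bump_hatn.
apply: (measurableT_comp (@measurable_cos R)).
apply: measurable_funD => //; apply: measurable_funM => //.
by apply: measurable_dot => //; exact: measurable_rV_affine.
Qed.

Let G_L1 N e sg : L1 mu (G N e sg).
Proof.
apply: (@L1_le _ _ _ mu _ (fun eta => (2 + 2 * dot e e) * hat_weight eta)).
- exact: G_measurable.
- by apply: L1Z; exact: L1_hat_weight.
- exact: G_bound.
Qed.

Let back N (e xi : E) : N.+1%:R^-1 *: (N.+1%:R *: xi + - (N.+1%:R *: e)) + e = xi.
Proof. by rewrite scalerDr scalerN !scalerA mulVf ?pnatr_eq0// !scale1r subrK. Qed.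

Let integrandE N xi : symbol s xi *
    (fcos (modulated N xi0 al) xi * cos (dot x xi) + fsin (modulated N xi0 al) xi * sin (dot x xi)) =
  N.+1%:R ^+ d * (2^-1 * (G N xi0 1 (N.+1%:R *: xi - N.+1%:R *: xi0) +
    G N (- xi0) (-1) (N.+1%:R *: xi - N.+1%:R *: (- xi0)))).
Proof.
rewrite modulated_fourier /G !back mul1r mulN1r scalerN opprK /symbol; ring.
Qed.

Let L1_shift N e sg : L1 mu (fun xi => G N e sg (N.+1%:R *: xi - N.+1%:R *: e)).
Proof. by apply: (@L1_rV_affine R d _ (- (N.+1%:R *: e)) _ _ (G_L1 N e sg)); rewrite ltr0n. Qed.

Lemma L1_modulated_symbol N : L1 mu (fun xi => symbol s xi *
  (fcos (modulated N xi0 al) xi * cos (dot x xi) + fsin (modulated N xi0 al) xi * sin (dot x xi))).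
Proof.
under eq_fun do rewrite integrandE.
by apply: L1Z; apply: L1Z; apply: L1D; exact: L1_shift.
Qed.

(** The Jacobian of the rescaling cancels the factor [N.+1 ^+ d], so that only the symbol and the
    phase still depend on [N]. *)
Let lapE N : frac_laplacian s (modulated N xi0 al) x = (2 * pi) ^- d *
  (2^-1 * (\int[mu]_eta G N xi0 1 eta + \int[mu]_eta G N (- xi0) (-1) eta)).
Proof.
have N0 : 0 < N.+1%:R :> R by [].
have Nn : N.+1%:R != 0 :> R by rewrite pnatr_eq0.
rewrite /frac_laplacian fourier_multiplier_real; last exact: L1_modulated.
congr (_ * _).
have E1 e sg : \int[mu]_eta G N e sg eta = N.+1%:R ^+ d *
    \int[mu]_xi G N e sg (N.+1%:R *: xi - N.+1%:R *: e).
  rewrite (@Rint_rV_affine R d _ (- (N.+1%:R *: e)) _ N0 (G_measurable N e sg)).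
  by rewrite mulrA -exprMn mulfV// expr1n mul1r.
rewrite !E1 -mulrDr -RintD// mulrCA -RintZ; last exact: L1D.
rewrite -RintZ; last by apply: L1Z; exact: L1D.
by apply: eq_Rintegral => xi _; exact: integrandE.
Qed.

Definition lap_bound : R := (2 * pi) ^- d * ((2 + 2 * dot xi0 xi0) * \int[mu]_eta hat_weight eta).

(** Uniform in [N] and in [x]: it allows dominated convergence against any integrable function of
    [x]. *)
Lemma frac_laplacian_modulated_bound N :
  `|frac_laplacian s (modulated N xi0 al) x| <= lap_bound.
Proof.
have pi0 : 0 <= (2 * pi) ^- d :> R by rewrite invr_ge0 exprn_ge0// mulr_ge0// pi_ge0.
rewrite lapE normrM ger0_norm// /lap_bound ler_wpM2l//.
have H e sg : `|\int[mu]_eta G N e sg eta| <= (2 + 2 * dot e e) * \int[mu]_eta hat_weight eta.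
  rewrite (le_trans (Rint_norm (G_L1 N e sg)))// -RintZ; last exact: L1_hat_weight.
  apply: Rint_le; [exact: L1_abs|by apply: L1Z; exact: L1_hat_weight|].
  exact: G_bound.
have := H xi0 1; have := H (- xi0) (-1); rewrite dotNl dotNr opprK => H1 H2.
rewrite normrM ger0_norm ?invr_ge0//.
have := ler_normD (\int[mu]_eta G N xi0 1 eta) (\int[mu]_eta G N (- xi0) (-1) eta).
by lra.
Qed.

(** As the spectrum concentrates at [xi0] and [- xi0], where the even symbol takes the same value,
    the wave becomes an eigenfunction in the limit. *)
Lemma cvg_frac_laplacian_modulated :
  frac_laplacian s (modulated N xi0 al) x @[N --> \oo] -->
  (2 * pi) ^- d * (\int[mu]_eta bump_hatn eta) * symbol s xi0 * cos (dot x xi0 + al).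
Proof.
under eq_fun do rewrite lapE.
have c0 : (N.+1%:R^-1 : R) @[N --> \oo] --> (0 : R) by exact: cvg_harmonic.
have H e sg : \int[mu]_eta G N e sg eta @[N --> \oo] -->
    \int[mu]_eta ((symbol s e * cos (al + sg * dot x e)) * bump_hatn eta).
  have [|||||_] := @dominated_Rint _ _ _ mu (fun N => G N e sg)
    (fun eta => (symbol s e * cos (al + sg * dot x e)) * bump_hatn eta)
    (fun eta => (2 + 2 * dot e e) * hat_weight eta) => //.
  - by apply: measurable_funM => //; exact: measurable_bump_hatn.
  - move=> eta; rewrite /G.
    rewrite (_ : _ * _ * bump_hatn eta = symbol s e * (bump_hatn eta * cos (al + sg * dot x e))); last by ring.
    apply: cvgM; first by apply: cvg_symbol; case/andP: hs.
    apply: cvgM; first exact: cvg_cst.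
    have ca : al + sg * dot x (N.+1%:R^-1 *: eta + e) @[N --> \oo] --> al + sg * dot x e.
      apply: cvgD; first exact: cvg_cst.
      apply: cvgM; first exact: cvg_cst.
      under eq_fun do rewrite dotDr dotZr.
      have h : (N.+1%:R^-1 * dot x eta + dot x e) @[N --> \oo] --> 0 * dot x eta + dot x e.
        by apply: cvgD; [apply: cvgM; [exact: c0|exact: cvg_cst]|exact: cvg_cst].
      by rewrite mul0r add0r in h.
    exact: (cvg_comp _ _ ca (@continuous_cos R _)).
  - by apply: L1Z; exact: L1_hat_weight.
have -> : (2 * pi) ^- d * (\int[mu]_eta bump_hatn eta) * symbol s xi0 * cos (dot x xi0 + al) =
  (2 * pi) ^- d * (2^-1 *
    (\int[mu]_eta ((symbol s xi0 * cos (al + 1 * dot x xi0)) * bump_hatn eta)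
   + \int[mu]_eta ((symbol s (- xi0) * cos (al + (-1) * dot x (- xi0))) * bump_hatn eta))).
  rewrite !(RintZ _ L1_bump_hatn) symbolN dotNr mulrNN !mul1r (addrC al).
  move: (\int[mu]_x0 _) ((2 * pi) ^- d) (symbol _ _) (cos _) => I c p q; by field.
apply: cvgM; first exact: cvg_cst.
apply: cvgM; first exact: cvg_cst.
by apply: cvgD; exact: H.
Qed.

End limit.

End modulated_bump.

(** * Oscillating test functions *)

Section directional.
Context {R : realType} {V : normedModType R}.

Lemma linear_derive (l : V -> R) : linear l -> continuous l ->
  forall v z, differentiable l z /\ 'D_v l z = l v.
Proof.
move=> ll cl v z.
pose lM := GRing.isLinear.Build _ _ _ _ l ll.
pose L : {linear V -> R} := HB.pack l lM.
have dL : differentiable l z by exact: (@linear_differentiable _ _ _ L z cl).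
split => //; rewrite (deriveE _ dL).
by have -> := @diff_lin _ _ _ L z cl.
Qed.

Lemma tame_linear h (l : V -> R) : smooth1 h -> linear l -> continuous l ->
  tame (fun z => h (l z)).
Proof.
move=> sh ll cl; apply: tame_comp => //.
- by move=> z; have [] := linear_derive ll cl 0 z.
- by move=> v; exists (l v) => z; have [] := linear_derive ll cl v z.
Qed.

Lemma derive_linear_comp h (l : V -> R) v z : smooth1 h -> linear l -> continuous l ->
  'D_v (fun z => h (l z)) z = l v * derive1 h (l z).
Proof.
move=> sh ll cl; have [dl Dl] := linear_derive ll cl v z.
by have [_ ->] := derive_comp1 v (@smooth1_derivable _ _ sh (l z)) dl; rewrite Dl.
Qed.

Lemma derive_const_dir (f : V -> R) v z : (forall h, f (h *: v + z) = f z) -> 'D_v f z = 0.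
Proof.
move=> H; rewrite /derive (_ : (fun h => _) = fun=> 0); first exact: lim_cst.
by apply/funext => h /=; rewrite H subrr scaler0.
Qed.

End directional.

Section test_function.
Context {R : realType} {d : nat}.
Local Notation E := 'rV[R]_d.
Local Notation RE := (R * E)%type.

Definition wave_test (th : R -> R) (N : nat) (xi : E) (al : R) (z : RE) : R :=
  th z.1 * modulated N xi al z.2.

Let lin_fst : linear (fun z : RE => z.1). Proof. by []. Qed.
Let cont_fst : continuous (fun z : RE => z.1). Proof. by move=> z; exact: cvg_fst. Qed.
Let cont_snd : continuous (fun z : RE => z.2). Proof. by move=> z; exact: cvg_snd. Qed.
Let lin_coord i : linear (fun z : RE => z.2 ord0 i).
Proof. by move=> a u v; rewrite !mxE. Qed.
Let cont_coord i : continuous (fun z : RE => z.2 ord0 i).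
Proof.
move=> z; apply: (@continuous_comp _ _ _ (fun z : RE => z.2) (fun v : E => v ord0 i)).
  exact: cont_snd.
exact: coord_continuous.
Qed.
Let lin_dot xi : linear (fun z : RE => dot z.2 xi).
Proof. by move=> a u v; rewrite dotDl dotZl. Qed.
Let cont_dot xi : continuous (fun z : RE => dot z.2 xi).
Proof.
suff H r : continuous (fun z : RE => \sum_(i <- r) (z.2 ord0 i * xi ord0 i)) by exact: H.
elim: r => [|i r IH] z.
  by under eq_fun do rewrite big_nil; exact: cvg_cst.
under eq_fun do rewrite big_cons.
by apply: cvgD; [apply: cvgM; [exact: cont_coord|exact: cvg_cst]|exact: IH].
Qed.

Let smooth_scaled (N : nat) : smooth1 (fun y : R => bump (N.+1%:R^-1 * y)).
Proof.
apply: tame_smooth1.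
by have := tame_affine N.+1%:R^-1 0 (@smooth1_bump R); under eq_fun do rewrite addr0.
Qed.

Let derive1_scaled (N : nat) (y : R) :
  derive1 (fun y : R => bump (N.+1%:R^-1 * y)) y = N.+1%:R^-1 * derive1 bump (N.+1%:R^-1 * y).
Proof.
rewrite derive1E (@derive_linear_comp R R bump (fun y => N.+1%:R^-1 * y)) ?mulr1//.
- exact: smooth1_bump.
- by move=> a u v; rewrite /GRing.scale/=; ring.
- by move=> u; apply: cvgM; [exact: cvg_cst|exact: cvg_id].
Qed.

Let smooth_cos (al : R) : smooth1 (fun y : R => cos (y + al)).
Proof.
apply: tame_smooth1.
by have := tame_affine 1 al (@smooth1_cos R); under eq_fun do rewrite mul1r.
Qed.

Let derive1_cos (al y : R) : derive1 (fun y : R => cos (y + al)) y = - sin (y + al).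
Proof.
have H : is_derive y 1 (fun y : R => cos (y + al)) (- sin (y + al)).
  by apply: is_derive_eq; rewrite /GRing.scale/=; ring.
by rewrite derive1E; have [_ ->] := H.
Qed.

Let tame_factor N i : tame (fun z : RE => bump (N.+1%:R^-1 * z.2 ord0 i)).
Proof.
exact: (@tame_linear R RE (fun y => bump (N.+1%:R^-1 * y)) (fun z => z.2 ord0 i)).
Qed.

Let tame_cos xi al : tame (fun z : RE => cos (dot z.2 xi + al)).
Proof. exact: (@tame_linear R RE (fun y => cos (y + al)) (fun z => dot z.2 xi)). Qed.

Let tame_modulated N xi al : tame (fun z : RE => modulated N xi al z.2).
Proof.
apply: tame_mul; last exact: tame_cos.
by apply: tame_prod => i; exact: tame_factor.
Qed.

Let tame_time th : smooth1 th -> tame (fun z : RE => th z.1).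
Proof. by move=> sth; exact: tame_linear. Qed.

(** [a] may be negative, so [th] may be nonzero at time 0: this is how the zero initial value is
    tested. *)
Lemma cauchy_wave_test (T a b : R) th N xi al : smooth1 th -> b < T ->
  (forall t, th t != 0 -> a <= t <= b) -> cauchy_test T (wave_test th N xi al).
Proof.
move=> sth bT th0.
pose K : set RE := `[a, b] `*` [set v : E | forall i : 'I_d, `[- N.+1%:R, N.+1%:R]%classic (v ord0 i)].
have cK : compact K.
  apply: compact_setX; first exact: segment_compact.
  by apply: (@rV_compact R d (fun=> `[- N.+1%:R, N.+1%:R]%classic)) => i; exact: segment_compact.
have clK : closed K by apply: compact_closed => //; exact: norm_hausdorff.
have sK : closure [set z | wave_test th N xi al z != 0] `<=` K.
  rewrite [X in _ `<=` X](proj1 (closure_id K) clK); apply: closureS => z /=.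
  rewrite /wave_test mulf_eq0 negb_or => /andP[t0].
  rewrite /modulated mulf_eq0 negb_or => /andP[c0 _]; split => /=.
    by rewrite in_itv/=; exact: th0.
  move=> i /=; rewrite in_itv/= -ler_norml leNgt; apply: contra c0 => H.
  rewrite /cutoff (bigD1 i)//= bump_supp ?mul0r// normrM ger0_norm ?invr_ge0//.
  by rewrite ler_pdivlMl// mulr1 ltW.
split.
- by apply: tame_smooth; apply: tame_mul; [exact: tame_time|exact: tame_modulated].
- by apply: (subclosed_compact _ cK) => //; exact: closed_closure.
- move=> z /sK[/=]; rewrite in_itv/= => /andP[_ tb] _; exact: le_lt_trans bT.
Qed.

Lemma time_derive_wave_test th N xi al z : smooth1 th ->
  time_derive (wave_test th N xi al) z = derive1 th z.1 * modulated N xi al z.2.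
Proof.
move=> sth; rewrite /time_derive /wave_test.
rewrite (@deriveM _ _ (fun z => th z.1) (fun z => modulated N xi al z.2)); last 2 first.
- by apply: diff_derivable; apply: tame_differentiable; exact: tame_time.
- by apply: diff_derivable; apply: tame_differentiable; exact: tame_modulated.
rewrite (@derive_linear_comp R RE th (fun z => z.1))//= mul1r.
rewrite (@derive_const_dir R RE (fun z => modulated N xi al z.2)).
  by rewrite scaler0 add0r /GRing.scale/= mulrC.
by move=> h /=; rewrite scaler0 add0r.
Qed.

(** The [i]-th partial derivative of [cutoff N]; its factor [N.+1^-1] makes it disappear in the
    limit. *)
Definition cutoff_deriv (N : nat) (i : 'I_d) (x : E) : R :=
  N.+1%:R^-1 * (derive1 bump (N.+1%:R^-1 * x ord0 i) *
    \prod_(j < d | j != i) bump (N.+1%:R^-1 * x ord0 j)).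

Lemma space_grad_wave_test th N xi al z i : smooth1 th ->
  space_grad (wave_test th N xi al) z ord0 i =
  th z.1 * (cutoff_deriv N i z.2 * cos (dot z.2 xi + al)
    - cutoff N z.2 * (xi ord0 i * sin (dot z.2 xi + al))).
Proof.
move=> sth; rewrite /space_grad mxE /wave_test.
rewrite (@deriveM _ _ (fun z => th z.1) (fun z => modulated N xi al z.2)); last 2 first.
- by apply: diff_derivable; apply: tame_differentiable; exact: tame_time.
- by apply: diff_derivable; apply: tame_differentiable; exact: tame_modulated.
rewrite (@derive_linear_comp R RE th (fun z => z.1))//= mul0r scaler0 addr0.
rewrite /GRing.scale/=; congr (_ * _).
rewrite /modulated.
have tc : tame (fun z : RE => cutoff N z.2) by apply: tame_prod => j; exact: tame_factor.
rewrite (@deriveM _ _ (fun z => cutoff N z.2) (fun z => cos (dot z.2 xi + al))); last 2 first.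
- by apply: diff_derivable; exact: tame_differentiable.
- by apply: diff_derivable; apply: tame_differentiable; exact: tame_cos.
rewrite (@derive_linear_comp R RE (fun y => cos (y + al)) (fun z => dot z.2 xi))//=.
rewrite derive1_cos.
have -> : dot (delta_mx ord0 i) xi = xi ord0 i.
  rewrite /dot (bigD1 i)//= big1 ?addr0; last by move=> j ji; rewrite mxE eqxx (negbTE ji) mul0r.
  by rewrite mxE !eqxx mul1r.
have tp : tame (fun z : RE => \prod_(j < d | j != i) bump (N.+1%:R^-1 * z.2 ord0 j)).
  rewrite (_ : (fun _ => _) = fun z : RE =>
      \prod_(j < d) if j != i then bump (N.+1%:R^-1 * z.2 ord0 j) else 1).
    2: by apply/funext => y; rewrite big_mkcond.
  by apply: tame_prod => j; case: (j != i); [exact: tame_factor|exact: tame_cst].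
have -> : 'D_(0, delta_mx ord0 i) (fun z : RE => cutoff N z.2) z = cutoff_deriv N i z.2.
  rewrite (_ : (fun z : RE => cutoff N z.2) = fun z => bump (N.+1%:R^-1 * z.2 ord0 i) *
    \prod_(j < d | j != i) bump (N.+1%:R^-1 * z.2 ord0 j)); last first.
    by apply/funext => y; rewrite /cutoff (bigD1 i).
  rewrite (@deriveM _ _ (fun z : RE => bump (N.+1%:R^-1 * z.2 ord0 i))
    (fun z : RE => \prod_(j < d | j != i) bump (N.+1%:R^-1 * z.2 ord0 j))); last 2 first.
  - by apply: diff_derivable; apply: tame_differentiable; exact: tame_factor.
  - by apply: diff_derivable; exact: tame_differentiable.
  rewrite (@derive_linear_comp R RE (fun y => bump (N.+1%:R^-1 * y)) (fun z : RE => z.2 ord0 i))//=.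
  have -> : (delta_mx ord0 i : E) ord0 i = 1 by rewrite mxE !eqxx.
  rewrite derive1_scaled mul1r.
  rewrite (@derive_const_dir R RE (fun z => \prod_(j < d | j != i) _)).
    by rewrite scaler0 add0r /GRing.scale/= /cutoff_deriv; ring.
  move=> h; apply: eq_bigr => j ji; congr (bump (_ * _)).
  by rewrite !mxE eqxx (negbTE ji) mulr0 add0r.
by rewrite /GRing.scale/=; ring.
Qed.

Lemma derive1_bump_bounded : exists2 C : R, 0 <= C & forall y : R, `|derive1 bump y| <= C.
Proof.
have cb : continuous (derive1 (@bump R)).
  by apply: smooth1_continuous; apply: smooth1_derive1; exact: smooth1_bump.
have [M [_ HM]] : bounded_set ((derive1 (@bump R)) @` `[-1, 1]%classic).
  apply: compact_bounded; apply: continuous_compact; last exact: segment_compact.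
  exact: continuous_subspaceT.
exists (`|M| + 1); first by rewrite addr_ge0.
move=> y; have [y1|y1] := ltP 1 `|y|.
  rewrite (@supp1_derive1 R bump) ?normr0 ?addr_ge0// => x x1.
  by apply: bump_supp; exact: ltW.
apply: (HM (`|M| + 1)); first by rewrite (le_lt_trans (ler_norm M))// ltrDl.
by exists y => //=; rewrite in_itv/= -ler_norml.
Qed.

Lemma cutoff_deriv_bound : exists2 C : R, 0 <= C &
  forall N i x, `|cutoff_deriv N i x| <= N.+1%:R^-1 * C.
Proof.
have [C C0 HC] := derive1_bump_bounded; exists C => // N i x.
rewrite /cutoff_deriv normrM ger0_norm ?invr_ge0// ler_wpM2l ?invr_ge0//.
rewrite normrM -[leRHS]mulr1 ler_pM//.
rewrite ger0_norm; last by apply: prodr_ge0 => j _; exact: bump_ge0.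
by apply: prodr_ile1 => j _; rewrite bump_ge0 bump_le1.
Qed.

Lemma frac_laplacian_wave_test (s : R) th N xi al (t : R) x : 0 < s < 1 ->
  frac_laplacian s (fun y => wave_test th N xi al (t, y)) x =
  th t * frac_laplacian s (modulated N xi al) x.
Proof.
move=> hs; pose f := modulated N xi al; have fi : L1 (lebesgue_rV d) f by exact: L1_modulated.
rewrite (_ : (fun y => _) = fun y => th t * f y); last first.
  by apply/funext => y.
have fi' : L1 (lebesgue_rV d) (fun y => th t * f y) by exact: L1Z.
rewrite /frac_laplacian (fourier_multiplier_real _ _ fi) (fourier_multiplier_real _ _ fi').
have fs := @L1_modulated_symbol R d s hs xi al x N.
rewrite mulrCA -(RintZ (th t) fs).
congr (_ * _); apply: eq_Rintegral => eta _.
rewrite (fcosZ _ _ fi) (fsinZ _ _ fi) /symbol -/f; move: (fcos f eta) (fsin f eta) => p q.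
ring.
Qed.

End test_function.

Lemma continuous_bounded_itv (R : realType) (h : R -> R) (a b : R) : continuous h ->
  exists2 C : R, 0 <= C & forall t, a <= t <= b -> `|h t| <= C.
Proof.
move=> ch.
have [M [_ HM]] : bounded_set (h @` `[a, b]%classic).
  apply: compact_bounded; apply: continuous_compact; last exact: segment_compact.
  exact: continuous_subspaceT.
exists (`|M| + 1); first by rewrite addr_ge0.
move=> t tab; apply: (HM (`|M| + 1)); first by rewrite (le_lt_trans (ler_norm M))// ltrDl.
by exists t => //=; rewrite in_itv.
Qed.

(** * The weak formulation tested with uncut waves *)

Section weak_wave.
Context {R : realType} {d : nat}.
Local Notation E := 'rV[R]_d.
Local Notation mu := (@lebesgue_rV R d).
Local Notation leb := (@lebesgue_measure R).
Local Notation Q := (@lebesgue_measure R \x @lebesgue_rV R d)%E.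
Variables (s T L : R) (z w : R -> E -> R) (g : 'I_d -> R -> E -> R).

(* The equation solved by z = y1 - y2, with w = beta y1 - beta y2 and
   g = D (b y1 y1 - b y2 y2); the initial measure has cancelled. *)
Definition linear_integrand (phi : R * E -> R) (p : R * E) : R :=
  z p.1 p.2 * time_derive phi p
  - w p.1 p.2 * frac_laplacian s (fun x => phi (p.1, x)) p.2
  + \sum_(i < d) g i p.1 p.2 * space_grad phi p ord0 i.

Definition linear_solution := forall phi, cauchy_test T phi ->
  L1 Q (linear_integrand phi) /\ \int[Q]_p linear_integrand phi p = 0.

Hypothesis hs : 0 < s < 1.
Hypothesis mz : measurable_fun setT (fun p : measurableTypeR R * E => z p.1 p.2).
Hypothesis mw : measurable_fun setT (fun p : measurableTypeR R * E => w p.1 p.2).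
Hypothesis mg : forall i, measurable_fun setT (fun p : measurableTypeR R * E => g i p.1 p.2).
Hypothesis z0 : forall t x, ~~ (0 < t < T) -> z t x = 0.
Hypothesis wL : forall t x, `|w t x| <= L * `|z t x|.
Hypothesis gL : forall i t x, `|g i t x| <= L * `|z t x|.
Hypothesis zi : L1 Q (fun p => z p.1 p.2).
Hypothesis weak : linear_solution.

(** The limit of the unnormalized cutoffs; [lap_mass] is the constant that their fractional
    Laplacians produce in the same limit. *)
Definition bump_top : R := bump 0 ^+ d.
Definition lap_mass : R := (2 * pi) ^- d * \int[mu]_eta bump_hatn eta.

Definition wave_limit (th : R -> R) (xi : E) (al : R) (p : R * E) : R :=
  z p.1 p.2 * (derive1 th p.1 * (bump_top * cos (dot p.2 xi + al)))
  - w p.1 p.2 * (th p.1 * (lap_mass * symbol s xi * cos (dot p.2 xi + al)))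
  + \sum_(i < d) g i p.1 p.2 * (th p.1 * (- (bump_top * (xi ord0 i * sin (dot p.2 xi + al))))).

(** Dominated convergence with majorant [K * |z|]. The three terms of [K] bound the time derivative,
    the fractional Laplacian and the gradient of the test functions, for [0 <= t <= T] only, since
    [z] vanishes at other times. *)
Lemma weak_wave_limit (th : R -> R) (a b al : R) (xi : E) : smooth1 th -> b < T ->
  (forall t, th t != 0 -> a <= t <= b) ->
  L1 Q (wave_limit th xi al) /\
  \int[Q]_p wave_limit th xi al p = 0.
Proof.
move=> sth bT thab.
have test N := cauchy_wave_test N xi al sth bT thab.
have [C1 C10 H1] := continuous_bounded_itv 0 T (smooth1_continuous (smooth1_derive1 sth)).
have [C2 C20 H2] := continuous_bounded_itv 0 T (smooth1_continuous sth).
have [C3 C30 H3] := @cutoff_deriv_bound R d.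
have cosc (x : E) : `|cos (dot x xi + al)| <= 1 by exact: normr_cos_le1.
have sinc (x : E) : `|sin (dot x xi + al)| <= 1 by exact: normr_sin_le1.
pose f_ N := linear_integrand (wave_test th N xi al).
have fE N p : f_ N p = z p.1 p.2 * (derive1 th p.1 * modulated N xi al p.2)
    - w p.1 p.2 * (th p.1 * frac_laplacian s (modulated N xi al) p.2)
    + \sum_(i < d) g i p.1 p.2 * (th p.1 * (cutoff_deriv N i p.2 * cos (dot p.2 xi + al)
       - cutoff N p.2 * (xi ord0 i * sin (dot p.2 xi + al)))).
  case: p => t x; rewrite /f_ /linear_integrand time_derive_wave_test//=.
  rewrite frac_laplacian_wave_test//; congr (_ + _).
  by apply: eq_bigr => i _; rewrite space_grad_wave_test.
pose K := C1 + L * (C2 * lap_bound xi) + \sum_(i < d) L * (C2 * (C3 + `|xi ord0 i|)).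
have bnd N p : `|f_ N p| <= K * `|z p.1 p.2|.
  rewrite fE; case: p => t x /=.
  have [tT|tT] := boolP (0 < t < T); last first.
    have zt0 := z0 x tT.
    have wt0 : w t x = 0 by apply/eqP; rewrite -normr_le0 (le_trans (wL t x))// zt0 normr0 mulr0.
    have gt0 i : g i t x = 0 by apply/eqP; rewrite -normr_le0 (le_trans (gL i t x))// zt0 normr0 mulr0.
    rewrite zt0 wt0 big1; last by move=> i _; rewrite gt0 mul0r.
    by rewrite !mul0r subr0 addr0 normr0 mulr0.
  have tT' : 0 <= t <= T by move: tT => /andP[t0 t1]; rewrite !ltW.
  have Z0 : 0 <= `|z t x| by [].
  rewrite /K !mulrDl.
  apply: (le_trans (ler_normD _ _)); apply: lerD.
    apply: (le_trans (ler_normB _ _)); apply: lerD.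
      rewrite normrM mulrC ler_wpM2r// normrM -[leRHS]mulr1 ler_pM ?H1//.
      rewrite /modulated normrM -[leRHS]mulr1 ler_pM// ger0_norm ?cutoff_ge0//.
      exact: cutoff_le1.
    rewrite [leRHS]mulrAC normrM ler_pM// normrM ler_pM ?H2//.
    exact: frac_laplacian_modulated_bound.
  apply: (le_trans (ler_norm_sum _ _ _)); rewrite mulr_suml; apply: ler_sum => i _.
  rewrite [leRHS]mulrAC normrM ler_pM// normrM ler_pM ?H2//.
  apply: (le_trans (ler_normB _ _)); apply: lerD.
    rewrite normrM -[leRHS]mulr1 ler_pM//.
    apply: (le_trans (H3 _ _ _)); rewrite -[leRHS]mul1r ler_wpM2r//.
    by rewrite invf_le1// ler1n.
  rewrite normrM -[leRHS]mul1r ler_pM//.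
    by rewrite ger0_norm ?cutoff_ge0// cutoff_le1.
  by rewrite normrM -[leRHS]mulr1 ler_pM.
have [|||||iL] := @dominated_Rint _ _ _ Q f_ (wave_limit th xi al) (fun p => K * `|z p.1 p.2|).
- by move=> N; have [] := weak (test N) => /L1_measurable.
- have mth h : continuous h -> measurable_fun setT (fun p : measurableTypeR R * E => h p.1 : R).
    by move=> ch; apply: measurableT_comp => //; exact: continuous_measurable_fun.
  have md : measurable_fun setT (fun p : measurableTypeR R * E => dot p.2 xi + al).
    apply: measurable_funD => //.
    exact: (measurableT_comp (measurable_dotl xi) measurable_snd).
  have mc : measurable_fun setT (fun p : measurableTypeR R * E => cos (dot p.2 xi + al)).
    exact: (measurableT_comp (@measurable_cos R) md).
  have ms : measurable_fun setT (fun p : measurableTypeR R * E => sin (dot p.2 xi + al)).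
    exact: (measurableT_comp (@measurable_sin R) md).
  have m0 := mth _ (smooth1_continuous sth).
  have m1 := mth _ (smooth1_continuous (smooth1_derive1 sth)).
  apply: measurable_funD.
    apply: measurable_funB; apply: measurable_funM => //; apply: measurable_funM => //.
      exact: measurable_funM.
    exact: measurable_funM.
  apply: measurable_sum => i; apply: measurable_funM => //; apply: measurable_funM => //.
  apply: measurableT_comp => //; apply: measurable_funM => //; exact: measurable_funM.
- move=> [t x]; under eq_fun do rewrite fE; rewrite /wave_limit/=.
  have cN : (N.+1%:R^-1 : R) @[N --> \oo] --> (0 : R) by exact: cvg_harmonic.
  apply: cvgD.
    apply: cvgB; apply: cvgM; [exact: cvg_cst| |exact: cvg_cst|]; apply: cvgM; first exact: cvg_cst.
    + by apply: cvgM; [exact: cvg_cutoff|exact: cvg_cst].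
    + exact: cvg_cst.
    + exact: cvg_frac_laplacian_modulated.
  elim: (index_enum _) => [|i r IH].
    by rewrite big_nil; under eq_fun do rewrite big_nil; exact: cvg_cst.
  rewrite big_cons; under eq_fun do rewrite big_cons.
  apply: cvgD => //; apply: cvgM; first exact: cvg_cst.
  apply: cvgM; first exact: cvg_cst.
  rewrite -[X in _ --> X]add0r; apply: cvgD.
    rewrite -(mul0r (cos (dot x xi + al))); apply: cvgM; last exact: cvg_cst.
    apply: (@squeeze_cvgr _ _ _ _ (fun N => - (N.+1%:R^-1 * C3)) (fun N => N.+1%:R^-1 * C3)).
    + by apply: nearW => N; rewrite -ler_norml.
    + rewrite -oppr0 -(mul0r C3); apply: cvgN; apply: cvgM => //; exact: cvg_cst.
    + rewrite -(mul0r C3); apply: cvgM => //; exact: cvg_cst.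
  by apply: cvgN; apply: cvgM; [exact: cvg_cutoff|exact: cvg_cst].
- by apply: L1Z; exact: L1_abs.
- exact: bnd.
move=> b0; split; first exact: iL.
rewrite (_ : (fun N => _) = fun=> 0) in b0; last first.
  by apply/funext => N; have [] := weak (test N).
by move: b0 => /(cvg_lim (@Rhausdorff R)) <-; rewrite lim_cst//; exact: Rhausdorff.
Qed.

End weak_wave.

(** * The equation of a Fourier coefficient *)

Section lebesgue_point_kernel.
Context {R : realType}.
Local Notation leb := (@lebesgue_measure R).

(** Supported in [[x - 2 / N.+1, x]], thus never after [x]: for [x < T] the test functions built
    from it stay admissible. *)
Definition back_bump (N : nat) (x t : R) : R := bump (N.+1%:R * t + (1 - N.+1%:R * x)).

Lemma L1_back_bump N x : L1 leb (back_bump N x).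
Proof. by apply: L1_affine; [rewrite ltr0n|exact: L1_bump]. Qed.

Lemma Rint_back_bump N x : \int[leb]_t back_bump N x t = N.+1%:R^-1 * step_height.
Proof. by apply: Rint_affine; [rewrite ltr0n|exact: measurable_bump]. Qed.

Lemma measurable_back_bump N x : measurable_fun setT (back_bump N x).
Proof. exact: L1_measurable (L1_back_bump N x). Qed.

Lemma back_bump_bound (N : nat) (x t : R) : `|back_bump N x t| <= 1.
Proof. by rewrite ger0_norm ?bump_ge0// bump_le1. Qed.

Lemma back_bump_supp N x t : 2 / N.+1%:R <= `|x - t| -> back_bump N x t = 0.
Proof.
have N0 : 0 < N.+1%:R :> R by [].
rewrite ler_pdivrMr// => H; apply: bump_supp.
rewrite (_ : N.+1%:R * t + _ = 1 - (x - t) * N.+1%:R); last by ring.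
move: H; rewrite -{1}(ger0_norm (ltW N0)) -normrM => H.
rewrite distrC; have := lerB_dist ((x - t) * N.+1%:R) 1.
by rewrite normr1 => /(le_trans _); apply; lra.
Qed.

(** [back_bump N x] is at most 1 and lives in the ball of radius [2 / N.+1], whose measure is
    [4 / N.+1]. After multiplication by [N.+1] the error is therefore at most 4 times the mean
    deviation [davg], which tends to 0 at a Lebesgue point. *)
Lemma lebesgue_pt_kernel (f : R -> R) (x : R) : L1 leb f -> lebesgue_pt f x ->
  N.+1%:R * \int[leb]_t (back_bump N x t * f t) @[N --> \oo] --> step_height * f x.
Proof.
move=> fi fx.
have mf := L1_measurable fi.
have mB N := measurable_back_bump N x.
have bfi N : L1 leb (fun t => back_bump N x t * f t).
  exact: (@L1_bounded_mul _ _ _ leb 1 f _ (mB N) (back_bump_bound N x) fi).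
have bci N : L1 leb (fun t => back_bump N x t * f x).
  by under eq_fun do rewrite mulrC; apply: L1Z; exact: L1_back_bump.
have key (N : nat) : (`|step_height * f x - N.+1%:R * \int[leb]_t (back_bump N x t * f t)|%:E <=
    4%:E * davg f x (2 / N.+1%:R))%E.
  have N0 : 0 < N.+1%:R :> R by [].
  have r0 : 0 < 2 / N.+1%:R :> R by rewrite divr_gt0.
  have -> : step_height * f x - N.+1%:R * \int[leb]_t (back_bump N x t * f t) =
      - (N.+1%:R * \int[leb]_t (back_bump N x t * (f t - f x))).
    under [in RHS]eq_Rintegral do rewrite mulrBr.
    rewrite RintB// mulrBr opprB; congr (_ - _).
    under eq_Rintegral do rewrite mulrC.
    rewrite RintZ; last exact: L1_back_bump.
    by rewrite Rint_back_bump; field; rewrite gt_eqF.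
  rewrite normrN normrM ger0_norm; last exact: ltW.
  have bdi : L1 leb (fun t => back_bump N x t * (f t - f x)).
    by under eq_fun do rewrite mulrBr; exact: L1B.
  have H := Rint_norm bdi.
  rewrite /davg /iavg lebesgue_measure_ball; last exact: ltW.
  have -> : ((2 / N.+1%:R *+ 2)%:E^-1 = (N.+1%:R / 4)%:E :> \bar R)%E.
    rewrite inver gt_eqF; last by rewrite mulrn_wgt0.
    by congr (_%:E); field; rewrite gt_eqF.
  rewrite muleA -EFinM (_ : 4 * (N.+1%:R / 4) = N.+1%:R :> R); last by field.
  rewrite EFinM lee_pmul2l ?lte_fin//.
  apply: (@le_trans _ _ (\int[leb]_t `|back_bump N x t * (f t - f x)|)%:E); first by rewrite lee_fin.
  rewrite EFin_Rint; last exact: L1_abs.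
  rewrite [leRHS]integral_mkcond/=; apply: ge0_le_integral => //.
  - by apply/measurable_EFinP; exact: L1_measurable (L1_abs bdi).
  - apply/(measurable_restrictT _ (measurable_ball _ _)).
    apply: measurable_funTS; apply/measurable_EFinP; apply: measurableT_comp => //.
    exact: measurable_funB.
  - move=> t _; rewrite patchE; case: ifPn => [|tb].
      by move=> _ /=; rewrite lee_fin normrM -[leRHS]mul1r ler_wpM2r// back_bump_bound.
    rewrite back_bump_supp ?mul0r ?normr0// leNgt; apply: contra tb => tb.
    by rewrite inE.
apply/cvgrPdist_le => e e0.
have c2 : 2 / N.+1%:R @[N --> \oo] --> (0 : R)^'+.
  have c0 : (2 * N.+1%:R^-1 : R) @[N --> \oo] --> (2 * 0 : R).
    by apply: cvgM; [exact: cvg_cst|exact: cvg_harmonic].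
  rewrite mulr0 in c0; move=> A /c0 HA.
  have HA' : \forall N \near \oo, 0 < 2 * N.+1%:R^-1 :> R -> A (2 * N.+1%:R^-1) by exact: HA.
  by apply: filterS HA' => N; apply; rewrite divr_gt0.
have := cvg_comp _ _ c2 fx; move=> /fine_cvgP[fin /cvgrPdist_le/(_ (e / 4))].
rewrite divr_gt0// => /(_ isT) H.
near=> N.
have k := key N.
have f1 : davg f x (2 / N.+1%:R) \is a fin_num by near: N; exact: fin.
have f2 : `|0 - fine (davg f x (2 / N.+1%:R))| <= e / 4 by near: N; exact: H.
move: k; rewrite -(fineK f1) -EFinM lee_fin => k.
move: f2; rewrite sub0r normrN => f2.
apply: (le_trans k); have := ler_norm (fine (davg f x (2 / N.+1%:R))); lra.
Unshelve. all: by end_near. Qed.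
End lebesgue_point_kernel.

Lemma measurable_natr_lt d (T : measurableType d) (R : realType) (f g : T -> R) :
  measurable_fun setT f -> measurable_fun setT g ->
  measurable_fun setT (fun x => (f x < g x)%R%:R : R).
Proof.
move=> mf mg; rewrite (_ : (fun x => _) = fun x => if f x < g x then 1 else 0).
  by apply: measurable_fun_ifT => //; exact: measurable_fun_ltr.
by apply/funext => x; case: (f x < g x).
Qed.

Section du_bois_reymond.
Context {R : realType}.
Local Notation leb := (@lebesgue_measure R).

(** The weak form of [Z' = F] before [T]. For [Z] and [F] that vanish at times [t <= 0] it includes
    the zero initial value, as [th] need not vanish there. *)
Definition ode_solution (T : R) (Z F : R -> R) := forall th (a b : R), smooth1 th -> b < T ->
  (forall t, th t != 0 -> a <= t <= b) -> \int[leb]_t (derive1 th t * Z t + th t * F t) = 0.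

(** A smooth version of [step_height] times the indicator of [t < x], equal to 0 from [x] on, with
    derivative [- N.+1 * back_bump N x t]. *)
Let back_step (N : nat) (x t : R) : R := step (- N.+1%:R * t + (N.+1%:R * x - 1)).

(** The second factor makes the support compact: it is 0 for [t <= -4] and constant for [t >= -2],
    hence constant wherever [Z] or [F] can be nonzero. *)
Let back_cutoff (N : nat) (x t : R) : R := back_step N x t * step (1 * t + 3).

Let smooth1_back_step N x : smooth1 (back_step N x).
Proof. by apply: tame_smooth1; apply: tame_affine; exact: smooth1_step. Qed.

Let smooth1_back_cutoff N x : smooth1 (back_cutoff N x).
Proof.
apply: smooth1M; first exact: smooth1_back_step.
by apply: tame_smooth1; apply: tame_affine; exact: smooth1_step.
Qed.

Let derive1_back_cutoff N x (t : R) : derive1 (back_cutoff N x) t =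
  - N.+1%:R * back_bump N x t * step (1 * t + 3) + back_step N x t * bump (1 * t + 3).
Proof.
have Hs (c b y : R) : is_derive y 1 (fun y => step (c * y + b)) (c * bump (c * y + b)).
  have Ha : is_derive y 1 (fun y : R => c * y + b) c.
    by apply: is_derive_eq; rewrite /GRing.scale/=; ring.
  have [ds Ds] := step_derive (c * y + b).
  have Hs : is_derive (c * y + b) 1 step (bump (c * y + b)).
    by apply: DeriveDef; [exact: ds|rewrite -derive1E; exact: Ds].
  have := @is_derive1_comp _ step (fun y => c * y + b) y _ _ Hs Ha.
  by move=> H; apply: is_derive_eq; rewrite /GRing.scale/= mulrC.
have H1 := Hs (- N.+1%:R) (N.+1%:R * x - 1) t.
have H2 := Hs 1 3 t.
have H : is_derive t 1 (back_cutoff N x)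
    (- N.+1%:R * back_bump N x t * step (1 * t + 3) + back_step N x t * bump (1 * t + 3)).
  have Eb : back_bump N x t = bump (- N.+1%:R * t + (N.+1%:R * x - 1)).
    by rewrite /back_bump -bumpN; congr bump; ring.
  by apply: is_derive_eq; rewrite Eb /GRing.scale/= -/(back_step N x t); ring.
by rewrite derive1E; have [_ ->] := H.
Qed.

Let supp_back_cutoff N x t : back_cutoff N x t != 0 -> -4 <= t <= x.
Proof.
have N0 : 0 < N.+1%:R :> R by [].
move=> t0; apply/andP; split; rewrite leNgt; apply: contra t0 => tx; rewrite mulf_eq0; apply/orP.
  by right; apply/eqP; apply: step_le; lra.
left; apply/eqP; apply: step_le; have : 0 < N.+1%:R * (t - x) by rewrite mulr_gt0// subr_gt0.
lra.
Qed.

(** Tested with a smoothed indicator of [t < x], the equation equates an average of [Z] just before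
    [x] with an integral of [F]. At a Lebesgue point [x] of [Z] both sides converge. *)
Lemma ode_solution_ae (T : R) (Z F : R -> R) : L1 leb Z -> L1 leb F ->
  (forall t, ~~ (0 < t < T) -> Z t = 0) -> (forall t, ~~ (0 < t < T) -> F t = 0) ->
  ode_solution T Z F ->
  {ae leb, forall t, t < T -> Z t = \int[leb]_u ((u < t)%R%:R * F u)}.
Proof.
move=> Zi Fi Z0 F0 ode.
have : {ae leb, forall t, lebesgue_pt Z t}.
  by apply: lebesgue_differentiation; apply: open_integrable_locally => //; exact: openT.
move=> [A [mA A0 sA]]; exists A; split => // x /= nx; apply: sA => /= Zx; apply: nx => xT.
have s0 := @step_height_gt0 R.
have mbs N : measurable_fun setT (back_step N x).
  by apply: continuous_measurable_fun; apply: smooth1_continuous.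
have bs1 N (t : R) : `|back_step N x t| <= step_height.
  by rewrite ger0_norm ?step_ge0// step_le_height.
have bFi N : L1 leb (fun t => back_step N x t * F t).
  exact: (@L1_bounded_mul _ _ _ leb _ F _ (mbs N) (bs1 N) Fi).
have bZi N : L1 leb (fun t => back_bump N x t * Z t).
  exact: (@L1_bounded_mul _ _ _ leb 1 Z _ (measurable_back_bump N x) (back_bump_bound N x) Zi).
have E N : N.+1%:R * \int[leb]_t (back_bump N x t * Z t) = \int[leb]_t (back_step N x t * F t).
  have := ode _ _ _ (@smooth1_back_cutoff N x) xT (@supp_back_cutoff N x).
  rewrite (_ : \int[leb]_t _ = \int[leb]_t (step_height *
      (back_step N x t * F t - N.+1%:R * (back_bump N x t * Z t)))); last first.
    apply: eq_Rintegral => t _; rewrite derive1_back_cutoff /back_cutoff.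
    have [tT|tT] := boolP (0 < t < T); last by rewrite Z0// F0// !mulr0 subrr mulr0 addr0.
    case/andP: tT => t0 _; rewrite bump_supp; last by rewrite ger0_norm; lra.
    by rewrite step_ge; [ring|lra].
  have i2 : L1 leb (fun t => N.+1%:R * (back_bump N x t * Z t)) by exact: L1Z.
  rewrite RintZ; last exact: L1B.
  by rewrite RintB// RintZ// => /eqP; rewrite mulf_eq0 gt_eqF//= subr_eq0 => /eqP.
have c1 := lebesgue_pt_kernel Zi Zx.
have [|||||_ c2] := @dominated_Rint _ _ _ leb (fun N t => back_step N x t * F t)
  (fun t => step_height * ((t < x)%R%:R * F t)) (fun t => step_height * `|F t|).
- by move=> N; exact: L1_measurable (bFi N).
- apply: measurable_funM => //; apply: measurable_funM; last exact: L1_measurable Fi.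
  exact: measurable_natr_lt.
- move=> t; rewrite mulrA; apply: cvgM; last exact: cvg_cst.
  have [tx|tx] := ltP t x; last first.
    rewrite mulr0; under eq_fun => N.
      rewrite /back_step step_le; last first.
        have : 0 <= N.+1%:R * (t - x) by rewrite mulr_ge0// subr_ge0.
        lra.
      over.
    exact: cvg_cst.
  rewrite mulr1; apply: cvg_near_cst; near=> N; apply: step_ge.
  have : 2 <= N.+1%:R * (x - t).
    rewrite -ler_pdivrMr ?subr_gt0//; apply: (@le_trans _ _ N%:R); last by rewrite ler_nat.
    apply: ltW; near: N; exact: nbhs_infty_gtr.
  lra.
- by apply: L1Z; exact: L1_abs.
- by move=> N t; rewrite normrM ler_wpM2r.
have iI : L1 leb (fun t => (t < x)%R%:R * F t).
  apply: (@L1_bounded_mul _ _ _ leb 1 F (fun t => (t < x)%R%:R)) => //; first exact: measurable_natr_lt.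
  by move=> t; rewrite normr_nat lern1 leq_b1.
rewrite (RintZ _ iI) in c2.
have c3 : \int[leb]_t (back_step N x t * F t) @[N --> \oo] --> step_height * Z x.
  by under eq_fun do rewrite -E.
have e : step_height * Z x = step_height * \int[leb]_u ((u < x)%R%:R * F u).
  exact: (cvg_unique (@Rhausdorff R) c3 c2).
exact: (mulfI (lt0r_neq0 s0) e).
Unshelve. all: by end_near. Qed.

End du_bois_reymond.

(** * The energy estimate *)

Section ode_energy.
Context {R : realType}.
Local Notation leb := (@lebesgue_measure R).
Implicit Types F Z : R -> R.

Definition before (t u : R) : R := (u < t)%R%:R.

Lemma before_ge0 t u : 0 <= before t u. Proof. exact: ler0n. Qed.

Lemma before_le1 t u : before t u <= 1.
Proof. by rewrite /before lern1 leq_b1. Qed.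

Lemma normr_before_le1 t u : `|before t u| <= 1.
Proof. by rewrite normr_nat lern1 leq_b1. Qed.

Lemma measurable_before t : measurable_fun [set: R] (before t).
Proof. exact: measurable_natr_lt. Qed.

Lemma measurable_before2 :
  measurable_fun setT (fun p : measurableTypeR R * measurableTypeR R => before p.1 p.2).
Proof. by apply: measurable_natr_lt. Qed.

Lemma L1_before t F : L1 leb F -> L1 leb (fun u => before t u * F u).
Proof.
move=> Fi; apply: (@L1_bounded_mul _ _ _ leb 1 F (before t)) => //; first exact: measurable_before.
exact: normr_before_le1.
Qed.

Definition primitive F (t : R) : R := \int[leb]_u (before t u * F u).

Lemma measurable_primitive F : measurable_fun setT F -> measurable_fun setT (primitive F).
Proof.
move=> mF; apply: (@measurable_Rint2 _ _ _ _ R leb (fun t u => before t u * F u)).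
apply: measurable_funM; first exact: measurable_before2.
exact: (measurableT_comp mF measurable_snd).
Qed.

Lemma primitive_bound F t : L1 leb F -> `|primitive F t| <= \int[leb]_u `|F u|.
Proof.
move=> Fi; apply: (le_trans (Rint_norm (L1_before t Fi))).
apply: Rint_le; [exact: L1_abs (L1_before t Fi)|exact: L1_abs|].
by move=> u; rewrite normrM -[leRHS]mul1r ler_wpM2r// normr_before_le1.
Qed.

(** The square is a double integral of a symmetric kernel; the diagonal is null and the two
    triangles contribute equally. This replaces the chain rule, [F] being merely integrable. *)
Lemma primitive_sqr F t : L1 leb F ->
  primitive F t ^+ 2 = 2 * \int[leb]_s (before t s * F s * primitive F s).
Proof.
move=> Fi; have Fti := L1_before t Fi.
pose k s u := (before t s * F s) * (before t u * F u).
have kC s u : k s u = k u s by rewrite /k mulrC.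
have ki : L1 (leb \x leb)%E (fun p => k p.1 p.2).
  exact: (@L1_prod _ _ _ _ _ leb leb (fun s => before t s * F s) (fun u => before t u * F u)).
have bki : L1 (leb \x leb)%E (fun p => before p.1 p.2 * k p.1 p.2).
  apply: (@L1_bounded_mul _ _ _ (leb \x leb)%E 1) => //; first exact: measurable_before2.
  by move=> p; exact: normr_before_le1.
have bki' : L1 (leb \x leb)%E (fun p => before p.2 p.1 * k p.1 p.2).
  rewrite (_ : (fun p => _) = fun p => before p.2 p.1 * k p.2 p.1); last first.
    by apply/funext => p; rewrite kC.
  exact: (@L1_swap _ _ _ _ _ leb leb (fun s u => before s u * k s u) bki).
have E : primitive F t ^+ 2 = \int[leb]_s \int[leb]_u (before s u * k s u + before u s * k s u).
  rewrite expr2 {1}/primitive mulrC -RintZ//; apply: eq_Rintegral => s _.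
  rewrite mulrC /primitive -RintZ//.
  have mk : measurable_fun setT (k s) by apply: measurable_funM => //; exact: L1_measurable Fti.
  apply: Rint_ae_eq => //.
    apply: measurable_funD; apply: measurable_funM => //; first exact: measurable_before.
    by apply: measurable_natr_lt.
  exists [set s]; split; [exact: measurable_set1|exact: lebesgue_measure_set1|].
  move=> u /= H; apply: contra_notP H => us; rewrite -/(k s u) -mulrDl.
  suff -> : before s u + before u s = 1 by rewrite mul1r.
  by rewrite /before; case: (ltgtP u s) => [_|_|/us//]; rewrite ?addr0 ?add0r.
have Ek s : \int[leb]_u (before s u * k s u) = before t s * F s * primitive F s.
  rewrite /primitive -RintZ; last exact: L1_before.
  apply: eq_Rintegral => u _; rewrite /k /before.
  have [us|us] := ltP u s; last by rewrite !mul0r mulr0.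
  have [st|st] := ltP s t; last by rewrite !mul0r ?mulr0.
  by rewrite (lt_trans us st) !mul1r.
have S : \int[leb]_s \int[leb]_u (before u s * k s u) = \int[leb]_s \int[leb]_u (before s u * k s u).
  rewrite (@Rint_swap _ _ _ _ _ leb leb (fun s u => before u s * k s u) bki').
  by apply: eq_Rintegral => s _; apply: eq_Rintegral => u _; rewrite kC.
rewrite E; transitivity (\int[(leb \x leb)%E]_p (before p.1 p.2 * k p.1 p.2 + before p.2 p.1 * k p.1 p.2)).
  by rewrite (@Rfubini1 _ _ _ _ _ leb leb _ (L1D bki bki')).
rewrite (RintD bki bki') (@Rfubini1 _ _ _ _ _ leb leb _ bki) (@Rfubini1 _ _ _ _ _ leb leb _ bki')/= S.
rewrite -mulr2n mulr_natl.
by congr (_ *+ _); apply: eq_Rintegral => s _; exact: Ek.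
Qed.

Definition window (t1 t : R) : R := ((0 < t)%R && (t < t1)%R)%:R.

Lemma L1_window t1 : L1 leb (window t1).
Proof.
apply: (@L1_bounded_supp _ 0 t1 1).
- rewrite (_ : window t1 = fun t => before t 0 * before t1 t).
    by apply: measurable_funM; [exact: measurable_natr_lt|exact: measurable_before].
  by apply/funext => t; rewrite /window /before; case: (0 < t); case: (t < t1); rewrite ?mul1r ?mul0r.
- move=> t; rewrite in_itv/= /window; case: ltgtP => //= t0; case: ltgtP => //= t1'.
- by move=> t; rewrite normr_nat lern1 leq_b1.
Qed.

Lemma window_ge0 t1 t : 0 <= window t1 t. Proof. exact: ler0n. Qed.

(* Equal to [t1 - s] for 0 <= s <= t1; only Fubini is used, never this value. *)
Definition elapsed (t1 s : R) : R := \int[leb]_t (window t1 t * before t s).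

Lemma L1_window_before2 t1 F : L1 leb F ->
  L1 (leb \x leb)%E (fun p => window t1 p.1 * before p.1 p.2 * F p.2).
Proof.
move=> Fi; rewrite (_ : (fun p => _) = fun p => before p.1 p.2 * (window t1 p.1 * F p.2)); last first.
  by apply/funext => p; rewrite mulrCA mulrA.
apply: (@L1_bounded_mul _ _ _ (leb \x leb)%E 1 (fun p => window t1 p.1 * F p.2)).
- exact: measurable_before2.
- by move=> p; exact: normr_before_le1.
- exact: (@L1_prod _ _ _ _ _ leb leb (window t1) F (L1_window t1) Fi).
Qed.

Lemma Rint_window_primitive t1 F : L1 leb F ->
  L1 leb (fun s => elapsed t1 s * F s) /\
  \int[leb]_t (window t1 t * primitive F t) = \int[leb]_s (elapsed t1 s * F s).
Proof.
move=> Fi; have H := L1_window_before2 t1 Fi.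
have E s : \int[leb]_t (window t1 t * before t s * F s) = elapsed t1 s * F s.
  rewrite /elapsed [RHS]mulrC -RintZ; last first.
    rewrite /=; under eq_fun do rewrite mulrC.
    apply: (@L1_bounded_mul _ _ _ leb 1 (window t1)); last exact: L1_window.
    - by apply: measurable_natr_lt.
    - by move=> t; exact: normr_before_le1.
  by apply: eq_Rintegral => t _; rewrite mulrC.
split.
  have := @L1_fubini2 _ _ _ _ _ leb leb _ H.
  by under eq_fun do rewrite E.
transitivity (\int[leb]_t \int[leb]_s (window t1 t * before t s * F s)).
  apply: eq_Rintegral => t _; rewrite -RintZ; last exact: L1_before.
  by apply: eq_Rintegral => s _; rewrite mulrA.
rewrite (@Rint_swap _ _ _ _ _ leb leb (fun t s => window t1 t * before t s * F s) H).
by apply: eq_Rintegral => s _; exact: E.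
Qed.

Lemma elapsed_ge0 t1 s : 0 <= elapsed t1 s.
Proof. by apply: Rint_ge0 => t; rewrite mulr_ge0 ?window_ge0 ?before_ge0. Qed.

Lemma measurable_elapsed t1 : measurable_fun setT (elapsed t1).
Proof.
apply: (@measurable_Rint1 _ _ _ _ R leb (fun t s => window t1 t * before t s)).
apply: measurable_funM; last exact: measurable_before2.
exact: (measurableT_comp (L1_measurable (L1_window t1)) measurable_fst).
Qed.

Lemma elapsed_bound t1 s : `|elapsed t1 s| <= \int[leb]_t window t1 t.
Proof.
rewrite ger0_norm ?elapsed_ge0//; apply: Rint_le; last 2 first.
- exact: L1_window.
- by move=> t; rewrite -[leRHS]mulr1 ler_wpM2l ?window_ge0 ?before_le1.
under eq_fun do rewrite mulrC.
apply: (@L1_bounded_mul _ _ _ leb 1 (window t1)); last exact: L1_window.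
- by apply: measurable_natr_lt.
- by move=> t; exact: normr_before_le1.
Qed.

Lemma elapsed_eq0 t1 s : t1 <= s -> elapsed t1 s = 0.
Proof.
move=> ts; rewrite /elapsed -[RHS](Rint_cst0 leb); apply: eq_Rintegral => t _.
rewrite /window /before; case: (ltP t t1) => [tt|_]; last by rewrite andbF mul0r.
by rewrite (ltNge s t) (ltW (lt_le_trans tt ts))/= mulr0.
Qed.

(** The formula for [Z ^+ 2] holds at almost every time only, so it is integrated over []0, t1[];
    exchanging the two time integrals turns the primitive of [F * Z] into the weight
    [elapsed t1]. *)
Lemma ode_energy (T t1 : R) Z F : L1 leb Z -> L1 leb F ->
  (forall t, ~~ (0 < t < T) -> Z t = 0) -> (forall t, ~~ (0 < t < T) -> F t = 0) ->
  ode_solution T Z F -> t1 < T ->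
  [/\ L1 leb (fun s => elapsed t1 s * (F s * Z s)),
     L1 leb (fun t => window t1 t * Z t ^+ 2) &
     \int[leb]_t (window t1 t * Z t ^+ 2) = 2 * \int[leb]_s (elapsed t1 s * (F s * Z s))].
Proof.
move=> Zi Fi Z0 F0 ode t1T.
have [A [mA A0 sA]] := ode_solution_ae Zi Fi Z0 F0 ode.
have ZA t : ~ A t -> t < T -> Z t = primitive F t.
  by move=> At; apply: contrapT => H; apply: At; exact: sA.
have aeA (P : R -> Prop) : (forall t, ~ A t -> P t) -> {ae leb, forall t, P t}.
  by move=> H; exists A; split => // t /= Pt; apply: contrapT => At; apply: Pt; exact: H.
have mZ := L1_measurable Zi; have mF := L1_measurable Fi; have mI := measurable_primitive mF.
(* [primitive F] is a bounded version of [Z], defined at every time, which makes this product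
   integrable. *)
pose G s := primitive F s * F s.
have Gi : L1 leb G by apply: (@L1_bounded_mul _ _ _ leb _ F (primitive F) mI) => // t; exact: primitive_bound.
have mG := L1_measurable Gi; have mIG := measurable_primitive mG.
have mwin : measurable_fun setT (window t1) := L1_measurable (L1_window t1).
have wI2 : L1 leb (fun t => primitive G t * window t1 t).
  apply: (@L1_bounded_mul _ _ _ leb _ (window t1) (primitive G) mIG); last exact: L1_window.
  by move=> t; exact: primitive_bound.
have sqrE t : primitive F t ^+ 2 = 2 * primitive G t.
  rewrite primitive_sqr//; congr (_ * _); apply: eq_Rintegral => s _.
  by rewrite /G; ring.
have ae1 : {ae leb, forall t, 2 * (primitive G t * window t1 t) = window t1 t * Z t ^+ 2}.
  apply: aeA => t At; rewrite mulrA -sqrE mulrC /window; case: (ltP t t1) => tt.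
    by rewrite ZA// (lt_trans tt).
  by rewrite andbF !mul0r.
have [eGi eG] := Rint_window_primitive t1 Gi.
have mel := measurable_elapsed t1.
have ae2 : {ae leb, forall s, elapsed t1 s * G s = elapsed t1 s * (F s * Z s)}.
  apply: aeA => s As; case: (ltP s t1) => st; last by rewrite elapsed_eq0// !mul0r.
  by rewrite /G -ZA ?(lt_trans st)// (mulrC (Z s)).
have m1 : measurable_fun setT (fun t => window t1 t * Z t ^+ 2).
  by apply: measurable_funM => //; exact: measurable_funX.
have m2 : measurable_fun setT (fun s => elapsed t1 s * (F s * Z s)).
  by apply: measurable_funM => //; exact: measurable_funM.
split.
- exact: (@L1_ae_eq _ _ _ leb (fun s => elapsed t1 s * G s) _ m2 ae2 eGi).
- by apply: (@L1_ae_eq _ _ _ leb (fun t => 2 * (primitive G t * window t1 t)) _ m1 ae1); exact: L1Z.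
- rewrite -(@Rint_ae_eq _ _ _ leb (fun t => 2 * (primitive G t * window t1 t)) _ _ m1 ae1); last exact: L1_measurable (L1Z 2 wI2).
  rewrite RintZ// -(@Rint_ae_eq _ _ _ leb (fun s => elapsed t1 s * G s) _ _ m2 ae2); last exact: L1_measurable eGi.
  by rewrite -eG; congr (_ * _); apply: eq_Rintegral => t _; rewrite mulrC.
Qed.

End ode_energy.

(** * Gronwall's lemma in integrated form *)

Section gronwall.
Context {R : realType}.
Local Notation leb := (@lebesgue_measure R).

(** For the nondecreasing [J = primitive H] the hypothesis bounds [J t1] by [C] times its integral
    over []0, t1[]. If [J] vanishes up to [t1 - h], this is at most [C * h * J t1], and
    [h = (2 * C)^-1] gives [J t1 <= J t1 / 2]. Finitely many steps of length [h] reach any time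
    before [T]. *)
Lemma gronwall (T C : R) (H : R -> R) : 0 < C -> L1 leb H -> (forall t, 0 <= H t) ->
  (forall t, ~~ (0 < t < T) -> H t = 0) ->
  (forall t1, t1 < T -> \int[leb]_t (window t1 t * H t) <=
     C * \int[leb]_t (window t1 t * primitive H t)) ->
  \int[leb]_t H t = 0.
Proof.
move=> C0 Hi H0 Hout ineq.
have pi t : L1 leb (fun u => before t u * H u) by exact: L1_before.
have J0 t : 0 <= primitive H t by apply: Rint_ge0 => u; rewrite mulr_ge0 ?before_ge0.
have Jmono t t' : t <= t' -> primitive H t <= primitive H t'.
  move=> tt; apply: Rint_le => // u; rewrite ler_wpM2r// /before.
  by rewrite ler_nat; case: (ltP u t) => // ut; rewrite (lt_le_trans ut tt).
have Jneg t : t <= 0 -> primitive H t = 0.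
  move=> t0; rewrite /primitive -[RHS](Rint_cst0 leb); apply: eq_Rintegral => u _.
  rewrite /before; case: (ltP u t) => ut; last by rewrite mul0r.
  by rewrite Hout ?mulr0// (ltNge 0 u) (ltW (lt_le_trans ut t0)).
have winE t1 : \int[leb]_t (window t1 t * H t) = primitive H t1.
  apply: eq_Rintegral => t _; rewrite /window /before.
  have [t0|t0] := boolP (0 < t < T); last by rewrite Hout// !mulr0.
  by case/andP: t0 => -> _.
pose h := (2 * C)^-1; have h0 : 0 < h by rewrite invr_gt0 mulr_gt0.
have step n : forall t1, t1 < T -> t1 <= n%:R * h -> primitive H t1 = 0.
  elim: n => [|n IH] t1 t1T t1n; first by apply: Jneg; rewrite mul0r in t1n.
  pose tau := t1 - h.
  have tauT : tau < T by rewrite /tau; lra.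
  have Jtau : primitive H tau = 0.
    by apply: IH => //; move: t1n; rewrite -natr1 mulrDl mul1r /tau; lra.
  have := ineq _ t1T; rewrite winE => le1.
  have le2 : \int[leb]_t (window t1 t * primitive H t) <= primitive H t1 * h.
    have -> : primitive H t1 * h = \int[leb]_t (primitive H t1 * \1_(`]tau, t1]) t).
      rewrite RintZ; last exact: L1_oc.
      rewrite Rint_oc ?/tau; last by lra.
      by congr (_ * _); ring.
    apply: Rint_le.
    - under eq_fun do rewrite mulrC.
      apply: (@L1_bounded_mul _ _ _ leb _ (window t1) (primitive H)); last exact: L1_window.
      + by apply: measurable_primitive; exact: L1_measurable Hi.
      + by move=> t; exact: primitive_bound.
    - by apply: L1Z; exact: L1_oc.
    - move=> t; rewrite /window indicE; have [tt|tt] := leP t tau.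
        have -> : primitive H t = 0 by apply/eqP; rewrite eq_le J0 -Jtau Jmono.
        by rewrite mulr0 mulr_ge0.
      have [t1t|t1t] := ltP t t1; last by rewrite andbF mul0r mulr_ge0.
      rewrite mem_set /=; last by rewrite in_itv/= tt ltW.
      rewrite mulr1; case: (0 < t); rewrite ?mul0r// mul1r.
      by apply: Jmono; exact: ltW.
  have : primitive H t1 <= 2^-1 * primitive H t1.
    apply: (le_trans le1); have -> : 2^-1 * primitive H t1 = C * (primitive H t1 * h).
      by rewrite /h; field; rewrite gt_eqF.
    by rewrite ler_pM2l.
  by have := J0 t1; lra.
have stepT t1 : t1 < T -> primitive H t1 = 0.
  move=> t1T; apply: (step (Num.truncn (t1 / h)).+1) => //.
  by rewrite -ler_pdivrMr// ltW// truncnS_gt.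
(* The inequality is available only for [t1 < T]; the times [T - n.+1^-1] exhaust the interval. *)
have [|||||_ c] := @dominated_Rint _ _ _ leb (fun n t => before (T - n.+1%:R^-1) t * H t) H H.
- by move=> n; exact: L1_measurable (pi _).
- exact: L1_measurable Hi.
- move=> t; have [tT|tT] := boolP (0 < t < T); last first.
    by under eq_fun do rewrite Hout// mulr0; rewrite Hout//; exact: cvg_cst.
  case/andP: tT => t0 tT.
  apply: cvg_near_cst; near=> n; rewrite /before.
  have nT : n.+1%:R^-1 < T - t.
    rewrite invf_plt ?posrE ?subr_gt0//; apply: (@lt_le_trans _ _ n%:R); last by rewrite ler_nat.
    by near: n; exact: nbhs_infty_gtr.
  have tn : t < T - n.+1%:R^-1 by rewrite ltrBrDr addrC -ltrBrDr.
  by rewrite tn mul1r.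
- exact: Hi.
- by move=> n t; rewrite normrM (ger0_norm (H0 t)) -[leRHS]mul1r ler_wpM2r// normr_before_le1.
have e : (fun n : nat => \int[leb]_t (before (T - n.+1%:R^-1) t * H t)) = fun=> 0.
  apply/funext => n; apply: stepT; by rewrite ltrBlDr ltrDl invr_gt0.
rewrite e in c.
by apply/esym; apply: (cvg_unique (@Rhausdorff R) (cvg_cst 0) c).
Unshelve. all: by end_near. Qed.

End gronwall.

(** * Pointwise estimates in the frequency *)

Lemma sqr_le_powR (R : realType) (c a : R) : 0 < c -> 2 < a ->
  exists2 K, 0 <= K & forall r : R, 0 <= r -> r ^+ 2 <= c * r `^ a + K.
Proof.
move=> c0 a2; pose r0 := (c^-1) `^ ((a - 2)^-1).
have a0 : 0 < a - 2 by lra.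
exists (r0 ^+ 2); first exact: sqr_ge0.
move=> r rge; have [rr|rr] := leP r r0.
  apply: (@le_trans _ _ (r0 ^+ 2)); last first.
    by rewrite lerDr; apply: mulr_ge0; [exact: ltW|exact: powR_ge0].
  by rewrite ler_pXn2r// nnegrE (le_trans rge).
have r00 : 0 <= r0 by exact: powR_ge0.
have rp : 0 < r by exact: le_lt_trans rr.
apply: (@le_trans _ _ (c * r `^ a)); last by rewrite lerDl sqr_ge0.
have -> : a = (a - 2) + 2%:R by ring.
rewrite powRD; last by apply/implyP => _; rewrite gt_eqF.
rewrite powR_mulrn// mulrA -[leLHS]mul1r ler_wpM2r ?sqr_ge0//.
rewrite -ler_pdivrMl// mulr1.
have -> : c^-1 = r0 `^ (a - 2) by rewrite /r0 -powRrM mulVf ?gt_eqF// powRr1// invr_ge0 ltW.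
by apply: ge0_ler_powR; rewrite ?nnegrE// ltW.
Qed.

(** Expand [k * (x + u * y / k) ^+ 2 >= 0] for [u = 1] and [u = -1]. *)
Lemma young_norm (R : realType) (k x y : R) : 0 < k -> `|2 * (x * y)| <= k * x ^+ 2 + k^-1 * y ^+ 2.
Proof.
move=> k0; have kk : k * k^-1 = 1 by rewrite mulfV// gt_eqF.
have H (u : R) : 0 <= k * (x + u * (k^-1 * y)) ^+ 2 by rewrite mulr_ge0 ?sqr_ge0// ltW.
have E (u : R) : k * (x + u * (k^-1 * y)) ^+ 2 =
    k * x ^+ 2 + (k * k^-1) * (2 * u * (x * y)) + (k * k^-1) * (u ^+ 2 * (k^-1 * y ^+ 2)) by ring.
have := H 1; have := H (-1); rewrite !E kk !mul1r sqrrN expr1n !mul1r => h1 h2.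
by rewrite ler_norml; apply/andP; split; lra.
Qed.

(* [e] is the frequency, [q] a multiple of [|e|^(2s)], and [z], [w], [g] the
   Fourier coefficients of the solution; the last hypothesis is where s > 1/2
   enters. *)
Lemma energy_pointwise (R : realType) (d : nat) (k a C q zc zs wc ws : R)
    (e gc gs : 'I_d -> R) (m := (1 + q)^-1) : 0 < k -> 0 <= q ->
  m ^+ 2 * (1 + \sum_i e i ^+ 2) <= k * (k * a + C * m) ->
  `|2 * (m * ((- q * wc - \sum_i e i * gs i) * zc + (- q * ws + \sum_i e i * gc i) * zs))
     + 2 * (wc * zc + ws * zs)| <=
  k * (wc ^+ 2 + ws ^+ 2) + k * (\sum_i (gc i ^+ 2 + gs i ^+ 2))
  + k * a * (zc ^+ 2 + zs ^+ 2) + C * m * (zc ^+ 2 + zs ^+ 2).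
Proof.
move=> k0 q0 H; have m0 : m * (1 + q) = 1 by rewrite mulVf// gt_eqF// ltr_wpDr.
(* Thanks to this identity the principal part [- 2 * m * q * (wc * zc + ws * zs)] cancels the added
   [2 * (wc * zc + ws * zs)] up to a term with the factor [m]. *)
have mq : m * q = 1 - m by rewrite -m0; ring.
rewrite (_ : 2 * (m * _) + _ = 2 * (wc * (m * zc)) + 2 * (ws * (m * zs)) +
   \sum_i (2 * (gc i * (m * e i * zs)) - 2 * (gs i * (m * e i * zc)))); last first.
  have S (g : 'I_d -> R) x : \sum_i 2 * (g i * (m * e i * x)) = 2 * m * x * \sum_i e i * g i.
    by rewrite mulr_sumr; apply: eq_bigr => i _; ring.
  rewrite sumrB !S; move: (\sum_i e i * gs i) (\sum_i e i * gc i) => Ss Sc.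
  have -> : 2 * (m * ((- q * wc - Ss) * zc + (- q * ws + Sc) * zs)) =
    - 2 * (m * q) * (wc * zc + ws * zs) + 2 * m * (Sc * zs - Ss * zc) by ring.
  by rewrite mq; ring.
(* Young's inequality charges [k] to [w] and [g], and leaves on [z] the factor
   [k^-1 * m ^+ 2 * (1 + |e|^2)], which the last hypothesis controls. *)
have Y x y := @young_norm R k x y k0.
apply: (@le_trans _ _ (k * (wc ^+ 2 + ws ^+ 2) + k * (\sum_i (gc i ^+ 2 + gs i ^+ 2)) +
   k^-1 * (m ^+ 2 * (1 + \sum_i e i ^+ 2)) * (zc ^+ 2 + zs ^+ 2))).
  have S : `|\sum_i (2 * (gc i * (m * e i * zs)) - 2 * (gs i * (m * e i * zc)))| <=
     \sum_i (k * (gc i ^+ 2 + gs i ^+ 2) + k^-1 * (m ^+ 2 * (zc ^+ 2 + zs ^+ 2)) * e i ^+ 2).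
    apply: (le_trans (ler_norm_sum _ _ _)); apply: ler_sum => i _.
    apply: (le_trans (ler_normB _ _)).
    have := Y (gc i) (m * e i * zs); have := Y (gs i) (m * e i * zc).
    by rewrite !exprMn => h1 h2; lra.
  rewrite [leRHS]big_split/= -[X in _ <= X + _]mulr_sumr -[X in _ <= _ + X]mulr_sumr in S.
  apply: (le_trans (ler_normD _ _)); apply: (le_trans (lerD (ler_normD _ _) S)).
  have := Y wc (m * zc); have := Y ws (m * zs); rewrite !exprMn => h1 h2.
  by move: h1 h2; move: (\sum_i e i ^+ 2) (\sum_i (gc i ^+ 2 + gs i ^+ 2)) k^-1 => Q P k'; lra.
rewrite -[leRHS]addrA lerD2l -mulrDl ler_wpM2r ?addr_ge0 ?sqr_ge0//.
by rewrite ler_pdivrMl.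
Qed.

Section slices.
Context {R : realType} {d : nat}.
Local Notation E := 'rV[R]_d.
Local Notation mu := (@lebesgue_rV R d).
Local Notation leb := (@lebesgue_measure R).
Local Notation Q := (@lebesgue_measure R \x @lebesgue_rV R d)%E.
Variables (z : R -> E -> R) (M : R).
Hypothesis zi : L1 Q (fun p => z p.1 p.2).
Hypothesis zt : forall t, L1 mu (z t).
Hypothesis zM : forall t x, `|z t x| <= M.

Section dominated.
Variables (f : R -> E -> R) (K : R).
Hypothesis mf : measurable_fun setT (fun p : measurableTypeR R * E => f p.1 p.2).
Hypothesis fK : forall t x, `|f t x| <= K * `|z t x|.

Lemma measurable_slice t : measurable_fun setT (f t).
Proof. exact: (measurableT_comp mf (@pair1_measurable _ _ (measurableTypeR R) E t)). Qed.

(** Bounding one of the two factors [|z t x|] by [M] makes square integrability a consequence of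
    integrability. *)
Lemma sqr_slice_le t x : `|f t x ^+ 2| <= (K ^+ 2 * M) * `|z t x|.
Proof.
rewrite normrX (@le_trans _ _ ((K * `|z t x|) ^+ 2))//.
  by rewrite ler_pXn2r// nnegrE ?normr_ge0// (le_trans _ (fK t x)).
rewrite exprMn -mulrA ler_wpM2l ?sqr_ge0// expr2 ler_wpM2r//.
Qed.

Lemma L12_slice t : L12 (f t).
Proof.
have m := measurable_slice t; split.
- by apply: (@L1_le _ _ _ mu _ (fun x => K * `|z t x|)) => //; apply: L1Z; exact: L1_abs.
- apply: (@L1_le _ _ _ mu _ (fun x => (K ^+ 2 * M) * `|z t x|)) => //.
  + exact: measurable_funX.
  + by apply: L1Z; exact: L1_abs.
  + exact: sqr_slice_le.
Qed.

Lemma L1_dominated : L1 Q (fun p => f p.1 p.2).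
Proof.
by apply: (@L1_le _ _ _ Q _ (fun p => K * `|z p.1 p.2|)) => //; apply: L1Z; exact: L1_abs.
Qed.

Lemma L1_sqr_dominated : L1 Q (fun p => f p.1 p.2 ^+ 2).
Proof.
apply: (@L1_le _ _ _ Q _ (fun p => (K ^+ 2 * M) * `|z p.1 p.2|)).
- exact: measurable_funX.
- by apply: L1Z; exact: L1_abs.
- by move=> p; exact: sqr_slice_le.
Qed.

Let measurable_fcos2 : measurable_fun setT (fun p : measurableTypeR R * E => fcos (f p.1) p.2).
Proof.
apply: (@measurable_Rint2 _ _ _ _ R mu (fun (p : measurableTypeR R * E) x => f p.1 x * cos (dot x p.2))).
apply: measurable_funM.
  have mp : measurable_fun setT (fun q : (measurableTypeR R * E) * E => (q.1.1, q.2)).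
    apply/measurable_fun_pairP; split.
      exact: (measurableT_comp measurable_fst measurable_fst).
    exact: measurable_snd.
  exact: (measurableT_comp mf mp).
apply: (measurableT_comp (@measurable_cos R)); apply: measurable_dot => //.
exact: (measurableT_comp measurable_snd measurable_fst).
Qed.

Let measurable_fsin2 : measurable_fun setT (fun p : measurableTypeR R * E => fsin (f p.1) p.2).
Proof.
apply: (@measurable_Rint2 _ _ _ _ R mu (fun (p : measurableTypeR R * E) x => f p.1 x * sin (dot x p.2))).
apply: measurable_funM.
  have mp : measurable_fun setT (fun q : (measurableTypeR R * E) * E => (q.1.1, q.2)).
    apply/measurable_fun_pairP; split.
      exact: (measurableT_comp measurable_fst measurable_fst).
    exact: measurable_snd.
  exact: (measurableT_comp mf mp).
apply: (measurableT_comp measurable_sin); apply: measurable_dot => //.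
exact: (measurableT_comp measurable_snd measurable_fst).
Qed.

Lemma measurable_fourier2 :
  measurable_fun setT (fun p : measurableTypeR R * E => fcos (f p.1) p.2) /\
  measurable_fun setT (fun p : measurableTypeR R * E => fsin (f p.1) p.2).
Proof. by split. Qed.

(** Plancherel at each time turns the inner integral into a multiple of the space integral of
    [f t x ^+ 2], which is integrable in time by Fubini. *)
Lemma L1_fpower_slices : L1 Q (fun p => fpower (f p.1) p.2).
Proof.
apply: (@L1_prod_le _ _ _ _ R leb mu (fun t xi => fpower (f t) xi)
   (fun t => fejer_mass ^+ d * \int[mu]_x f t x ^+ 2)).
- by apply: measurable_funD; apply: measurable_funX.
- by apply: L1Z; apply: (@L1_fubini1 _ _ _ _ R leb mu (fun p => f p.1 p.2 ^+ 2)); exact: L1_sqr_dominated.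
- move=> t; have [i <-] := plancherel (L12_slice t); rewrite EFin_Rint//.
  apply: ge0_le_integral => //.
  + by apply/measurable_EFinP; exact: L1_measurable (L1_abs i).
  + by apply/measurable_EFinP; exact: L1_measurable i.
  + by move=> xi _; rewrite lee_fin ger0_norm// fpower_ge0.
Qed.

End dominated.
End slices.

Section ode_wave.
Context {R : realType} {d : nat}.
Local Notation E := 'rV[R]_d.
Local Notation mu := (@lebesgue_rV R d).
Local Notation leb := (@lebesgue_measure R).
Local Notation Q := (@lebesgue_measure R \x @lebesgue_rV R d)%E.
Variables (s T L : R) (z w : R -> E -> R) (g : 'I_d -> R -> E -> R).
Hypothesis hs : 0 < s < 1.
Hypothesis mz : measurable_fun setT (fun p : measurableTypeR R * E => z p.1 p.2).
Hypothesis mw : measurable_fun setT (fun p : measurableTypeR R * E => w p.1 p.2).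
Hypothesis mg : forall i, measurable_fun setT (fun p : measurableTypeR R * E => g i p.1 p.2).
Hypothesis z0 : forall t x, ~~ (0 < t < T) -> z t x = 0.
Hypothesis wL : forall t x, `|w t x| <= L * `|z t x|.
Hypothesis gL : forall i t x, `|g i t x| <= L * `|z t x|.
Hypothesis zi : L1 Q (fun p => z p.1 p.2).
Hypothesis zt : forall t, L1 mu (z t).
Hypothesis weak : linear_solution s T z w g.

Lemma L1_mul_wave (f : E -> R) (h : R -> R) (xi : E) (al : R) : measurable_fun setT h ->
  (forall y, `|h y| <= 1) -> L1 mu f -> L1 mu (fun x => f x * h (dot x xi + al)).
Proof.
move=> mh h1 fi; under eq_fun do rewrite mulrC.
apply: (@L1_bounded_mul _ _ _ _ 1) => //.
apply: (measurableT_comp mh); apply: measurable_funD => //; exact: measurable_dotl.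
Qed.

Lemma bump_top_gt0 : 0 < @bump_top R d.
Proof.
rewrite exprn_gt0//; apply: (lt_le_trans (expR_gt0 (-4))); apply: bump_ge.
by rewrite normr0.
Qed.

(* By Fourier inversion this constant is 1, but only its positivity matters. *)
Definition multiplier_ratio : R := @lap_mass R d / @bump_top R d.

Lemma multiplier_ratio_gt0 : 0 < multiplier_ratio.
Proof.
rewrite divr_gt0 ?bump_top_gt0// mulr_gt0 ?Rint_bump_hatn_gt0//.
by rewrite invr_gt0 exprn_gt0// mulr_gt0// pi_gt0.
Qed.

Definition wave_cos (f : R -> E -> R) (xi : E) (al t : R) : R :=
  \int[mu]_x (f t x * cos (dot x xi + al)).
Definition wave_sin (f : R -> E -> R) (xi : E) (al t : R) : R :=
  \int[mu]_x (f t x * sin (dot x xi + al)).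

(** Fubini in the limit identity. Dividing by [bump_top] normalizes the coefficient of the time
    derivative and leaves [multiplier_ratio] in front of the symbol. *)
Lemma ode_wave xi al : ode_solution T (wave_cos z xi al)
  (fun t => - (multiplier_ratio * symbol s xi) * wave_cos w xi al t
     - \sum_(i < d) xi ord0 i * wave_sin (g i) xi al t).
Proof.
move=> th a b sth bT thab.
have [iL e] := @weak_wave_limit R d s T L z w g hs mz mw mg z0 wL gL zi weak th a b al xi sth bT thab.
have ti t := L1_mul_wave xi al (@measurable_cos R) (@normr_cos_le1 R) (zt t).
have wti t : L1 mu (w t).
  apply: (@L1_le _ _ _ mu _ (fun x => L * `|z t x|)) => //; first exact: measurable_slice.
  by apply: L1Z; exact: L1_abs.
have gti i t : L1 mu (g i t).
  apply: (@L1_le _ _ _ mu _ (fun x => L * `|z t x|)) => //; first exact: measurable_slice (mg i) t.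
  by apply: L1Z; exact: L1_abs.
have wi t := L1_mul_wave xi al (@measurable_cos R) (@normr_cos_le1 R) (wti t).
have gi i t := L1_mul_wave xi al (@measurable_sin R) (@normr_sin_le1 R) (gti i t).
set F := fun t : R => derive1 th t * wave_cos z xi al t + th t * _.
have k0 := bump_top_gt0.
have inner t : \int[mu]_x wave_limit s z w g th xi al (t, x) = @bump_top R d * F t.
  transitivity (\int[mu]_x ((derive1 th t * @bump_top R d) * (z t x * cos (dot x xi + al))
     - (th t * (@lap_mass R d * symbol s xi)) * (w t x * cos (dot x xi + al))
     + \sum_(i < d) (- (th t * @bump_top R d * xi ord0 i)) * (g i t x * sin (dot x xi + al)))).
    apply: eq_Rintegral => x _; rewrite /wave_limit/=; congr (_ - _ + _); [ring|ring|].
    by apply: eq_bigr => i _; ring.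
  rewrite RintD; last 2 first.
  - by apply: L1B; apply: L1Z.
  - by apply: L1_sum => i; apply: L1Z.
  rewrite RintB; [|by apply: L1Z..].
  rewrite Rint_sum; last by move=> i; exact: L1Z.
  rewrite !RintZ//.
  have -> : @lap_mass R d = multiplier_ratio * @bump_top R d by rewrite /multiplier_ratio divfK ?gt_eqF.
  have -> : \sum_(i < d) \int[mu]_x (- (th t * @bump_top R d * xi ord0 i) * (g i t x * sin (dot x xi + al))) =
      - (th t * @bump_top R d) * \sum_(i < d) xi ord0 i * wave_sin (g i) xi al t.
    rewrite mulr_sumr; apply: eq_bigr => i _; rewrite RintZ// /wave_sin; ring.
  by rewrite /F -/(wave_cos z xi al t) -/(wave_cos w xi al t); ring.
have kFi := @L1_fubini1 _ _ _ _ R leb mu _ iL.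
rewrite (_ : (fun t => _) = fun t => @bump_top R d * F t) in kFi; last by apply/funext.
have Fi : L1 leb F.
  have := L1Z (@bump_top R d)^-1 kFi; rewrite (_ : (fun t => _) = F)//.
  by apply/funext => t; rewrite mulKf// gt_eqF.
move: e; rewrite (@Rfubini1 _ _ _ _ R leb mu _ iL).
under eq_Rintegral do rewrite inner.
by rewrite RintZ// => /eqP; rewrite mulf_eq0 gt_eqF//= => /eqP.
Qed.

End ode_wave.

(** * Uniqueness for the linear problem *)

Section energy.
Context {R : realType} {d : nat}.
Local Notation E := 'rV[R]_d.
Local Notation mu := (@lebesgue_rV R d).
Local Notation leb := (@lebesgue_measure R).
Local Notation Q := (@lebesgue_measure R \x @lebesgue_rV R d)%E.
Variables (s T L M k a : R) (z w : R -> E -> R) (g : 'I_d -> R -> E -> R).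
Hypothesis hs : 2^-1 < s < 1.
Hypothesis mz : measurable_fun setT (fun p : measurableTypeR R * E => z p.1 p.2).
Hypothesis mw : measurable_fun setT (fun p : measurableTypeR R * E => w p.1 p.2).
Hypothesis mg : forall i, measurable_fun setT (fun p : measurableTypeR R * E => g i p.1 p.2).
Hypothesis z0 : forall t x, ~~ (0 < t < T) -> z t x = 0.
Hypothesis zM : forall t x, `|z t x| <= M.
Hypothesis wL : forall t x, `|w t x| <= L * `|z t x|.
Hypothesis gL : forall i t x, `|g i t x| <= L * `|z t x|.
Hypothesis zi : L1 Q (fun p => z p.1 p.2).
Hypothesis zt : forall t, L1 mu (z t).
Hypothesis weak : linear_solution s T z w g.
Hypothesis k0 : 0 < k.
Hypothesis diss : forall t x,
  k * (w t x ^+ 2 + \sum_(i < d) g i t x ^+ 2 + a * z t x ^+ 2) <= 2 * (z t x * w t x).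
Hypothesis ag : a = 1 \/ (a = 0 /\ forall i t x, g i t x = 0).

(* The weight [m] is that of the norm of H^(-s). *)
Let q (xi : E) : R := @multiplier_ratio R d * symbol s xi.
Let m (xi : E) : R := (1 + q xi)^-1.

Let q_ge0 xi : 0 <= q xi.
Proof. by rewrite mulr_ge0 ?symbol_ge0// ltW// multiplier_ratio_gt0. Qed.

Let m_ge0 xi : 0 <= m xi.
Proof. by rewrite invr_ge0 addr_ge0. Qed.

Let m_le1 xi : m xi <= 1.
Proof. by rewrite invf_le1 ?ltr_wpDr// lerDl. Qed.

Let m_gt0 xi : 0 < m xi.
Proof. by rewrite invr_gt0 ltr_wpDr. Qed.

Let measurable_q : measurable_fun setT q.
Proof. by apply: measurable_funM => //; exact: measurable_symbol. Qed.

Let measurable_m : measurable_fun setT m.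
Proof.
rewrite (_ : m = fun xi => (1 + q xi) `^ (-1)).
  apply: (measurableT_comp (measurable_powR (-1))).
  exact: measurable_funD.
by apply/funext => xi; rewrite powR_inv1// addr_ge0.
Qed.

(** For [a = 1]: as [4 * s > 2], [|xi|^2 <= (k * q xi) ^+ 2 + K]; multiplying by [m ^+ 2] and using
    [m * q <= 1] and [m <= 1] gives [k ^+ 2 + (K + 1) * m]. For [a = 0] the factor [a] erases the
    frequencies, and [m ^+ 2 <= m] is enough. *)
Let weight_bound : exists2 C, 0 < C & forall xi,
  m xi ^+ 2 * (1 + \sum_(i < d) (a * xi ord0 i) ^+ 2) <= k * (k * a + C * m xi).
Proof.
have A0 := @multiplier_ratio_gt0 R d.
have c0 : 0 < (k * @multiplier_ratio R d) ^+ 2 by rewrite exprn_gt0// mulr_gt0.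
have s4 : 2 < 4 * s by case/andP: hs; lra.
have [K K0 HK] := sqr_le_powR c0 s4.
exists ((K + 1) / k); first by rewrite divr_gt0// ltr_wpDl.
move=> xi.
have -> : k * (k * a + (K + 1) / k * m xi) = k * k * a + (K + 1) * m xi.
  by move: (m xi) => mx; field; rewrite gt_eqF.
have m1 := m_le1 xi; have m0 := m_ge0 xi.
have mm : m xi ^+ 2 <= m xi by rewrite expr2 -[leRHS]mulr1 ler_wpM2l.
case: ag => [->|[-> _]]; last first.
  rewrite big1; last by move=> i _; rewrite mul0r expr0n.
  rewrite addr0 mulr1 mulr0 add0r; apply: (le_trans mm).
  by rewrite -[leLHS]mul1r ler_wpM2r// lerDr.
have -> : \sum_(i < d) (1 * xi ord0 i) ^+ 2 = enorm xi ^+ 2.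
  by rewrite enorm_sqr; apply: eq_bigr => i _; rewrite mul1r expr2.
have := HK _ (enorm_ge0 xi).
have -> : enorm xi `^ (4 * s) = symbol s xi ^+ 2.
  by rewrite -powR_mulrn ?symbol_ge0// /symbol -powRrM; congr (_ `^ _); ring.
move=> H.
have mq : m xi * q xi <= 1.
  rewrite -(@mulVf _ (1 + q xi)) ?gt_eqF ?ltr_wpDr// ler_wpM2l//.
  by rewrite lerDr.
have mq2 : (m xi * q xi) ^+ 2 <= 1 by rewrite expr_le1// mulr_ge0.
apply: (@le_trans _ _ (k ^+ 2 * (m xi * q xi) ^+ 2 + (K + 1) * m xi ^+ 2)).
  rewrite (_ : k ^+ 2 * _ + _ = m xi ^+ 2 * (1 + ((k * q xi) ^+ 2 + K))); last by ring.
  by apply: ler_wpM2l; [exact: sqr_ge0|rewrite lerD2l /q mulrA; move: H; rewrite -exprMn].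
rewrite mulr1 -expr2; apply: lerD; last by rewrite ler_wpM2l// addr_ge0.
by rewrite -[leRHS]mulr1 ler_wpM2l// sqr_ge0.
Qed.

Let wave_energy xi al (F := fun t => - q xi * wave_cos w xi al t
     - \sum_(i < d) xi ord0 i * wave_sin (g i) xi al t) t1 : t1 < T ->
  [/\ L1 leb (fun s => elapsed t1 s * (F s * wave_cos z xi al s)),
     L1 leb (fun t => window t1 t * wave_cos z xi al t ^+ 2) &
     \int[leb]_t (window t1 t * wave_cos z xi al t ^+ 2) =
     2 * \int[leb]_s (elapsed t1 s * (F s * wave_cos z xi al s))].
Proof.
have hs' : 0 < s < 1 by move: hs => /andP[h1 h2]; apply/andP; split; lra.
have waveL1 (h : R -> R) (f : R -> E -> R) : measurable_fun setT h -> (forall y, `|h y| <= 1) ->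
    L1 Q (fun p => f p.1 p.2) -> L1 leb (fun t => \int[mu]_x (f t x * h (dot x xi + al))).
  move=> mh h1 fi.
  apply: (@L1_fubini1 _ _ _ _ R leb mu (fun p => f p.1 p.2 * h (dot p.2 xi + al))).
  under eq_fun do rewrite mulrC.
  apply: (@L1_bounded_mul _ _ _ Q 1) => //.
  apply: (measurableT_comp mh); apply: measurable_funD => //.
  exact: (measurableT_comp (measurable_dotl xi) measurable_snd).
have wi : L1 Q (fun p => w p.1 p.2) by exact: (L1_dominated zi mw wL).
have gi i : L1 Q (fun p => g i p.1 p.2) by exact: (L1_dominated zi (mg i) (gL i)).
have w0 t x : ~~ (0 < t < T) -> w t x = 0.
  by move=> tT; apply/eqP; rewrite -normr_le0 (le_trans (wL t x))// z0// normr0 mulr0.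
have g0 i t x : ~~ (0 < t < T) -> g i t x = 0.
  by move=> tT; apply/eqP; rewrite -normr_le0 (le_trans (gL i t x))// z0// normr0 mulr0.
have int0 (h : R -> R) (f : R -> E -> R) t : (forall x, f t x = 0) ->
    \int[mu]_x (f t x * h (dot x xi + al)) = 0.
  by move=> f0; rewrite -[RHS](Rint_cst0 mu); apply: eq_Rintegral => x _; rewrite f0 mul0r.
apply: ode_energy.
- by apply: (waveL1 cos) => //; [exact: measurable_cos|exact: normr_cos_le1].
- apply: L1B.
    by apply: L1Z; apply: (waveL1 cos) => //; [exact: measurable_cos|exact: normr_cos_le1].
  apply: L1_sum => i; apply: L1Z.
  by apply: (waveL1 sin) => //; [exact: measurable_sin|exact: normr_sin_le1].
- by move=> t tT; apply: (int0 cos) => x; exact: z0.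
- move=> t tT; rewrite /F /wave_cos (int0 cos); last by move=> x; exact: w0.
  rewrite mulr0 sub0r big1 ?oppr0// => i _.
  by rewrite /wave_sin (int0 sin) ?mulr0// => x; exact: g0.
- exact: (ode_wave hs' mz mw mg z0 wL gL zi zt weak).
Qed.

Let wt t : L1 mu (w t) := (L12_slice zt zM mw wL t).1.
Let gt i t : L1 mu (g i t) := (L12_slice zt zM (mg i) (gL i) t).1.

Let wave0 (f : R -> E -> R) xi t :
  wave_cos f xi 0 t = fcos (f t) xi /\ wave_sin f xi 0 t = fsin (f t) xi.
Proof. by split; apply: eq_Rintegral => x _; rewrite addr0. Qed.

Let wavepi (f : R -> E -> R) xi t : L1 mu (f t) ->
  wave_cos f xi (- (pi / 2)) t = fsin (f t) xi /\ wave_sin f xi (- (pi / 2)) t = - fcos (f t) xi.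
Proof.
move=> fi; split; first by apply: eq_Rintegral => x _; rewrite cosBpihalf.
rewrite /fcos -RintN; last exact: L1_fcos.
by apply: eq_Rintegral => x _; rewrite sinBpihalf mulrN.
Qed.

(** Twice the weight times [F * Z], added over the phases 0 and [- (pi / 2)], that is, over the
    cosine and the sine coefficients. *)
Let X t xi : R := 2 * (m xi * ((- q xi * fcos (w t) xi - \sum_(i < d) xi ord0 i * fsin (g i t) xi) * fcos (z t) xi
  + (- q xi * fsin (w t) xi + \sum_(i < d) xi ord0 i * fcos (g i t) xi) * fsin (z t) xi)).

Let energy_identity xi t1 : t1 < T ->
  \int[leb]_t (window t1 t * (m xi * fpower (z t) xi)) = \int[leb]_t (elapsed t1 t * X t xi).
Proof.
move=> t1T.
have [i1 j1 e1] := @wave_energy xi 0 t1 t1T.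
have [i2 j2 e2] := @wave_energy xi (- (pi / 2)) t1 t1T.
transitivity (m xi * (\int[leb]_t (window t1 t * wave_cos z xi 0 t ^+ 2) +
    \int[leb]_t (window t1 t * wave_cos z xi (- (pi / 2)) t ^+ 2))).
  rewrite -RintD// -RintZ; last exact: L1D.
  apply: eq_Rintegral => t _.
  by rewrite (wave0 z xi t).1 (@wavepi z xi t (zt t)).1 -mulrDr mulrCA.
rewrite e1 e2 -mulrDr -RintD// mulrCA -RintZ; last exact: L1D.
rewrite -RintZ; last by apply: L1Z; exact: L1D.
apply: eq_Rintegral => t _.
rewrite !(wave0 z xi t).1 !(wave0 w xi t).1 !(@wavepi z xi t (zt t)).1 !(@wavepi w xi t (wt t)).1.
have -> : \sum_(i < d) xi ord0 i * wave_sin (g i) xi 0 t = \sum_(i < d) xi ord0 i * fsin (g i t) xi.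
  by apply: eq_bigr => i _; rewrite (wave0 (g i) xi t).2.
have -> : \sum_(i < d) xi ord0 i * wave_sin (g i) xi (- (pi / 2)) t =
    - \sum_(i < d) xi ord0 i * fcos (g i t) xi.
  by rewrite -sumrN; apply: eq_bigr => i _; rewrite (@wavepi (g i) xi t (gt i t)).2 mulrN.
by rewrite opprK /X; ring.
Qed.

(** Polarization: [fpower (z - w) - fpower z - fpower w] is minus twice the product of the
    coefficients of [z] and [w], so Plancherel's identity for squares also handles the cross
    term. *)
Let zw t x : R := z t x - w t x.

Let mzw : measurable_fun setT (fun p : measurableTypeR R * E => zw p.1 p.2).
Proof. exact: measurable_funB. Qed.

Let zwL t x : `|zw t x| <= (1 + L) * `|z t x|.
Proof. by rewrite mulrDl mul1r (le_trans (ler_normB _ _))// lerD2l. Qed.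

Let zz t x : `|z t x| <= 1 * `|z t x|.
Proof. by rewrite mul1r. Qed.

Let remainder (C t : R) xi : R := k * fpower (w t) xi + k * (\sum_(i < d) fpower (g i t) xi)
  + k * a * fpower (z t) xi + C * m xi * fpower (z t) xi.

Let majorant (C t : R) xi : R :=
  fpower (zw t) xi - fpower (z t) xi - fpower (w t) xi + remainder C t xi.

Let X_bound C t xi :
  m xi ^+ 2 * (1 + \sum_(i < d) (a * xi ord0 i) ^+ 2) <= k * (k * a + C * m xi) ->
  X t xi <= majorant C t xi /\
  `|X t xi| <= fpower (zw t) xi + fpower (z t) xi + fpower (w t) xi + remainder C t xi.
Proof.
move=> H.
have := energy_pointwise (fcos (z t) xi) (fsin (z t) xi) (fcos (w t) xi) (fsin (w t) xi)
  (fun i => fcos (g i t) xi) (fun i => fsin (g i t) xi) k0 (q_ge0 xi) H.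
(* The pointwise estimate is applied at the frequency [a * xi]. The factor can then be dropped: for
   [a = 0] the coefficients of [g] it multiplies are 0. *)
have ae f : (forall i, a = 0 -> f i = 0) ->
    \sum_i a * xi ord0 i * f i = \sum_i xi ord0 i * f i.
  move=> f0; apply: eq_bigr => i _; case: ag => [->|[a0 _]]; first by rewrite mul1r.
  by rewrite f0// !mulr0.
have g00 i : a = 0 -> fcos (g i t) xi = 0 /\ fsin (g i t) xi = 0.
  move=> a0; case: ag => [a1|[_ g0]]; first by move: a1; rewrite a0 => /esym/eqP; rewrite oner_eq0.
  split; rewrite -[RHS](Rint_cst0 mu); apply: eq_Rintegral => x _; rewrite g0 mul0r//.
rewrite ae; last by move=> i /g00-/(_ i)[].
rewrite ae; last by move=> i /g00-/(_ i)[].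
rewrite -/(X t xi) -/(remainder C t xi) => /ler_normlP[h1 h2].
have E : 2 * (fcos (w t) xi * fcos (z t) xi + fsin (w t) xi * fsin (z t) xi) =
    fpower (z t) xi + fpower (w t) xi - fpower (zw t) xi.
  by rewrite /fpower /zw fcosB// fsinB//; ring.
rewrite E in h1 h2.
have p1 := fpower_ge0 (z t) xi; have p2 := fpower_ge0 (w t) xi; have p3 := fpower_ge0 (zw t) xi.
rewrite /majorant; split; first by lra.
by rewrite ler_norml; apply/andP; split; lra.
Qed.

Let Pz : L1 Q (fun p => fpower (z p.1) p.2) := L1_fpower_slices zi zt zM mz zz.
Let Pw : L1 Q (fun p => fpower (w p.1) p.2) := L1_fpower_slices zi zt zM mw wL.
Let Pzw : L1 Q (fun p => fpower (zw p.1) p.2) := L1_fpower_slices zi zt zM mzw zwL.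
Let Pg i : L1 Q (fun p => fpower (g i p.1) p.2) := L1_fpower_slices zi zt zM (mg i) (gL i).

Let L1_weighted (h : R * E -> R) : L1 Q h -> L1 Q (fun p => m p.2 * h p).
Proof.
apply: (@L1_bounded_mul _ _ _ Q 1).
- exact: (measurableT_comp measurable_m measurable_snd).
- by move=> p; rewrite ger0_norm.
Qed.

Let L1_remainder C : L1 Q (fun p => remainder C p.1 p.2).
Proof.
apply: L1D; last first.
  by under eq_fun do rewrite -mulrA; apply: L1Z; exact: L1_weighted.
apply: L1D; last exact: L1Z.
by apply: L1D; [exact: L1Z|apply: L1Z; apply: L1_sum].
Qed.

Let L1_majorant C : L1 Q (fun p => majorant C p.1 p.2).
Proof. by apply: L1D; [apply: L1B => //; exact: L1B|exact: L1_remainder]. Qed.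

Let measurable_X : measurable_fun setT (fun p : measurableTypeR R * E => X p.1 p.2).
Proof.
have [zc zs] := measurable_fourier2 mz; have [wc ws] := measurable_fourier2 mw.
have gcs i := measurable_fourier2 (mg i).
have mq : measurable_fun setT (fun p : measurableTypeR R * E => - q p.2).
  by apply: measurableT_comp => //; exact: (measurableT_comp measurable_q measurable_snd).
have mc i : measurable_fun setT (fun p : measurableTypeR R * E => p.2 ord0 i).
  exact: (measurableT_comp (measurable_coord i) measurable_snd).
apply: measurable_funM => //; apply: measurable_funM.
  exact: (measurableT_comp measurable_m measurable_snd).
apply: measurable_funD; apply: measurable_funM => //.
- apply: measurable_funB; first exact: measurable_funM.
  by apply: measurable_sum => i; apply: measurable_funM => //; exact: (gcs i).2.
- apply: measurable_funD; first exact: measurable_funM.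
  by apply: measurable_sum => i; apply: measurable_funM => //; exact: (gcs i).1.
Qed.

Let L1_weighted_slice t : L1 mu (fun xi => m xi * fpower (z t) xi).
Proof.
have [z1 _] := plancherel (L12_slice zt zM mz zz t).
by apply: (@L1_bounded_mul _ _ _ mu 1) => // xi; rewrite ger0_norm.
Qed.

Let H t : R := \int[mu]_xi (m xi * fpower (z t) xi).

Let L1_H : L1 leb H.
Proof. exact: (@L1_fubini1 _ _ _ _ R leb mu _ (L1_weighted Pz)). Qed.

(** By Plancherel all terms but the last become [fejer_mass ^+ d] times the space integral of
    [- 2 z w + k (w^2 + |g|^2 + a z^2)], which [diss] makes nonpositive. *)
Let Rint_majorant C t : \int[mu]_xi majorant C t xi <= C * H t.
Proof.
have [z1 pz] := plancherel (L12_slice zt zM mz zz t).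
have [w1 pw] := plancherel (L12_slice zt zM mw wL t).
have [zw1 pzw] := plancherel (L12_slice zt zM mzw zwL t).
have pg i := plancherel (L12_slice zt zM (mg i) (gL i) t).
have [_ z2] := L12_slice zt zM mz zz t.
have [_ w2] := L12_slice zt zM mw wL t.
have [_ zw2] := L12_slice zt zM mzw zwL t.
have g2 i := (L12_slice zt zM (mg i) (gL i) t).2.
have mz1 := L1_weighted_slice t.
have sg : L1 mu (fun xi => \sum_(i < d) fpower (g i t) xi) by apply: L1_sum => i; exact: (pg i).1.
have -> : \int[mu]_xi majorant C t xi =
    (\int[mu]_xi fpower (zw t) xi - \int[mu]_xi fpower (z t) xi - \int[mu]_xi fpower (w t) xi)
    + (k * \int[mu]_xi fpower (w t) xi + k * (\sum_(i < d) \int[mu]_xi fpower (g i t) xi)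
      + k * a * \int[mu]_xi fpower (z t) xi + C * H t).
  rewrite -(Rint_sum _ (fun i => (pg i).1)) -!RintZ// -RintB// -RintB//; last exact: L1B.
  rewrite -RintD; [|exact: L1Z..].
  rewrite -RintD; [|by apply: L1D; exact: L1Z|exact: L1Z].
  rewrite -RintD; [|by apply: L1D; [apply: L1D; exact: L1Z|exact: L1Z]|exact: L1Z].
  rewrite -RintD; last 2 first.
  - by apply: L1B => //; exact: L1B.
  - by apply: L1D; [apply: L1D; [apply: L1D; exact: L1Z|exact: L1Z]|exact: L1Z].
  by apply: eq_Rintegral => xi _; rewrite /majorant /remainder mulrA.
rewrite pz pw pzw; under eq_bigr do rewrite (pg _).2.
rewrite -mulr_sumr [leLHS]addrA gerDr.
have c0 : 0 <= @fejer_mass R ^+ d by rewrite exprn_ge0// ltW// fejer_mass_gt0.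
move: (fejer_mass ^+ d) c0 => c c0.
rewrite [leLHS](_ : _ = c * (\int[mu]_x zw t x ^+ 2 - \int[mu]_x z t x ^+ 2 - \int[mu]_x w t x ^+ 2
  + k * \int[mu]_x w t x ^+ 2 + k * (\sum_(i < d) \int[mu]_x g i t x ^+ 2)
  + k * a * \int[mu]_x z t x ^+ 2)); last first.
  by move: (\sum_(i < d) _) => S; ring.
apply: mulr_ge0_le0 => //.
have sg2 : L1 mu (fun x => \sum_(i < d) g i t x ^+ 2) by apply: L1_sum.
have i1 : L1 mu (fun x => zw t x ^+ 2 - z t x ^+ 2 - w t x ^+ 2).
  by apply: L1B => //; exact: L1B.
have i2 : L1 mu (fun x => k * w t x ^+ 2) by exact: L1Z.
have i3 : L1 mu (fun x => k * \sum_(i < d) g i t x ^+ 2) by exact: L1Z.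
have i4 : L1 mu (fun x => k * a * z t x ^+ 2) by exact: L1Z.
rewrite -(Rint_sum _ g2) -!RintZ// -RintB// -RintB//; last exact: L1B.
rewrite -RintD// -RintD//; last exact: L1D.
rewrite -RintD//; last by apply: L1D => //; exact: L1D.
rewrite -[leRHS](Rint_cst0 mu); apply: Rint_le.
- exact: (L1D (L1D (L1D i1 i2) i3) i4).
- exact: L1_0.
- move=> x; have := diss t x; rewrite /zw !mulrDr => h.
  rewrite (_ : (z t x - w t x) ^+ 2 - z t x ^+ 2 - w t x ^+ 2 = - (2 * (z t x * w t x))); last by ring.
  by rewrite -(mulrA k a) -!addrA addrC subr_le0 addrA.
Qed.

Let L1_majorant_slice C t : L1 mu (majorant C t).
Proof.
have [z1 pz] := plancherel (L12_slice zt zM mz zz t).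
have [w1 pw] := plancherel (L12_slice zt zM mw wL t).
have [zw1 pzw] := plancherel (L12_slice zt zM mzw zwL t).
have pg i := (plancherel (L12_slice zt zM (mg i) (gL i) t)).1.
apply: L1D; first by apply: L1B => //; exact: L1B.
apply: L1D; last first.
  by under eq_fun do rewrite -mulrA; apply: L1Z; exact: L1_weighted_slice.
apply: L1D; last exact: L1Z.
by apply: L1D; [exact: L1Z|apply: L1Z; apply: L1_sum].
Qed.

(** The energy identity is available at each [xi], the bound on the majorant at each [t]: Fubini is
    used in one order for the former and in the other for the latter. The weight [elapsed] is
    nonnegative and so preserves the inequalities. *)
Let energy_ineq : exists2 C, 0 < C & forall t1, t1 < T ->
  \int[leb]_t (window t1 t * H t) <= C * \int[leb]_t (window t1 t * primitive H t).
Proof.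
have [C C0 HC] := weight_bound; exists C => // t1 t1T.
have [eHi ->] := Rint_window_primitive t1 L1_H.
have Xb p : `|X p.1 p.2| <= fpower (zw p.1) p.2 + fpower (z p.1) p.2 + fpower (w p.1) p.2
    + remainder C p.1 p.2 by exact: (X_bound p.1 (HC p.2)).2.
have Xi : L1 Q (fun p => X p.1 p.2).
  apply: (@L1_le _ _ _ Q _ _ measurable_X _ Xb).
  by apply: L1D; [apply: L1D => //; exact: L1D|exact: L1_remainder].
have wini (h : R * E -> R) : L1 Q h -> L1 Q (fun p => window t1 p.1 * h p).
  apply: (@L1_bounded_mul _ _ _ Q 1).
  - exact: (measurableT_comp (L1_measurable (L1_window t1)) measurable_fst).
  - by move=> p; rewrite normr_nat lern1 leq_b1.
have eli (h : R * E -> R) : L1 Q h -> L1 Q (fun p => elapsed t1 p.1 * h p).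
  apply: (@L1_bounded_mul _ _ _ Q (\int[leb]_t window t1 t)).
  - exact: (measurableT_comp (measurable_elapsed t1) measurable_fst).
  - by move=> p; exact: elapsed_bound.
have wH := wini _ (L1_weighted Pz).
have -> : \int[leb]_t (window t1 t * H t) = \int[Q]_p (elapsed t1 p.1 * X p.1 p.2).
  transitivity (\int[Q]_p (window t1 p.1 * (m p.2 * fpower (z p.1) p.2))).
    rewrite (@Rfubini1 _ _ _ _ R leb mu _ wH); apply: eq_Rintegral => t _.
    by rewrite /H -RintZ//; exact: (L1_weighted_slice t).
  rewrite (@Rfubini2 _ _ _ _ R leb mu _ wH) (@Rfubini2 _ _ _ _ R leb mu _ (eli _ Xi))/=.
  by apply: eq_Rintegral => xi _; exact: energy_identity.
apply: (@le_trans _ _ (\int[Q]_p (elapsed t1 p.1 * majorant C p.1 p.2))).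
  apply: Rint_le; [exact: eli|apply: eli; exact: L1_majorant|].
  by move=> p; rewrite ler_wpM2l ?elapsed_ge0// (X_bound p.1 (HC p.2)).1.
rewrite (@Rfubini1 _ _ _ _ R leb mu _ (eli _ (L1_majorant C))) -RintZ//.
apply: Rint_le; [exact: (@L1_fubini1 _ _ _ _ R leb mu _ (eli _ (L1_majorant C)))|exact: L1Z|].
move=> t /=; rewrite RintZ; last exact: L1_majorant_slice.
by rewrite mulrCA ler_wpM2l ?elapsed_ge0// Rint_majorant.
Qed.

(** Gronwall's lemma makes [H t] vanish for almost every [t]. As [m] is positive, the power of [z t]
    then vanishes almost everywhere, and Plancherel leads back to [z]. *)
Theorem linear_uniqueness : {ae Q, forall p, z p.1 p.2 = 0}.
Proof.
have [C C0 HC] := energy_ineq.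
have H0 t : 0 <= H t by apply: Rint_ge0 => xi; rewrite mulr_ge0 ?fpower_ge0.
have IH : \int[leb]_t H t = 0.
  apply: (gronwall C0 L1_H H0 _ HC) => t tT.
  rewrite /H -[RHS](Rint_cst0 mu); apply: eq_Rintegral => xi _.
  rewrite /fpower /fcos /fsin; under eq_Rintegral do rewrite z0// mul0r.
  under [in X in _ + X]eq_Rintegral do rewrite z0// mul0r.
  by rewrite Rint_cst0 expr0n addr0 mulr0.
have z2 := L1_sqr_dominated zi zM mz zz.
have Iz t : H t = 0 -> \int[mu]_x z t x ^+ 2 = 0.
  move=> Ht; have P0 xi : 0 <= m xi * fpower (z t) xi by rewrite mulr_ge0 ?fpower_ge0.
  have aeP := Rint_eq0_ae (L1_weighted_slice t) P0 Ht.
  have [i1 e] := plancherel (L12_slice zt zM mz zz t).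
  have : \int[mu]_xi fpower (z t) xi = 0.
    rewrite -(Rint_cst0 mu); apply: Rint_ae_eq => //; first exact: L1_measurable i1.
    have [A [mA A0 sA]] := aeP; exists A; split => // xi /= nP; apply: sA => /= eP; apply: nP.
    by move/eqP: eP; rewrite mulf_eq0 (gt_eqF (m_gt0 xi))/= => /eqP.
  rewrite e => /eqP; rewrite mulf_eq0 expf_eq0 => /orP[/andP[_]|/eqP//].
  by rewrite gt_eqF// fejer_mass_gt0.
have Iz2 : \int[Q]_p z p.1 p.2 ^+ 2 = 0.
  rewrite (@Rfubini1 _ _ _ _ R leb mu _ z2) -[RHS](Rint_cst0 leb); apply: Rint_ae_eq => //.
    exact: L1_measurable (@L1_fubini1 _ _ _ _ R leb mu _ z2).
  have [A [mA A0 sA]] := Rint_eq0_ae L1_H H0 IH.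
  by exists A; split => // t /= nz; apply: sA => /= Ht; apply: nz; exact: Iz.
have [A [mA A0 sA]] := Rint_eq0_ae z2 (fun p => sqr_ge0 (z p.1 p.2)) Iz2.
exists A; split => // p /= nz; apply: sA => /= e; apply: nz.
by apply/eqP; rewrite -sqrf_eq0; apply/eqP.
Qed.

End energy.

(** * Reduction to the linear problem *)

Section almost_everywhere.
Context d (T : measurableType d) (R : realType).
Variable mu : {measure set T -> \bar R}.

Lemma ae_and (P P' : T -> Prop) : {ae mu, forall x, P x} -> {ae mu, forall x, P' x} ->
  {ae mu, forall x, P x /\ P' x}.
Proof.
move=> [A [mA A0 sA]] [B [mB B0 sB]]; exists (A `|` B); split.
- exact: measurableU.
- by rewrite measureU0.
- move=> x /= /not_andP[nP|nP]; [left; exact: sA|right; exact: sB].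
Qed.

Lemma Lfun_infty_bounded (f : T -> R) : f \in Lfun mu +oo%E ->
  measurable_fun setT f /\ exists2 M, 0 <= M & {ae mu, forall x, `|f x| <= M}.
Proof.
move=> /andP[/[!inE]/= mf lf]; split => //.
(* The norm of exponent [+oo] is an essential supremum only on a space of positive measure; on a
   null space every set is negligible. *)
have [mu0|mu0] := eqVneq (mu setT) 0%E.
  exists 0 => //; exists setT; split => //.
move: lf; rewrite /finite_norm unlock lt0e mu0 measure_ge0/= => lf.
have [M HM] := @ess_supr_bounded _ _ _ mu (Num.norm \o f) lf.
exists `|M| => //; have [A [mA A0 sA]] := HM; exists A; split => // x /= nx.
by apply: sA => /= h; apply: nx; exact: le_trans (ler_norm M).
Qed.

End almost_everywhere.

Section almost_everywhere_prod.
Context d1 d2 (T1 : measurableType d1) (T2 : measurableType d2) (R : realType).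
Variable m1 : {sigma_finite_measure set T1 -> \bar R}.
Variable m2 : {sigma_finite_measure set T2 -> \bar R}.

Lemma ae_fst (P : T1 -> Prop) : {ae m1, forall x, P x} -> {ae (m1 \x m2)%E, forall p, P p.1}.
Proof.
move=> [A [mA A0 sA]]; exists (A `*` setT); split.
- exact: measurableX.
- by transitivity (m1 A * m2 setT)%E; [exact: product_measure1E|rewrite A0 mul0e].
- by move=> p /= nP; split => //; exact: sA.
Qed.

Lemma ae_snd (P : T2 -> Prop) : {ae m2, forall x, P x} -> {ae (m1 \x m2)%E, forall p, P p.2}.
Proof.
move=> [A [mA A0 sA]]; exists (setT `*` A); split.
- exact: measurableX.
- by transitivity (m1 setT * m2 A)%E; [exact: product_measure1E|rewrite A0 mule0].
- by move=> p /= nP; split => //; exact: sA.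
Qed.

Lemma ae_L1_slice (f : T1 * T2 -> R) : L1 (m1 \x m2)%E f ->
  {ae m1, forall x, L1 m2 (fun y => f (x, y))}.
Proof. by move=> fi; exact: (ae_integrable1 fi). Qed.

End almost_everywhere_prod.

(** * Lipschitz and dissipativity estimates for C1 nonlinearities *)

Section C1_functions.
Context {R : realType}.
Implicit Types f : R -> R.

Lemma C1_MVT f (M u v : R) : C1 f -> `|u| <= M -> `|v| <= M ->
  exists2 c, `|c| <= M & f u - f v = derive1 f c * (u - v).
Proof.
move=> [df cf].
wlog uv : u v / v <= u.
  move=> H uM vM; have [|/ltW] := leP v u; first by move/H; exact.
  by move=> /H /(_ vM uM)[c cM e]; exists c => //; rewrite -opprB e; ring.
move=> uM vM.
have cont : {within `[v, u], continuous f}.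
  apply: continuous_subspaceT => x; apply: differentiable_continuous.
  by apply/derivable1_diffP; exact: df.
have dd x : x \in `]v, u[ -> is_derive x 1 f (derive1 f x).
  by move=> _; apply: DeriveDef; [exact: df|rewrite derive1E].
have [c cvu e] := MVT_segment uv dd cont.
exists c => //; move: cvu uM vM; rewrite in_itv/= !ler_norml => /andP[c1 c2] /andP[u1 u2] /andP[v1 v2].
by apply/andP; split; lra.
Qed.

Lemma C1_Lipschitz f (M : R) : C1 f -> exists2 L, 0 < L &
  forall u v, `|u| <= M -> `|v| <= M -> `|f u - f v| <= L * `|u - v|.
Proof.
move=> cf; have [L L0 HL] := continuous_bounded_itv (- M) M cf.2.
exists (L + 1); first by rewrite ltr_wpDl.
move=> u v uM vM; have [c cM ->] := C1_MVT cf uM vM.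
rewrite normrM ler_wpM2r//; apply: (@le_trans _ _ L); last by rewrite lerDl.
by apply: HL; rewrite -ler_norml.
Qed.

Lemma C1_mul_id f : C1 f -> C1 (fun r => f r * r).
Proof.
move=> [df cf].
have H (r : R) : is_derive r 1 (fun r => f r * r) (derive1 f r * r + f r).
  have Hf : is_derive r 1 f (derive1 f r) by apply: DeriveDef; [exact: df|rewrite derive1E].
  by apply: is_derive_eq; rewrite /GRing.scale/=; ring.
split; first by move=> r; have [] := H r.
rewrite (_ : derive1 _ = fun r => derive1 f r * r + f r); last first.
  by apply/funext => r; rewrite derive1E; have [_ ->] := H r.
move=> r; apply: cvgD; first by apply: cvgM; [exact: cf|exact: cvg_id].
by apply: differentiable_continuous; apply/derivable1_diffP; exact: df.
Qed.

Lemma C1_measurable f : C1 f -> measurable_fun setT f.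
Proof.
move=> [df _]; apply: continuous_measurable_fun => r.
by apply: differentiable_continuous; apply/derivable1_diffP; exact: df.
Qed.

(* For a = 1 the square of the difference is controlled, which absorbs the drift;
   a = 0 is the degenerate case, in which there is no drift. *)
Definition dissipative (a : R) f := forall M K : R, 0 <= K -> exists2 k, 0 < k &
  forall u v, `|u| <= M -> `|v| <= M ->
  k * ((f u - f v) ^+ 2 + a * (1 + K) * (u - v) ^+ 2) <= 2 * ((u - v) * (f u - f v)).

(** By the mean value theorem the right side is [2 f'(e) (u - v)^2]. One [f'(e)] pays for
    [k f'(e)^2], since [k <= 1 / (L + 1)]; the other pays for [k (1 + K)], which is at most the
    positive minimum of [f'] on [[-M, M]]. *)
Lemma dissipative_increasing f : C1 f -> (forall r, 0 < derive1 f r) -> dissipative 1 f.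
Proof.
move=> cf f0 M K K0.
have [L L0 HL] := continuous_bounded_itv (- M) M cf.2.
have [M0|M0] := ltP M 0.
  by exists 1 => // u v uM; move: (le_lt_trans uM M0); rewrite normr_lt0.
have MM : - M <= M by lra.
have [c _ cmin] := EVT_min MM (continuous_subspaceT cf.2).
have al0 := f0 c.
pose k := Num.min (derive1 f c / (1 + K)) (L + 1)^-1.
have L1 : 0 < L + 1 by rewrite ltr_wpDl.
have K1 : 0 < 1 + K by rewrite ltr_wpDr.
have k0 : 0 < k by rewrite lt_min divr_gt0//= invr_gt0.
have k1 : k * (1 + K) <= derive1 f c by rewrite -ler_pdivlMr// ge_min lexx.
have k2 : k * (L + 1) <= 1 by rewrite -ler_pdivlMr// div1r ge_min lexx orbT.
exists k => // u v uM vM; have [e eM ->] := C1_MVT cf uM vM.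
have eM' : - M <= e <= M by rewrite -ler_norml.
have e1 : derive1 f c <= derive1 f e by apply: cmin; rewrite in_itv.
have e2 : derive1 f e <= L + 1.
  by rewrite (le_trans (ler_norm _))// (le_trans (HL _ eM'))// lerDl.
move: (derive1 f e) (derive1 f c) e1 e2 k1 al0 => be al e1 e2 k1 al0.
have kb : k * be <= 1 by rewrite (le_trans _ k2)// ler_pM2l.
have kbb : k * be * be <= be by rewrite -[leRHS]mul1r ler_wpM2r//; lra.
rewrite (_ : k * _ = (k * be * be + k * (1 + K)) * (u - v) ^+ 2); last by ring.
rewrite (_ : 2 * _ = (2 * be) * (u - v) ^+ 2); last by ring.
by rewrite ler_wpM2r ?sqr_ge0//; lra.
Qed.

(** Without a positive lower bound for [f'] there remains [f'(e)^2 <= (L + 1) f'(e)], which controls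
    the increment of [f] but not [u - v]. *)
Lemma dissipative_nondecreasing f : C1 f -> (forall r, 0 <= derive1 f r) -> dissipative 0 f.
Proof.
move=> cf f0 M K K0.
have [L L0 HL] := continuous_bounded_itv (- M) M cf.2.
have L1 : 0 < L + 1 by rewrite ltr_wpDl.
exists (L + 1)^-1; first by rewrite invr_gt0.
move=> u v uM vM; have [e eM ->] := C1_MVT cf uM vM.
have eM' : - M <= e <= M by rewrite -ler_norml.
have e2 : derive1 f e <= L + 1.
  by rewrite (le_trans (ler_norm _))// (le_trans (HL _ eM'))// lerDl.
have := f0 e; move: (derive1 f e) e2 => be e2 be0.
rewrite !mul0r addr0 ler_pdivrMl//.
rewrite (_ : (be * _) ^+ 2 = be * be * (u - v) ^+ 2); last by ring.
rewrite (_ : (L + 1) * _ = (2 * (L + 1) * be) * (u - v) ^+ 2); last by ring.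
rewrite ler_wpM2r ?sqr_ge0// ler_wpM2r//; lra.
Qed.

End C1_functions.

Section reduction.
Context {R : realType} {d : nat}.
Local Notation E := 'rV[R]_d.
Local Notation mu := (@lebesgue_rV R d).
Local Notation leb := (@lebesgue_measure R).
Local Notation Q := (@lebesgue_measure R \x @lebesgue_rV R d)%E.

Lemma measurable_time_space (T : R) :
  measurable (time_space T : set (measurableTypeR R * E)).
Proof. by apply: measurableX => //; exact: measurable_itv. Qed.

Lemma coord_le_enorm (x : E) i : `|x ord0 i| <= enorm x.
Proof.
rewrite -sqrtr_sqr ler_sqrt ?dot_ge0// /dot (bigD1 i)//= -expr2 lerDl.
by apply: sumr_ge0 => j _; rewrite -expr2 sqr_ge0.
Qed.

Lemma uniqueness_dissipative (s T a : R) (beta b : R -> R) (D : E -> E)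
    (u0 : {charge set E -> \bar R}) (y1 y2 : R * E -> R) :
  2^-1 < s < 1 -> C1 beta -> beta 0 = 0 -> Linfty_field D -> C1 b ->
  Lp_time_space T +oo%E y1 -> Lp_time_space T +oo%E y2 ->
  distributional_solution T s beta b D u0 y1 ->
  distributional_solution T s beta b D u0 y2 ->
  Lp_time_space T 1%E (y1 \- y2) ->
  dissipative a beta -> a = 1 \/ a = 0 /\ {ae mu, forall x, D x = 0} ->
  y1 = y2 %[ae time_space_measure in time_space T].
Proof.
move=> hs Cbeta beta0 [mD hD] Cb hy1 hy2 sol1 sol2 hL1 diss aD.
pose S : set (measurableTypeR R * E) := time_space T.
have mS : measurable S := measurable_time_space T.
pose Y (y : R * E -> R) : measurableTypeR R * E -> R := y \_ S.
have [mY1 [M1 M10 HM1]] := Lfun_infty_bounded hy1.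
have [mY2 [M2 M20 HM2]] := Lfun_infty_bounded hy2.
have [_ [MD MD0 HMD]] := Lfun_infty_bounded hD.
have dL1 : L1 Q (Y (y1 \- y2)) by apply/Lfun1_integrable; exact: hL1.
have aeD : {ae mu, forall x, a = 0 -> D x = 0}.
  case: aD => [->|[_ D0]]; first by apply: aeW => x /eqP; rewrite oner_eq0.
  have [A [mA A0 sA]] := D0; exists A; split => // x /= nx; apply: sA => /= e; apply: nx => _.
  exact: e.
(* One null set gathers the exceptions to the bounds on [y1], [y2] and [D], to the vanishing of [D]
   when [a = 0], and to the integrability of the time slices. *)
have [N [mN N0 sN]] := ae_and (ae_and (ae_and (HM1 : {ae Q, _}) (HM2 : {ae Q, _}))
  (ae_and (@ae_snd _ _ _ _ _ leb mu _ HMD) (@ae_snd _ _ _ _ _ leb mu _ aeD)))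
  (@ae_fst _ _ _ _ _ leb mu _ (@ae_L1_slice _ _ _ _ _ leb mu _ dL1)).
pose B := S `\` N.
have mB : measurable B by exact: measurableD.
pose e p : R := \1_B p.
have me : measurable_fun setT e by exact: measurable_indic.
have eB p : B p -> e p = 1 by move=> Bp; rewrite /e indicE mem_set.
have eNB p : ~ B p -> e p = 0 by move=> Bp; rewrite /e indicE memNset.
have good p : B p -> [/\ `|Y y1 p| <= M1, `|Y y2 p| <= M2, `|enorm (D p.2)| <= MD,
    a = 0 -> D p.2 = 0 & L1 mu (fun x => Y (y1 \- y2) (p.1, x))].
  move=> [Sp Np]; apply: contrapT => H; apply: Np; apply: sN => /= -[[[h1 h2] [h3 h4]] h5].
  exact: H.
have YB y p : B p -> Y y p = y p by move=> [Sp _]; rewrite /Y patchE mem_set.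
(* Cutting to [B] makes all bounds hold everywhere and lets the linear integrand
   be a restriction of the given ones, hence measurable. *)
pose v y p : R := e p * Y y p.
have vB y p : B p -> v y p = y p by move=> Bp; rewrite /v eB// mul1r YB.
have vNB y p : ~ B p -> v y p = 0 by move=> Bp; rewrite /v eNB// mul0r.
have mv1 : measurable_fun setT (v y1) by exact: measurable_funM.
have mv2 : measurable_fun setT (v y2) by exact: measurable_funM.
pose M := Num.max M1 M2.
have bnd p : `|v y1 p| <= M /\ `|v y2 p| <= M.
  have [Bp|Bp] := pselect (B p); last by rewrite !vNB// normr0 /M le_max M10.
  have [h1 h2 _ _ _] := good p Bp; rewrite /v eB// !mul1r /M !le_max h1 h2 orbT//.
have [v1M v2M] : (forall p, `|v y1 p| <= M) /\ (forall p, `|v y2 p| <= M).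
  by split => p; have [] := bnd p.
pose h r := b r * r.
have [Lb Lb0 HLb] := C1_Lipschitz M Cbeta.
have [Lh Lh0 HLh] := C1_Lipschitz M (C1_mul_id Cb).
pose z t x := v y1 (t, x) - v y2 (t, x).
pose w t x := beta (v y1 (t, x)) - beta (v y2 (t, x)).
pose g i t x := D x ord0 i * (h (v y1 (t, x)) - h (v y2 (t, x))).
pose L := Lb + MD * Lh.
have zB t x : B (t, x) -> z t x = Y (y1 \- y2) (t, x).
  by move=> Bp; rewrite /z !vB// YB.
have zNB t x : ~ B (t, x) -> z t x = 0 by move=> Bp; rewrite /z !vNB// subrr.
have zY t x : `|z t x| <= `|Y (y1 \- y2) (t, x)|.
  by have [Bp|Bp] := pselect (B (t, x)); [rewrite zB|rewrite zNB// normr0].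
have uncurry (f : measurableTypeR R * E -> R) : measurable_fun setT f ->
    measurable_fun setT (fun p : measurableTypeR R * E => f (p.1, p.2)).
  by move=> mf; rewrite (_ : (fun p => _) = f)//; apply/funext => -[].
have mz : measurable_fun setT (fun p : measurableTypeR R * E => z p.1 p.2).
  exact: (uncurry _ (measurable_funB mv1 mv2)).
have mw : measurable_fun setT (fun p : measurableTypeR R * E => w p.1 p.2).
  apply: (uncurry (fun p => beta (v y1 p) - beta (v y2 p))).
  by apply: measurable_funB; apply: measurableT_comp => //; exact: C1_measurable.
have mh : measurable_fun setT h by apply: C1_measurable; exact: C1_mul_id.
have mg i : measurable_fun setT (fun p : measurableTypeR R * E => g i p.1 p.2).
  apply: (uncurry (fun p => D p.2 ord0 i * (h (v y1 p) - h (v y2 p)))).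
  apply: measurable_funM; last by apply: measurable_funB; apply: measurableT_comp.
  exact: (measurableT_comp (measurable_coord i) (measurableT_comp mD measurable_snd)).
have z0 t x : ~~ (0 < t < T) -> z t x = 0.
  by move=> tT; apply: zNB => -[[/= t0 _] _]; move: tT; rewrite in_itv/= in t0; rewrite t0.
have zM t x : `|z t x| <= 2 * M.
  have := ler_normB (v y1 (t, x)) (v y2 (t, x)).
  by have := v1M (t, x); have := v2M (t, x); rewrite -/(z t x); lra.
have wL t x : `|w t x| <= L * `|z t x|.
  apply: (le_trans (HLb _ _ (v1M _) (v2M _))); rewrite ler_wpM2r// lerDl mulr_ge0//.
  exact: ltW.
have gL' i t x : `|g i t x| <= MD * Lh * `|z t x|.
  have [Bp|Bp] := pselect (B (t, x)); last by rewrite /g !vNB// subrr mulr0 normr0 mulr_ge0// mulr_ge0// ltW.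
  have [_ _ h3 _ _] := good _ Bp.
  rewrite normrM -mulrA ler_pM//; last exact: HLh.
  exact: le_trans (coord_le_enorm _ _) (le_trans (ler_norm _) h3).
have gL i t x : `|g i t x| <= L * `|z t x|.
  by apply: (le_trans (gL' i t x)); rewrite ler_wpM2r// lerDr ltW.
have zi : L1 Q (fun p => z p.1 p.2).
  apply: (@L1_le _ _ _ Q _ (fun p => `|Y (y1 \- y2) p|)) => //; first exact: L1_abs.
  by move=> [t x]; exact: zY.
(* The slice condition depends on [t] alone: one point of [B] at time [t] ensures it, and without
   such a point [z t] is 0. *)
have zt t : L1 mu (z t).
  have [[x0 Bx]|nB] := pselect (exists x, B (t, x)); last first.
    rewrite (_ : z t = fun=> 0); first exact: L1_0.
    by apply/funext => x; apply: zNB => Bx; apply: nB; exists x.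
  have [_ _ _ _ /= h5] := good _ Bx.
  apply: (@L1_le _ _ _ mu _ (fun x => `|Y (y1 \- y2) (t, x)|)); last exact: zY.
    exact: (measurable_slice mz t).
  exact: L1_abs.
(* Each component of [g] is at most [MD * Lh * |z|]; this choice of [K] makes [|g|^2 <= K z^2], so
   that the term with [1 + K] covers both [|g|^2] and [z^2]. *)
have [k k0 Hk] := diss M (\sum_(i < d) (MD * Lh) ^+ 2) (sumr_ge0 _ (fun i _ => sqr_ge0 (MD * Lh))).
have g00 : a = 0 -> forall i t x, g i t x = 0.
  move=> a0 i t x; have [Bp|Bp] := pselect (B (t, x)); last by rewrite /g !vNB// subrr mulr0.
  by have [_ _ _ h4 _] := good _ Bp; rewrite /g (h4 a0) mxE mul0r.
have ag : a = 1 \/ a = 0 /\ forall i t x, g i t x = 0.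
  by case: aD => [->|[a0 _]]; [left|right; split => //; exact: g00].
have dis t x : k * (w t x ^+ 2 + \sum_(i < d) g i t x ^+ 2 + a * z t x ^+ 2) <= 2 * (z t x * w t x).
  apply: le_trans (Hk _ _ (v1M (t, x)) (v2M (t, x))); apply: ler_wpM2l; first exact: ltW.
  rewrite -addrA lerD2l mulrDr mulr1 mulrDl addrC lerD2l.
  case: ag => [->|[-> g0]].
    rewrite mul1r mulr_suml; apply: ler_sum => i _.
    rewrite -(real_normK (num_real (g i t x))) -(real_normK (num_real (_ - _))) -exprMn.
    by rewrite ler_pXn2r ?nnegrE// mulr_ge0// mulr_ge0// ltW.
  by rewrite mul0r mul0r big1// => i _; rewrite g0 expr0n.
have weak : linear_solution s T z w g.
  move=> phi tphi.
  pose W y p : R := weak_integrand s beta b D y phi p.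
  have [I1 e1] := sol1 _ tphi; have [I2 e2] := sol2 _ tphi.
  have sub (y : R * E -> R) : time_space_measure.-integrable (time_space T)
      (EFin \o weak_integrand s beta b D y phi) -> L1 Q (Y (W y)).
    by move=> /(integrable_mkcond _ mS); rewrite restrict_EFin.
  have J1 := sub _ I1; have J2 := sub _ I2.
  have E p : linear_integrand s z w g phi p = e p * (Y (W y1) p - Y (W y2) p).
    case: p => t x; rewrite /linear_integrand/=.
    have [Bp|Bp] := pselect (B (t, x)); last first.
      rewrite eNB// mul0r zNB// /w !vNB// subrr !mul0r subr0 big1 ?addr0// => i _.
      by rewrite /g !vNB// subrr mulr0 mul0r.
    rewrite eB// mul1r !YB// /W /weak_integrand/= /z /w !vB//.
    under eq_bigr do rewrite /g !vB// mulrAC.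
    rewrite -mulr_suml -/(dot (D x) (space_grad phi (t, x))) /h.
    by ring.
  have J : L1 Q (fun p => Y (W y1) p - Y (W y2) p) by exact: L1B.
  have eJ : L1 Q (fun p => e p * (Y (W y1) p - Y (W y2) p)).
    apply: (@L1_bounded_mul _ _ _ Q 1) => // p.
    by rewrite /e indicE normr_nat lern1 leq_b1.
  rewrite (_ : linear_integrand _ _ _ _ _ = fun p => e p * (Y (W y1) p - Y (W y2) p)); last exact/funext.
  split; first exact: eJ.
  transitivity (\int[Q]_p (Y (W y1) p - Y (W y2) p)).
    apply: Rint_ae_eq; [exact: L1_measurable eJ|exact: L1_measurable J|].
    (* The cut [e] differs from the indicator of the strip only on [N]. *)
    exists N; split => // p /= np; apply: contrapT => Np; apply: np.
    have [Bp|Bp] := pselect (B p); first by rewrite eB// mul1r.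
    have Sp : ~ S p by move=> Sp; apply: Bp.
    by rewrite /Y !patchE memNset// subrr mulr0.
  rewrite RintB// /Y -!Rintegral_mkcond; apply/eqP; rewrite subr_eq0; apply/eqP.
  (* The term with [u0] is the same in both formulations and cancels. *)
  exact: (addIr _ (etrans e1 (esym e2))).
have [A [mA A0 sA]] := linear_uniqueness hs mz mw mg z0 zM wL gL zi zt weak k0 dis ag.
exists (A `|` N); split.
- exact: measurableU.
- by rewrite measureU0.
- move=> p /= np; have [Ap|Ap] := pselect (A p); [by left|right].
  apply: contrapT => Np; apply: np => Sp; have Bp : B p by [].
  have : z p.1 p.2 = 0 by apply: contrapT => zp; apply: Ap; exact: sA.
  case: p Bp {Ap Np Sp} => t x Bp /=; rewrite /z !vB// => /eqP.
  by rewrite subr_eq0 => /eqP.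
Qed.
End reduction.

Theorem theorem3p1 (R : realType) (d : nat) (s T : R) (beta b : R -> R)
    (D : 'rV[R]_d -> 'rV[R]_d) (u0 : {charge set 'rV[R]_d -> \bar R})
    (y1 y2 : R * 'rV[R]_d -> R)
    (hd : (1 <= d)%N) (hs : 2^-1 < s < 1) (hT : 0 < T)
    (hbeta : C1 beta) (hbeta0 : beta 0 = 0)
    (hD : Linfty_field D)
    (hb : C1 b)
    (hy1 : Lp_time_space T +oo%E y1) (hy2 : Lp_time_space T +oo%E y2)
    (sol1 : distributional_solution T s beta b D u0 y1)
    (sol2 : distributional_solution T s beta b D u0 y2)
    (hL1 : Lp_time_space T 1%E (y1 \- y2))
    (hL2 : Linfty_L2 T (y1 \- y2))
    (h0 : vanishes_initially (y1 \- y2)) :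
  ((forall r, 0 < derive1 beta r) ->
    y1 = y2 %[ae time_space_measure in time_space T]) /\
  (D = cst 0 %[ae lebesgue_rV d] -> (forall r, 0 <= derive1 beta r) ->
    y1 = y2 %[ae time_space_measure in time_space T]).
Proof.
split=> [beta_pos|D0 beta_ge0].
  apply: (uniqueness_dissipative hs hbeta hbeta0 hD hb hy1 hy2 sol1 sol2 hL1).
    exact: dissipative_increasing.
  by left.
apply: (uniqueness_dissipative hs hbeta hbeta0 hD hb hy1 hy2 sol1 sol2 hL1).
  exact: dissipative_nondecreasing.
right; split => //; have [A [mA A0 sA]] := D0; exists A; split => // x /= nx.
by apply: sA => /= h; apply: nx; exact: h.
Qed.
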